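(* Let $M_t$, $t\in[0,T)$, be a family of smooth closed strictly convex surfaces in $\mathbb{R}^3$ flowing according to $\frac{d}{dt}X=-H^3\nu$. Then $$\max_{M_t}\frac{(\lambda_1^2+\lambda_1\lambda_2+\lambda_2^2)(\lambda_1+\lambda_2)^2(\lambda_1-\lambda_2)^2}{2(\lambda_1^2-\lambda_1\lambda_2+\lambda_2^2)\lambda_1\lambda_2}$$ is non-increasing in time.
   Context: A closed surface is a compact connected embedded surface without boundary. $X=X(x,t)$ is the (smooth) embedding vector of $M_t$ into $\mathbb{R}^3$, $\frac{d}{dt}X$ its total time derivative, and $\nu$ the outer unit normal to $M_t$. The principal curvatures $\lambda_1,\lambda_2$ are the eigenvalues of the second fundamental form with respect to the induced metric, with sign such that round spheres have positive principal curvatures. A surface is strictly convex if all its principal curvatures are strictly positive. $H=\lambda_1+\lambda_2$. *)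

(* Defs.v *)
From HB Require Import structures.
From mathcomp Require Import all_boot all_order all_algebra.
From mathcomp Require Import all_classical all_reals all_analysis.

Set Implicit Arguments.
Unset Strict Implicit.
Unset Printing Implicit Defensive.

Import Order.TTheory GRing.Theory Num.Theory.
Import numFieldNormedType.Exports.

Local Open Scope classical_set_scope.
Local Open Scope ring_scope.

(* Surfaces in R^3 and smooth maps between arbitrary subsets of Euclidean     *)
(* spaces, following Milnor's "Topology from the differentiable viewpoint".   *)
(* The topology on 'rV[R]_n is the usual one, but the library norm is the sup *)
(* norm; the Euclidean structure enters only through [dot].                   *)

Section Smooth.
Context {R : realType}.

Definition iter_derive (V W : normedModType R) (f : V -> W) (vs : seq V) :
    V -> W :=
  foldr (fun v g => fun x => 'D_v g x) f vs.

(* On an open set of a finite-dimensional space this is C^oo. *)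
Definition smooth_on_open (V W : normedModType R) (O : set V) (f : V -> W) :=
  forall (vs : seq V) (x : V), O x ->
    {for x, continuous (iter_derive f vs)} /\
    (forall v : V, derivable (iter_derive f vs) x v).

(* Smoothness on a set A that need not be open: f locally extends to a smooth *)
(* map.  For A of the form M x [0, T[ this is smoothness up to time 0.        *)
Definition smooth_on (V W : normedModType R) (A : set V) (f : V -> W) :=
  forall x, A x -> exists (O : set V) (g : V -> W),
    [/\ open O, O x, smooth_on_open O g & {in A `&` O, f =1 g}].

Definition diffeo_onto (V W : normedModType R) (A : set V) (B : set W)
    (f : V -> W) :=
  smooth_on A f /\
  exists g : W -> V,
    [/\ smooth_on B g, f @` A = B, {in A, cancel f g} & {in B, cancel g f}].

End Smooth.

Section Surfaces.
Context {R : realType}.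

Definition dot (n : nat) (u v : 'rV[R]_n) : R := (u *m v^T) 0 0.

(* phi is a diffeomorphism from an open subset U of R^2 onto a relatively     *)
(* open subset of S.                                                          *)
Definition local_param (S : set 'rV[R]_3) (U : set 'rV[R]_2)
    (phi : 'rV[R]_2 -> 'rV[R]_3) :=
  [/\ open U, diffeo_onto U (phi @` U) phi &
      exists2 O : set 'rV[R]_3, open O & phi @` U = S `&` O].

Definition closed_surface (S : set 'rV[R]_3) :=
  [/\ S !=set0, compact S, connected S &
      forall p, S p -> exists U phi, local_param S U phi /\ (phi @` U) p].

(* The unbounded component of the complement of a closed surface. *)
Definition exterior (S : set 'rV[R]_3) : set 'rV[R]_3 :=
  [set x | ~ S x /\ ~ bounded_set (connected_component (~` S) x)].

Definition partial (phi : 'rV[R]_2 -> 'rV[R]_3) (i : 'I_2) :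
    'rV[R]_2 -> 'rV[R]_3 :=
  fun u => 'D_(delta_mx 0 i) phi u.

Definition outer_unit_normal (S : set 'rV[R]_3) (nu : 'rV[R]_3 -> 'rV[R]_3) :=
  forall p, S p ->
    [/\ dot (nu p) (nu p) = 1,
        forall U phi u, local_param S U phi -> U u -> phi u = p ->
          forall i, dot (partial phi i u) (nu p) = 0 &
        \forall e \near 0^'+, exterior S (p + e *: nu p)].

Definition first_fundamental_form (phi : 'rV[R]_2 -> 'rV[R]_3)
    (u : 'rV[R]_2) : 'M[R]_2 :=
  \matrix_(i, j) dot (partial phi i u) (partial phi j u).

(* The minus sign makes round spheres positive for the outer normal n. *)
Definition second_fundamental_form (phi : 'rV[R]_2 -> 'rV[R]_3)
    (n : 'rV[R]_3) (u : 'rV[R]_2) : 'M[R]_2 :=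
  \matrix_(i, j) - dot (partial (partial phi i) j u) n.

(* l1 p and l2 p are the eigenvalues, listed with multiplicity and in no      *)
(* particular order, of the second fundamental form with respect to the first *)
(* one.  Changing phi conjugates the matrix g^-1 h, so quantifying over all   *)
(* local parametrizations around p fixes the same pair as using a single one. *)
Definition principal_curvatures (S : set 'rV[R]_3)
    (nu : 'rV[R]_3 -> 'rV[R]_3) (l1 l2 : 'rV[R]_3 -> R) :=
  forall U phi u, local_param S U phi -> U u ->
    char_poly (invmx (first_fundamental_form phi u) *m
               second_fundamental_form phi (nu (phi u)) u) =
    ('X - (l1 (phi u))%:P) * ('X - (l2 (phi u))%:P).

Definition strictly_convex (S : set 'rV[R]_3) (l1 l2 : 'rV[R]_3 -> R) :=
  forall p, S p -> 0 < l1 p /\ 0 < l2 p.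

(* F is differentiable at t relatively to I, with derivative v: the           *)
(* derivative is one-sided when t is an endpoint of I.                        *)
Definition is_derive_within (I : set R) (F : R -> 'rV[R]_3) (t : R)
    (v : 'rV[R]_3) :=
  (s - t)^-1 *: (F s - F t) @[s --> within I t^'] --> v.

(* X t, restricted to the fixed parameter surface N, is the embedding vector  *)
(* of M t.                                                                    *)
Definition smooth_family (I : set R) (N : set 'rV[R]_3)
    (X : R -> 'rV[R]_3 -> 'rV[R]_3) (M : R -> set 'rV[R]_3) :=
  [/\ closed_surface N,
      smooth_on (N `*` I) (fun z : 'rV[R]_3 * R => X z.2 z.1) &
      forall t, I t -> diffeo_onto N (M t) (X t)].

Definition is_max (A : set R) (m : R) := A m /\ ubound A m.

Definition curvature_quantity (a b : R) : R :=
  ((a ^+ 2 + a * b + b ^+ 2) * (a + b) ^+ 2 * (a - b) ^+ 2) /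
  (2 * (a ^+ 2 - a * b + b ^+ 2) * (a * b)).

End Surfaces.

(* Main.v *)
Require Import Defs.
From HB Require Import structures.
From mathcomp Require Import all_boot all_order all_algebra.
From mathcomp Require Import all_classical all_reals all_analysis.
From mathcomp Require Import ring lra.

Set Implicit Arguments.
Unset Strict Implicit.
Unset Printing Implicit Defensive.

Import Order.TTheory GRing.Theory Num.Theory.
Import numFieldNormedType.Exports.

Local Open Scope classical_set_scope.
Local Open Scope ring_scope.

(** The quantity is w = P / Q with P = (H^2 - K) H^2 (H^2 - 4 K) and
    Q = 2 (H^2 - 3 K) K, where H and K are the mean and Gauss curvatures.  Being
    rational in H^2 and K, it is smooth on strictly convex surfaces, although
    the principal curvatures themselves are not smooth at umbilic points.

    The proof is a maximum principle.  If the maximum of w increased between two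
    times, then by compactness w - e t, for a small e > 0, would be maximal over
    that time interval at some (x0, t0) with t0 > 0 ([quantity_max],
    [quantity_nonincreasing]): w(., t0) is maximal at x0 with value c, and
    w(x0, .) grows at rate at least e up to time t0.  This is excluded by a
    computation at that point ([no_growth]).

    Near (x0, t0) the surface is a graph over its tangent plane at (x0, t0), of
    height f = - <X, n> with n the outer normal there.  The projection onto the
    tangent plane is not inverted.  In any chart one takes the vector fields E0
    and E1 dual to the differentials of the two tangential coordinates h0 and h1,
    and Et = d/dt - (dh0/dt) E0 - (dh1/dt) E1.  Their brackets kill h0, h1 and t,
    hence vanish ([field_commute]), so that E0, E1, Et act on f as the partial
    derivatives act on the function whose graph is the surface.  With
      D = 1 + |Df|^2,  L = det D^2 f,
      N = (1 + f1^2) f00 - 2 f0 f1 f01 + (1 + f0^2) f11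
    one gets H^2 D^3 = N^2, K D^2 = L and Et f D^4 = N^3
    ([mean_curvature_graph], [gauss_curvature_graph], [speed_graph]); since only
    these even combinations occur, neither a square root nor the sign of the
    normal remains.  Everything becomes polynomial in derivatives of f: the
    function Z = D^9 (P - c Q) = D^9 Q (w - c) ([level_graph]) has a spatial
    maximum, equal to 0, at x0, and its time derivative there must be shown to be
    nonpositive ([level_dt_le0]).

    In Et Z - 3 H^2 (E0 E0 Z + E1 E1 Z) the fourth derivatives of f cancel
    ([level_nonincreasing]).  In directions where D^2 f = diag(a, b) there remain
    a term without third derivatives, whose product with Q is
    - 24 (a + b)^4 (a b)^4 (a - b)^2 ([zero_order_le0]), and two quadratic forms,
    one in (f000, f011) and one in (f111, f001).  The critical point equations
    E0 Z = 0 and E1 Z = 0 restrict each form to a line, on which its sign is that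
    of an explicit polynomial in a and b ([gradient_le0], [gradient_poly_ge0]).
    At an umbilic point the equations are void, but there c = 0 and Et Z = 0
    outright.  Together with E0 E0 Z <= 0 and E1 E1 Z <= 0 this gives Et Z <= 0,
    whereas growth of w at rate e forces Et Z > 0.

    The calculus behind this rests on iterated directional derivatives: functions
    that have them all form an algebra stable under composition ([Ck_comp]), are
    differentiable ([smooth_differentiable]) and have symmetric second
    derivatives ([derive_comm]).  Positivity of the principal curvatures makes
    the first fundamental form nonsingular in every chart
    ([principal_curvature_equations]), so every chart may be used. *)

(** * Smooth functions on open sets *)

Section SmoothCalculus.
Context {R : realType}.
Implicit Types V W : normedModType R.

(** Smoothness is a statement about all finite sequences of directions;
    closure properties need an induction on the number of derivatives that
    carries all of them at once, which this level-by-level version provides. *)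
Fixpoint Ck V W (O : set V) (n : nat) (f : V -> W) : Prop :=
  (forall x, O x -> {for x, continuous f}) /\
  if n is n'.+1 then
    (forall x v, O x -> derivable f x v) /\ forall v, Ck O n' ('D_v f)
  else True.

Lemma iter_derive_rcons V W (f : V -> W) vs v :
  iter_derive f (rcons vs v) = iter_derive ('D_v f) vs.
Proof. by rewrite /iter_derive foldr_rcons. Qed.

Lemma smooth_continuous V W (O : set V) (f : V -> W) x :
  smooth_on_open O f -> O x -> {for x, continuous f}.
Proof. by move=> sf Ox; have [] := sf [::] x Ox. Qed.

Lemma smooth_derivable V W (O : set V) (f : V -> W) x v :
  smooth_on_open O f -> O x -> derivable f x v.
Proof. by move=> sf Ox; have [_] := sf [::] x Ox. Qed.

Lemma smooth_derive V W (O : set V) (f : V -> W) v :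
  smooth_on_open O f -> smooth_on_open O ('D_v f).
Proof. by move=> sf vs; rewrite -iter_derive_rcons; apply: sf. Qed.

Lemma smooth_CkP V W (O : set V) (f : V -> W) :
  smooth_on_open O f <-> forall n, Ck O n f.
Proof.
split=> [sf n|].
  elim: n f sf => [|n IH] f sf /=; split.
  - by move=> x; apply: smooth_continuous.
  - by [].
  - by move=> x; apply: smooth_continuous.
  - split=> [x v|v]; first exact: smooth_derivable.
    by apply/IH/smooth_derive.
move=> cf vs; elim/last_ind: vs f cf => [|vs v IH] f cf.
  by move=> x Ox; have [c [d _]] := cf 1; split=> [|v]; [exact: c|exact: d].
by rewrite iter_derive_rcons; apply: IH => n; have [_ [_]] := cf n.+1; apply.
Qed.

Lemma near_open V (O : set V) (P : V -> Prop) x :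
  open O -> O x -> (forall y, O y -> P y) -> \near x, P x.
Proof. by move=> oO Ox OP; apply: filterS OP _; apply: open_nbhs_nbhs. Qed.

(** Derivatives at a point of an open set see only values on that set, so
    product, inverse and chain rules valid on O alone suffice below. *)
Lemma Ck_congr V W (O : set V) n (f g : V -> W) :
  open O -> {in O, f =1 g} -> Ck O n f -> Ck O n g.
Proof.
move=> oO; elim: n f g => [|n IH] f g fg [cf Cf].
  split=> // x Ox; have /cf := Ox.
  rewrite /continuous_at /prop_for /= -(fg x (mem_set Ox)).
  move=> cfx; apply: cvg_trans cfx; apply: near_eq_cvg.
  by apply: near_open Ox _ => // y Oy; rewrite fg ?inE.
split.
  move=> x Ox; have /cf := Ox.
  rewrite /continuous_at /prop_for /= -(fg x (mem_set Ox)).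
  move=> cfx; apply: cvg_trans cfx; apply: near_eq_cvg.
  by apply: near_open Ox _ => // y Oy; rewrite fg ?inE.
case: Cf => df Cf; split=> [x v Ox|v].
  apply: near_eq_derivable (df x v Ox).
  by apply: near_open Ox _ => // y Oy; rewrite fg ?inE.
apply: IH (Cf v) => x /set_mem Ox.
apply: near_eq_derive; apply: near_open Ox _ => // y Oy.
by rewrite fg ?inE.
Qed.

Lemma derive_congr V W (O : set V) (f g : V -> W) v x :
  open O -> {in O, f =1 g} -> O x -> 'D_v f x = 'D_v g x.
Proof.
move=> oO fg Ox; apply: near_eq_derive.
by apply: near_open Ox _ => // y Oy; rewrite fg ?inE.
Qed.

Lemma smooth_congr V W (O : set V) (f g : V -> W) :
  open O -> {in O, f =1 g} -> smooth_on_open O f -> smooth_on_open O g.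
Proof.
by move=> oO fg /smooth_CkP Cf; apply/smooth_CkP => n; apply: Ck_congr fg _.
Qed.

Lemma smooth_subset V W (O O' : set V) (f : V -> W) :
  O' `<=` O -> smooth_on_open O f -> smooth_on_open O' f.
Proof. by move=> OO sf vs x /OO; apply: sf. Qed.

Lemma Ck_cst V W (O : set V) n (a : W) : Ck O n (cst a).
Proof.
elim: n a => [|n IH] a /=; split=> //.
- by move=> x _; apply: cst_continuous.
- by move=> x _; apply: cst_continuous.
- split=> [x v _|v]; first exact: derivable_cst.
  by rewrite (_ : 'D_v (cst a) = cst 0) //; apply/funext => x; rewrite derive_cst.
Qed.

Lemma smooth_cst V W (O : set V) (a : W) : smooth_on_open O (cst a : V -> W).
Proof. by apply/smooth_CkP => n; apply: Ck_cst. Qed.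

Lemma Ck_pred V W (O : set V) n (f : V -> W) : Ck O n.+1 f -> Ck O n f.
Proof.
elim: n f => [|n IH] f [cf [df Cf]]; split=> //.
by split=> // v; apply: IH.
Qed.

Lemma Ck_add V W (O : set V) n (f g : V -> W) : open O ->
  Ck O n f -> Ck O n g -> Ck O n (f + g).
Proof.
move=> oO; elim: n f g => [|n IH] f g [cf Cf] [cg Cg]; split=> //.
- by move=> x Ox; apply: continuousD; [exact: cf|exact: cg].
- by move=> x Ox; apply: continuousD; [exact: cf|exact: cg].
case: Cf Cg => [df Cf] [dg Cg]; split=> [x v Ox|v].
  by apply: derivableD; [exact: df|exact: dg].
apply: (@Ck_congr _ _ _ _ ('D_v f + 'D_v g)) => //; last exact: IH (Cf v) (Cg v).
by move=> x /set_mem Ox; rewrite deriveD //; [exact: df|exact: dg].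
Qed.

Lemma smooth_add V W (O : set V) (f g : V -> W) : open O ->
  smooth_on_open O f -> smooth_on_open O g -> smooth_on_open O (fun x => f x + g x).
Proof.
move=> oO /smooth_CkP Cf /smooth_CkP Cg; apply/smooth_CkP => n.
exact: (Ck_add oO).
Qed.

Lemma Ck_mul V (O : set V) n (f g : V -> R) : open O ->
  Ck O n f -> Ck O n g -> Ck O n (f * g).
Proof.
move=> oO; elim: n f g => [|n IH] f g Cf Cg.
  case: Cf Cg => cf _ [cg _]; split=> // x Ox.
  by apply: continuousM; [exact: cf|exact: cg].
have [Cf' Cg'] := (Ck_pred Cf, Ck_pred Cg).
case: Cf Cg => [cf [df Cf]] [cg [dg Cg]]; split.
  by move=> x Ox; apply: continuousM; [exact: cf|exact: cg].
split=> [x v Ox|v].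
  by apply: derivableM; [exact: df|exact: dg].
apply: (@Ck_congr _ _ _ _ (f * 'D_v g + g * 'D_v f)) => //.
  by move=> x /set_mem Ox; rewrite deriveM //; [exact: df|exact: dg].
exact: Ck_add (IH _ _ Cf' (Cg v)) (IH _ _ Cg' (Cf v)).
Qed.

Lemma smooth_mul V (O : set V) (f g : V -> R) : open O ->
  smooth_on_open O f -> smooth_on_open O g -> smooth_on_open O (fun x => f x * g x).
Proof.
move=> oO /smooth_CkP Cf /smooth_CkP Cg; apply/smooth_CkP => n.
exact: Ck_mul.
Qed.

Lemma smooth_opp V (O : set V) (f : V -> R) : open O ->
  smooth_on_open O f -> smooth_on_open O (fun x => - f x).
Proof.
move=> oO sf; have sg := smooth_mul oO (@smooth_cst _ _ O (-1 : R)) sf.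
by apply: (smooth_congr oO _ sg) => x _; rewrite /cst mulN1r.
Qed.

(** The derivative of 1/f is again built from 1/f, so the induction feeds
    the hypothesis for 1/f back into the product rule. *)
Lemma Ck_inv V (O : set V) n (f : V -> R) : open O ->
  (forall x, O x -> f x != 0) -> Ck O n f -> Ck O n (fun x => (f x)^-1).
Proof.
move=> oO f0; elim: n => [|n IH] Cf.
  case: Cf => cf _; split=> // x Ox.
  by apply: continuousV; [exact: f0|exact: cf].
have Cf' := Ck_pred Cf; case: Cf => [cf [df Cf]]; split.
  by move=> x Ox; apply: continuousV; [exact: f0|exact: cf].
split=> [x v Ox|v].
  by apply: derivableV; [exact: f0|exact: df].
have CV := IH Cf'.
apply: (@Ck_congr _ _ _ _ (cst (-1) * ((fun x => (f x)^-1) *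
   ((fun x => (f x)^-1) * 'D_v f)))) => //.
  move=> x /set_mem Ox; rewrite deriveV //; [|exact: f0|exact: df].
  rewrite -![(_ * _) x]/(_ * _) /cst /= mulN1r mulrA -expr2 -exprVn.
  by rewrite [RHS]/GRing.scale /= mulNr.
exact: Ck_mul (Ck_cst _ _ _) (Ck_mul _ CV (Ck_mul _ CV (Cf v))).
Qed.

Lemma smooth_inv V (O : set V) (f : V -> R) : open O ->
  (forall x, O x -> f x != 0) -> smooth_on_open O f ->
  smooth_on_open O (fun x => (f x)^-1).
Proof.
move=> oO f0 /smooth_CkP Cf; apply/smooth_CkP => n; exact: Ck_inv.
Qed.

End SmoothCalculus.

(** * Linear coordinates *)

Section LinearMaps.
Context {R : realType}.
Implicit Types V W Z : normedModType R.

Lemma derive_lin_comp V W Z (L : {linear W -> Z}) (f : V -> W) x v :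
  continuous L -> derivable f x v ->
  derivable (L \o f) x v /\ 'D_v (L \o f) x = L ('D_v f x).
Proof.
move=> cL df.
have cvgL : h^-1 *: (((L \o f) \o shift x) (h *: v) - (L \o f) x) @[h --> 0^']
    --> L ('D_v f x).
  have -> : (fun h => h^-1 *: (((L \o f) \o shift x) (h *: v) - (L \o f) x)) =
            L \o (fun h => h^-1 *: ((f \o shift x) (h *: v) - f x)).
    by apply/funext => h /=; rewrite linearZ /= [in RHS]linearB scalerBr.
  exact: cvg_comp df (cL _).
by split; [apply/cvg_ex; exists (L ('D_v f x))|exact: cvg_lim].
Qed.

Lemma Ck_lin_comp V W Z (O : set V) n (L : {linear W -> Z}) (f : V -> W) :
  open O -> continuous L -> Ck O n f -> Ck O n (L \o f).
Proof.
move=> oO cL; elim: n f => [|n IH] f [cf Cf]; split.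
- by move=> x Ox; apply: continuous_comp; [exact: cf|exact: cL].
- by [].
- by move=> x Ox; apply: continuous_comp; [exact: cf|exact: cL].
case: Cf => df Cf; split=> [x v Ox|v].
  by have [] := derive_lin_comp cL (df x v Ox).
apply: (Ck_congr oO _ (IH _ (Cf v))) => x /set_mem Ox.
by have [_ ->] := derive_lin_comp cL (df x v Ox).
Qed.

Lemma smooth_lin_comp V W Z (O : set V) (L : {linear W -> Z}) (f : V -> W) :
  open O -> continuous L -> smooth_on_open O f -> smooth_on_open O (L \o f).
Proof.
by move=> oO cL /smooth_CkP Cf; apply/smooth_CkP => n; apply: Ck_lin_comp.
Qed.

Lemma smooth_id V (O : set V) : open O -> smooth_on_open O (@id V).
Proof.
move=> oO; have cid x : O x -> {for x, continuous (@id V)} by move=> _; exact: cvg_id.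
apply/smooth_CkP => -[|n]; split=> //.
split=> [x v _|v]; first exact: derivable_id.
by apply: (Ck_congr oO _ (Ck_cst O n v)) => x _; rewrite derive_id.
Qed.

Lemma smooth_lin V W (O : set V) (L : {linear V -> W}) :
  open O -> continuous L -> smooth_on_open O L.
Proof. by move=> oO cL; exact: (smooth_lin_comp oO cL (smooth_id oO)). Qed.

Lemma smooth_sum V W (O : set V) (I : Type) (s : seq I) (F : I -> V -> W) :
  open O -> (forall i, smooth_on_open O (F i)) ->
  smooth_on_open O (fun x => \sum_(i <- s) F i x).
Proof.
move=> oO sF; elim: s => [|i s IH].
  apply: (smooth_congr oO _ (@smooth_cst _ _ _ O (0 : W))) => x _.
  by rewrite big_nil.
apply: (smooth_congr oO _ (smooth_add oO (sF i) IH)) => x _.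
by rewrite big_cons.
Qed.

(** A finite basis whose coordinate forms have norm at most 1.  It makes one
    proof serve both for the space of row vectors and for its product with the
    time axis, which is not itself a space of row vectors. *)
Record coordinates V := Coordinates {
  cidx : finType;
  cvec : cidx -> V;
  cfun : cidx -> {linear V -> R};
  cfun_le : forall i v, `|cfun i v| <= `|v|;
  csum : forall v, v = \sum_i cfun i v *: cvec i }.

Lemma le_linear_continuous V (L : {linear V -> R}) :
  (forall v, `|L v| <= `|v|) -> continuous L.
Proof.
move=> L1 x; apply/cvgrPdist_lt => e e0; near=> y.
rewrite -linearB; apply: le_lt_trans (L1 _) _.
by near: y; apply: cvgr_dist_lt.
Unshelve. all: by end_near. Qed.

Lemma cfun_continuous V (c : coordinates V) i : continuous (cfun (c := c) i).
Proof. by apply: le_linear_continuous => v; apply: cfun_le. Qed.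

Lemma scalel_lin_continuous V (b : V) :
  exists2 L : {linear R -> V}, (forall k, L k = k *: b) & continuous L.
Proof.
pose d (h : R) := h *: b.
have lin_d : linear d by move=> ? ? ?; rewrite /d scalerDl scalerA.
pose dM := GRing.isLinear.Build _ _ _ _ _ lin_d.
pose dL : {linear _ -> _} := HB.pack d dM.
by exists dL => //; exact: scalel_continuous.
Qed.

Lemma smooth_scalel V W (O : set V) (f : V -> R) (b : W) : open O ->
  smooth_on_open O f -> smooth_on_open O (fun x => f x *: b).
Proof.
move=> oO sf; have [L LE cL] := scalel_lin_continuous b.
by apply: (smooth_congr oO _ (smooth_lin_comp oO cL sf)) => x _ /=.
Qed.

Lemma smooth_coordP V W (c : coordinates W) (O : set V) (f : V -> W) : open O ->
  smooth_on_open O f <-> forall i, smooth_on_open O (fun x => cfun (c := c) i (f x)).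
Proof.
move=> oO; split=> [sf i|sf].
  exact: (smooth_lin_comp oO (@cfun_continuous _ c i) sf).
have := smooth_sum (index_enum (cidx c)) oO
  (fun i => smooth_scalel (cvec i) oO (sf i)).
by apply: smooth_congr oO _ => x _; rewrite -csum.
Qed.

Definition rV_coord n (i : 'I_n) (v : 'rV[R]_n) : R := v 0 i.

Lemma rV_coord_linear n (i : 'I_n) : linear (rV_coord i).
Proof. by move=> a u v; rewrite /rV_coord !mxE. Qed.

HB.instance Definition _ n (i : 'I_n) :=
  GRing.isLinear.Build R 'rV[R]_n R _ _ (rV_coord_linear i).

Lemma rV_coord_le n (i : 'I_n) v : `|rV_coord i v| <= `|v|.
Proof.
rewrite /rV_coord [leRHS]/Num.Def.normr/= mx_normrE.
exact: (le_bigmax _ (fun i : 'I_1 * 'I_n => `|v i.1 i.2|) (0, i)).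
Qed.

Lemma rV_coord_sum n (v : 'rV[R]_n) :
  v = \sum_i rV_coord i v *: delta_mx 0 i.
Proof. exact: row_sum_delta. Qed.

Definition rV_coordinates n : coordinates 'rV[R]_n :=
  @Coordinates _ _ _ (fun i : 'I_n => @rV_coord n i) (@rV_coord_le n)
    (@rV_coord_sum n).

(** The extra index, of type unit, stands for the time coordinate. *)
Definition pair_coord V (c : coordinates V) (o : (cidx c + unit)%type)
    (p : V * R) : R :=
  if o is inl i then cfun i p.1 else p.2.

Lemma pair_coord_linear V (c : coordinates V) o : linear (@pair_coord V c o).
Proof. by move=> a u v; case: o => [i|] //=; rewrite linearP. Qed.

HB.instance Definition _ V (c : coordinates V) o :=
  GRing.isLinear.Build R (V * R)%type R _ _ (@pair_coord_linear V c o).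

Lemma pair_coord_le V (c : coordinates V) o (v : V * R) :
  `|@pair_coord V c o v| <= `|v|.
Proof.
rewrite prod_normE le_max; case: o => [i|] /=; last by rewrite lexx orbT.
by rewrite cfun_le.
Qed.

Definition pair_vec V (c : coordinates V) (o : (cidx c + unit)%type) : V * R :=
  if o is inl i then (cvec i, 0) else (0, 1).

Lemma pair_coord_sum V (c : coordinates V) (v : V * R) :
  v = \sum_o @pair_coord V c o v *: pair_vec o.
Proof.
rewrite big_sumType /= [X in _ + X](big_pred1 tt) //=.
have -> : \sum_i cfun (c := c) i v.1 *: (cvec i, 0) =
          (\sum_i cfun (c := c) i v.1 *: cvec (c := c) i, 0) :> V * R.
  elim/big_ind2: _ => //= [a x b y -> ->|i _].
    by congr (_, _); rewrite addr0.
  by congr (_, _); rewrite /= scaler0.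
rewrite -csum [LHS]surjective_pairing.
by congr (_, _) => /=; rewrite ?scaler0 ?addr0 // add0r [RHS]mulr1.
Qed.

Definition pair_coordinates V (c : coordinates V) : coordinates (V * R)%type :=
  @Coordinates _ _ (@pair_vec V c) (fun o => @pair_coord V c o) (@pair_coord_le V c)
    (@pair_coord_sum V c).

End LinearMaps.

(** * Differentiability, chain rule and symmetry of second derivatives *)

Section ChainRule.
Context {R : realType}.
Implicit Types V W : normedModType R.

Lemma derivable_line V W (f : V -> W) b y (t : R) :
  derivable f (t *: b + y) b ->
  is_derive t 1 (fun s : R => f (s *: b + y)) ('D_b f (t *: b + y)).
Proof.
have E : (fun h : R => h^-1 *: (((fun s : R => f (s *: b + y)) \o shift t) (h *: 1)
            - f (t *: b + y))) =
         (fun h => h^-1 *: ((f \o shift (t *: b + y)) (h *: b) - f (t *: b + y))).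
  apply/funext => h /=; congr (_ *: (f _ - _)).
  by rewrite [h *: 1]mulr1 scalerDl addrA.
move=> df; split; first by rewrite /derivable E.
by rewrite /derive E.
Qed.

(** Stated with absolute values so that k may have either sign. *)
Lemma mean_value_line V (f : V -> R) b y (k : R) :
  (forall t : R, `|t| <= `|k| -> derivable f (t *: b + y) b) ->
  exists2 t : R, `|t| <= `|k| & f (k *: b + y) - f y = k * 'D_b f (t *: b + y).
Proof.
move=> df; set g := fun s : R => f (s *: b + y).
have dg (t : R) : `|t| <= `|k| -> is_derive t 1 g ('D_b f (t *: b + y)).
  by move=> /df; apply: derivable_line.
have g0 : g 0 = f y by rewrite /g scale0r add0r.
have cg (a c : R) : (forall t : R, t \in `[a, c] -> `|t| <= `|k|) ->
    {within `[a, c], continuous g}.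
  move=> ac; apply: derivable_within_continuous => t /ac /dg.
  by case.
have [k0|k0] := leP 0 k.
  have le (t : R) : t \in `[0, k] -> `|t| <= `|k|.
    by rewrite in_itv /= => /andP[t0 tk]; rewrite !ger0_norm.
  have [|c /le ck E] := @MVT_segment R g (fun t => 'D_b f (t *: b + y)) _ _ k0 _ (cg _ _ le).
    by move=> t /subset_itv_oo_cc /le; apply: dg.
  by exists c => //; rewrite -[LHS]/(g k - _) -g0 E subr0 mulrC.
have le (t : R) : t \in `[k, 0] -> `|t| <= `|k|.
  by rewrite in_itv /= => /andP[kt t0]; rewrite !ler0_norm ?lerN2 // ltW.
have [|c /le ck E] := @MVT_segment R g (fun t => 'D_b f (t *: b + y)) _ _ (ltW k0) _ (cg _ _ le).
  by move=> t /subset_itv_oo_cc /le; apply: dg.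
by exists c => //; rewrite -[LHS]/(g k - _) -g0 -opprB E sub0r mulrN opprK mulrC.
Qed.

(** Moving along one basis vector at a time turns the increment of f into a
    telescoping sum; on each segment the mean value theorem gives a partial
    derivative at a point near x, and continuity of that derivative replaces it by
    its value at x.  Induction on the list s adds one segment at a time, which is
    why the base point y is not fixed to be x. *)
Lemma increment_approx V (O : set V) (f : V -> R) x (I : Type) (b : I -> V)
    (s : seq I) (e : R) :
  open O -> O x -> (forall y v, O y -> derivable f y v) ->
  (forall v, {for x, continuous ('D_v f)}) -> 0 < e ->
  exists2 d, 0 < d & forall y (k : I -> R), `|y - x| < d ->
    (forall i, `|k i| < d) ->
    `|f (\sum_(i <- s) k i *: b i + y) - f y - \sum_(i <- s) k i * 'D_(b i) f x|
      <= e * \sum_(i <- s) `|k i|.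
Proof.
move=> oO Ox df cf e0; elim: s => [|i s [d1 d10 IH]].
  exists 1 => // y k _ _.
  by rewrite !big_nil add0r !subrr normr0 mulr0.
have [r r0 Hr] : exists2 r : R, 0 < r & forall y, `|y - x| < r ->
    O y /\ `|'D_(b i) f y - 'D_(b i) f x| < e.
  have H1 : \forall y \near x, O y by apply: open_nbhs_nbhs.
  have H2 : \forall y \near x, `|'D_(b i) f x - 'D_(b i) f y| < e.
    by have /cvgrPdist_lt := cf (b i); apply.
  have H3 : \forall y \near x, O y /\ `|'D_(b i) f x - 'D_(b i) f y| < e
    by exact: filterI H1 H2.
  move/nbhs_normP : H3 => [r /= r0 H].
  exists r => // y yx; have [|Oy ye] := H y; first by rewrite /ball_ /= distrC.
  by split => //; rewrite distrC.
pose c := 2 * (1 + `|b i|); have c0 : 0 < c.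
  by rewrite /c mulr_gt0 // ltr_wpDr.
pose d := Num.min (d1 / c) (r / c).
have d0 : 0 < d by rewrite lt_min !divr_gt0.
have hd y t : `|y - x| < d -> `|t| < d -> `|t *: b i + y - x| < d1 /\ `|t *: b i + y - x| < r.
  move=> yx td; have : `|t *: b i + y - x| < d * c.
    rewrite -addrA; apply: le_lt_trans (ler_normD _ _) _; rewrite normrZ /c.
    have : `|t| * `|b i| <= d * `|b i| by rewrite ler_wpM2r // ltW.
    have := normr_ge0 (b i); nra.
  have [] : d * c <= d1 /\ d * c <= r.
    by rewrite -!ler_pdivlMr // !ge_min !lexx orbT.
  by move=> h1 h2 h3; split; apply: lt_le_trans h3 _.
exists d => // y k yx kd.
rewrite !big_cons.
(* first segment from y, the others from k i *: b i + y by induction *)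
have [|t tk E] := @mean_value_line V f (b i) y (k i).
  move=> t tk; apply: df.
  by have [_ /Hr[]] := hd y t yx (le_lt_trans tk (kd i)).
have [dk _] := hd y (k i) yx (kd i).
have dd1 : d <= d1.
  have : d * 1 <= d * c.
    by apply: ler_wpM2l; [exact: ltW|rewrite /c; have := normr_ge0 (b i); lra].
  by rewrite mulr1 => /le_trans; apply; rewrite -ler_pdivlMr // ge_min lexx.
have := IH (k i *: b i + y) k dk (fun j => lt_le_trans (kd j) dd1).
have [_ /Hr[_ Dt]] := hd y t yx (le_lt_trans tk (kd i)).
rewrite addrA [_ + \sum_(_ <- _) _]addrC -!addrA => Q.
set S := \sum_(j <- s) k j *: b j in Q *.
set T := \sum_(j <- s) k j * _ in Q *.
set A := f (S + _) in Q *.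
have -> : A + (- f y - (k i * 'D_(b i) f x + T)) =
  (A + (- f (k i *: b i + y) - T)) +
  k i * ('D_(b i) f (t *: b i + y) - 'D_(b i) f x).
  rewrite mulrBr -E; ring.
apply: le_trans (ler_normD _ _) _.
rewrite [leRHS]mulrDr [leRHS]addrC lerD // normrM mulrC.
by rewrite ler_wpM2r // ltW.
Qed.

Lemma smooth_differentiable V (c : coordinates V) (O : set V) (f : V -> R) x :
  open O -> O x -> smooth_on_open O f -> differentiable f x.
Proof.
move=> oO Ox sf.
pose L (v : V) : R := \sum_i cfun (c := c) i v * 'D_(cvec i) f x.
have linL : linear L.
  move=> a u v; have scE (z : R) : a *: z = a * z by [].
  rewrite /L scE mulr_sumr -big_split /=; apply: eq_bigr => i _.
  by rewrite linearP /= mulrDl scE mulrA.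
pose LM := GRing.isLinear.Build _ _ _ _ _ linL.
pose L' : {linear V -> R} := HB.pack L LM.
have cL : continuous L'.
  have sL := smooth_sum (index_enum (cidx c)) openT (fun i => smooth_scalel
    ('D_(cvec i) f x : R) openT (smooth_lin openT (@cfun_continuous _ _ c i))).
  by move=> v; apply: (smooth_continuous sL).
have D : f \o shift x = cst (f x) + L' +o_ 0 id.
  apply/eqaddoP => e e0.
  (* the error e / (1 + n) per coordinate adds up to at most e *)
  pose n := #|cidx c|%:R : R.
  have e1 : 0 < e / (1 + n) by rewrite divr_gt0 // ltr_wpDr // ler0n.
  have [d d0 H] := @increment_approx V O f x _ (@cvec _ _ c) (index_enum (cidx c)) _
    oO Ox (fun y v Oy => smooth_derivable (v := v) sf Oy)
    (fun v => smooth_continuous (smooth_derive v sf) Ox) e1.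
  near=> v.
  have vd : `|v| < d by near: v; apply: nbhs0_lt.
  have := H x (fun i => cfun i v); rewrite subrr normr0 => /(_ d0).
  move=> /(_ (fun i => le_lt_trans (cfun_le i v) vd)).
  rewrite -csum => Q.
  have -> : (f \o shift x - (cst (f x) + L')) v = f (v + x) - f x - L v.
    by rewrite -[LHS]/(f (v + x) - (f x + L v)) opprD addrA.
  apply: le_trans Q _; rewrite -mulrA ler_wpM2l ?(ltW e0) //.
  rewrite ler_pdivrMl; last by rewrite ltr_wpDr // ler0n.
  apply: (@le_trans _ _ (\sum_(i : cidx c) `|v|)).
    by apply: ler_sum => i _; apply: cfun_le.
  by rewrite sumr_const -mulr_natl ler_wpM2r // lerDr.
apply/diff_locallyP.
by rewrite (diff_unique cL D).
Unshelve. all: by end_near. Qed.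

End ChainRule.

Section Composition.
Context {R : realType}.
Implicit Types V W Z : normedModType R.

Lemma derive_line V W (f : V -> W) x v :
  'D_v f x = 'D_1 (fun h : R => f (h *: v + x)) 0.
Proof.
rewrite /derive.
set g1 := fun h => h^-1 *: _; set g2 := fun h => h^-1 *: _.
suff -> : g1 = g2 by [].
by apply/funext => h; rewrite /g1 /g2 /= addr0 scale0r add0r [_%:A]mulr1.
Qed.

(** On a line, derivability of f along v is differentiability of a curve,
    to which the chain rule for differentials applies. *)
Lemma derive_comp V W Z (f : V -> W) (g : W -> Z) x v :
  derivable f x v -> differentiable g (f x) ->
  derivable (g \o f) x v /\ 'D_v (g \o f) x = 'D_('D_v f x) g (f x).
Proof.
move=> /derivable1P/derivable1_diffP dc dg.
pose c := fun h : R => f (h *: v + x).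
have c0 : c 0 = f x by rewrite /c scale0r add0r.
have dgc : differentiable (g \o c) 0.
  have dgc0 : differentiable g (c 0) by rewrite c0.
  exact: (differentiable_comp dc dgc0).
split.
  by apply/derivable1P/derivable1_diffP.
rewrite derive_line -[LHS]/('D_1 (g \o c) 0) deriveE // diff_comp //; last by rewrite c0.
by rewrite /= -(deriveE _ dc) -derive_line c0 -deriveE.
Qed.

Lemma derive_sum_coords V (c : coordinates V) (f : V -> R) x v :
  differentiable f x ->
  'D_v f x = \sum_i cfun (c := c) i v * 'D_(cvec (c := c) i) f x.
Proof.
move=> df; rewrite deriveE // {1}[v](csum c) linear_sum /=.
by apply: eq_bigr => i _; rewrite linearZ /= -deriveE.
Qed.

(** The chain rule writes each derivative of g o f as a finite sum of products
    of a derivative of a coordinate of f with a derivative of g composed with f,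
    so smoothness of g o f to order n gives it to order n + 1. *)
Lemma Ck_comp V W (c : coordinates W) (O : set V) (O' : set W) n
    (f : V -> W) (g : W -> R) :
  open O -> open O' -> (forall x, O x -> O' (f x)) ->
  smooth_on_open O f -> smooth_on_open O' g -> Ck O n (g \o f).
Proof.
move=> oO oO' OO' sf; elim: n g => [|n IH] g sg.
  split=> // x Ox; apply: continuous_comp; first exact: smooth_continuous Ox.
  by apply: smooth_continuous (OO' _ Ox).
split.
  move=> x Ox; apply: continuous_comp; first exact: smooth_continuous Ox.
  by apply: smooth_continuous (OO' _ Ox).
have dg x : O x -> differentiable g (f x).
  by move=> Ox; apply: (smooth_differentiable c oO' (OO' _ Ox)).
split=> [x v Ox|v].
  by have [] := derive_comp (smooth_derivable (v := v) sf Ox) (dg _ Ox).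
have sF i : Ck O n (fun x => cfun (c := c) i ('D_v f x) *
    ('D_(cvec (c := c) i) g \o f) x).
  apply: (Ck_mul oO); last by apply: IH; apply: smooth_derive.
  have := smooth_lin_comp oO (@cfun_continuous _ _ c i) (smooth_derive v sf).
  by move/smooth_CkP; apply.
suff : Ck O n (fun x => \sum_i cfun (c := c) i ('D_v f x) *
    ('D_(cvec (c := c) i) g \o f) x).
  apply: Ck_congr => // x /set_mem Ox.
  have [_ ->] := derive_comp (smooth_derivable (v := v) sf Ox) (dg _ Ox).
  by rewrite (derive_sum_coords c _ (dg _ Ox)).
elim: (index_enum _) => [|i s IHs].
  by apply: (Ck_congr oO _ (Ck_cst O n (0 : R))) => x _; rewrite big_nil.
apply: (Ck_congr oO _ (Ck_add oO (sF i) IHs)) => x _.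
by rewrite big_cons.
Qed.

Lemma smooth_comp V W Z (c : coordinates W) (d : coordinates Z)
    (O : set V) (O' : set W) (f : V -> W) (g : W -> Z) :
  open O -> open O' -> (forall x, O x -> O' (f x)) ->
  smooth_on_open O f -> smooth_on_open O' g -> smooth_on_open O (g \o f).
Proof.
move=> oO oO' OO' sf /(smooth_coordP d _ oO') sg.
apply/(smooth_coordP d _ oO) => i; apply/smooth_CkP => n.
exact: (Ck_comp c n oO oO' OO' sf (sg i)).
Qed.

Lemma smooth_on_continuous V W (A : set V) (f : V -> W) x :
  smooth_on A f -> A x ->
  exists (O : set V) (g : V -> W),
    [/\ open O, O x, {for x, continuous g} & {in A `&` O, f =1 g}].
Proof.
move=> sf Ax; have [ O [g [ oO Ox sg fg]]] := sf x Ax; exists O, g; split=> //.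
exact: smooth_continuous Ox.
Qed.

(** Local extensions of f and g compose on the open set where the
    extension of f lands in the domain of the extension of g. *)
Lemma smooth_on_comp V W Z (c : coordinates W) (d : coordinates Z)
    (A : set V) (B : set W) (f : V -> W) (g : W -> Z) :
  (forall x, A x -> B (f x)) -> smooth_on A f -> smooth_on B g ->
  smooth_on A (g \o f).
Proof.
move=> AB sf sg x Ax.
have [ O [F [ oO Ox sF fF]]] := sf x Ax.
have [ O' [G [oO' Ofx sG gG]]] := sg _ (AB _ Ax).
have fx : f x = F x by rewrite fF // inE.
pose P := O `&` (F @^-1` O')^°.
have OP : P `<=` O `&` (F @^-1` O').
  by move=> y [Oy]; move/interior_subset.
have oP : open P by apply: openI => //; exact: open_interior.
exists P, (G \o F); split=> //.
- split=> //; have cF := smooth_continuous sF Ox.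
  by apply: cF; rewrite /= -fx; apply: open_nbhs_nbhs.
- apply: (smooth_comp c d oP oO') => //.
    by move=> y /OP[].
  by apply: smooth_subset sF => y /OP[].
- move=> y; rewrite inE => -[Ay /OP[ Oy Oy']] /=.
  have fy : f y = F y by rewrite fF // inE.
  by rewrite gG ?fy // inE; split=> //; rewrite -fy; apply: AB.
Qed.

Lemma smooth_on_subset V W (A B : set V) (f : V -> W) :
  A `<=` B -> smooth_on B f -> smooth_on A f.
Proof.
move=> AB sf x Ax; have [ O [g [ oO Ox sg fg]]] := sf x (AB _ Ax); exists O, g; split=> //.
by move=> y; rewrite inE => -[Ay Oy]; apply: fg; rewrite inE; split=> //; apply: AB.
Qed.

Lemma smooth_on_openP V W (O : set V) (f : V -> W) : open O ->
  smooth_on O f -> smooth_on_open O f.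
Proof.
move=> oO sf vs x Ox; have [P [g [oP Px sg fg]]] := sf x Ox.
have oOP : open (O `&` P) by exact: openI.
have sg' : smooth_on_open (O `&` P) g by apply: smooth_subset sg => y [].
have : smooth_on_open (O `&` P) f.
  by apply: (smooth_congr oOP _ sg') => y Oy; rewrite fg.
by move=> /(_ vs x (conj Ox Px)).
Qed.

(** Two applications of the mean value theorem, first along v to the
    increment of f along w, then along w to the derivative along v. *)
Lemma mixed_increment V (O : set V) (f : V -> R) x v w (r h : R) :
  smooth_on_open O f -> (forall y, `|y - x| < r -> O y) ->
  0 < h -> h * (`|v| + `|w|) < r ->
  exists2 y, `|y - x| < r &
    'D_w ('D_v f) y = (f (h *: v + (h *: w + x)) - f (h *: v + x)
                       - (f (h *: w + x) - f x)) / (h * h).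
Proof.
move=> sf Or h0 hr.
have near_x (s t : R) : `|s| <= h -> `|t| <= h -> `|t *: w + (s *: v + x) - x| < r.
  move=> sh th; rewrite addrA addrK; apply: le_lt_trans hr.
  apply: le_trans (ler_normD _ _) _; rewrite !normrZ mulrDr addrC.
  by apply: lerD; apply: ler_wpM2r.
have hn : `|h| = h by rewrite gtr0_norm.
have h0' : `|0 : R| <= h by rewrite normr0 ltW.
pose F y := f (y + h *: w) - f y.
have dF y : O y -> O (y + h *: w) ->
    derivable F y v /\ 'D_v F y = 'D_v f (y + h *: w) - 'D_v f y.
  move=> Oy Oyw.
  have E : (fun k : R => k^-1 *: ((F \o shift y) (k *: v) - F y)) =
     (fun k : R => k^-1 *: ((f \o shift (y + h *: w)) (k *: v) - f (y + h *: w))) -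
     (fun k : R => k^-1 *: ((f \o shift y) (k *: v) - f y)).
    apply/funext => k; rewrite -[RHS]/(_ - _) -scalerBr /F /=; congr (_ *: _).
    by rewrite addrA; ring.
  have cv : k^-1 *: ((F \o shift y) (k *: v) - F y) @[k --> 0^'] -->
      'D_v f (y + h *: w) - 'D_v f y.
    by rewrite E; apply: cvgB; apply: (smooth_derivable (v := v) sf).
  by split; [apply/cvg_ex; eexists; exact: cv|exact: cvg_lim cv].
have Fpt t : `|t| <= h -> O (t *: v + x) /\ O (t *: v + x + h *: w).
  move=> th; split; apply: Or.
    by have := near_x t 0 th h0'; rewrite scale0r add0r.
  by rewrite [X in X - x]addrC; apply: near_x => //; rewrite hn.
have [|s sh E1] := @mean_value_line _ _ F v x h.
  move=> t; rewrite hn => th; have [ O1 O2] := Fpt t th.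
  by have [] := dF _ O1 O2.
rewrite hn in sh; have [ O1 O2] := Fpt s sh.
have [_ E2] := dF _ O1 O2.
have [|t th E3] := @mean_value_line _ _ ('D_v f) w (s *: v + x) h.
  move=> t; rewrite hn => th; apply: (smooth_derivable (smooth_derive v sf)).
  by apply: Or; apply: near_x.
rewrite hn in th.
exists (t *: w + (s *: v + x)); first exact: near_x.
have hh : h * h != 0 by rewrite mulf_neq0 ?gt_eqF.
apply: (canRL (mulfK hh)); rewrite mulrC -mulrA -E3.
rewrite [h *: w + (_ + _)]addrC -E2 -E1 /F.
by rewrite [h *: w + x]addrC addrA; move: (f _) (f _) (f _) (f _) => *; ring.
Qed.

Lemma eq_of_close_values V (p q : V -> R) x :
  {for x, continuous p} -> {for x, continuous q} ->
  (forall r, 0 < r -> exists y z, [/\ `|y - x| < r, `|z - x| < r & p y = q z]) ->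
  p x = q x.
Proof.
move=> cp cq close; apply/eqP; rewrite -subr_eq0 -normr_le0.
apply/ler_addgt0Pr => e e0; rewrite add0r.
have e2 : 0 < e / 2 by rewrite divr_gt0.
have Hp : \forall y \near x, `|p x - p y| < e / 2.
  by move/cvgrPdist_lt : cp; apply.
have Hq : \forall y \near x, `|q x - q y| < e / 2.
  by move/cvgrPdist_lt : cq; apply.
have H : \forall y \near x, `|p x - p y| < e / 2 /\ `|q x - q y| < e / 2.
  by apply: filterS (filterI Hp Hq) => y [].
move/nbhs_normP : H => [r /= r0 H].
have [y [z [yr zr pq]]] := close r r0.
have [|/ltW A _] := H y; first by rewrite /ball_ /= distrC.
have [|_ /ltW B] := H z; first by rewrite /ball_ /= distrC.
have -> : p x - q x = (p x - p y) - (q x - q z) by rewrite pq; ring.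
by rewrite (splitr e); apply: le_trans (ler_normB _ _) _; rewrite lerD.
Qed.

(** The double difference quotient is symmetric in v and w, and by
    [mixed_increment] it is a value of each mixed derivative near x; continuity
    of both mixed derivatives then forces them to agree at x. *)
Lemma derive_comm V (O : set V) (f : V -> R) x v w :
  open O -> O x -> smooth_on_open O f ->
  'D_w ('D_v f) x = 'D_v ('D_w f) x.
Proof.
move=> oO Ox sf; apply: (@eq_of_close_values _ ('D_w ('D_v f)) ('D_v ('D_w f))).
- exact: smooth_continuous (smooth_derive w (smooth_derive v sf)) Ox.
- exact: smooth_continuous (smooth_derive v (smooth_derive w sf)) Ox.
move=> r0 r00.
have : \forall y \near x, O y by apply: open_nbhs_nbhs.
move/nbhs_normP => [r1 /= r10 H].
pose r := Num.min r0 r1; have rr : 0 < r by rewrite lt_min r00 r10.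
have HO y : `|y - x| < r -> O y.
  by rewrite lt_min => /andP[_ yr]; apply: H; rewrite /ball_ /= distrC.
have Hr y : `|y - x| < r -> `|y - x| < r0 by rewrite lt_min => /andP[].
(* the parallelogram spanned by h v and h w stays within distance r *)
pose h := r / (1 + (`|v| + `|w|)).
have p0 : 0 < 1 + (`|v| + `|w|) by rewrite ltr_wpDr // addr_ge0.
have h0 : 0 < h by rewrite divr_gt0.
have hr : h * (`|v| + `|w|) < r.
  by rewrite /h mulrAC ltr_pdivrMr // ltr_pM2l // ltrDr.
have hr' : h * (`|w| + `|v|) < r by rewrite [`|w| + _]addrC.
have [y yr E] := mixed_increment sf HO h0 hr.
have [z zr E'] := mixed_increment sf HO h0 hr'.
exists y, z; split; [exact: Hr|exact: Hr|].
apply: etrans E (etrans _ (esym E')).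
rewrite [h *: w + (_ + _)]addrCA; congr (_ / _).
by move: (f _) (f _) (f _) (f _) => *; ring.
Qed.

End Composition.

(** * Derivatives at a local maximum *)

Section Extrema.
Context {R : realType}.

(** Only nonpositive increments are used, because the maximum of w - e t may sit at
    the end of the time interval, beyond which nothing is known. *)
Lemma left_growth (g : R -> R) (k : R) : derivable g 0 1 ->
  (\forall h \near 0, h <= 0 -> g h <= g 0 + k * h) -> k <= 'D_1 g 0.
Proof.
move=> dg H; rewrite leNgt; apply/negP => Dk.
have e0 : 0 < k - 'D_1 g 0 by rewrite subr_gt0.
have cg : h^-1 *: ((g \o shift 0) (h *: 1) - g 0) @[h --> 0^'] --> 'D_1 g 0.
  exact: dg.
have n1 : \forall h \near (0 : R), h != 0 ->
    `|'D_1 g 0 - h^-1 *: ((g \o shift 0) (h *: 1) - g 0)| < k - 'D_1 g 0.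
  exact: (proj1 (cvgrPdist_lt _ _) cg _ e0).
have /nbhs_ballP [r /= r0 rH] : nbhs (0 : R) (fun h => (h != 0 ->
   `|'D_1 g 0 - h^-1 *: ((g \o shift 0) (h *: 1) - g 0)| < k - 'D_1 g 0) /\
   (h <= 0 -> g h <= g 0 + k * h)) by exact: filterI n1 H.
pose h := - (r / 2).
have h0 : h < 0 by rewrite oppr_lt0 divr_gt0.
have [] := rH h.
  rewrite /ball /= sub0r normrN /h normrN gtr0_norm ?divr_gt0 //.
  by rewrite ltr_pdivrMr // ltr_pMr // ltr1n.
rewrite /= [h *: 1]mulr1 addr0 lt_eqF // => /(_ isT) A /(_ (ltW h0)) B.
move: A; apply/negP; rewrite -leNgt.
have q : k <= h^-1 * (g h - g 0).
  by rewrite mulrC ler_ndivlMr // lerBlDl.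
rewrite [X in _ <= `|_ - X|](_ : _ = h^-1 * (g h - g 0)) //.
by rewrite distrC; apply: le_trans (ler_norm _); rewrite lerB.
Qed.

Lemma critical_of_local_max (g : R -> R) : derivable g 0 1 ->
  (\forall h \near 0, g h <= g 0) -> 'D_1 g 0 = 0.
Proof.
move=> dg H; apply/eqP; rewrite eq_le; apply/andP; split; last first.
  by apply: (left_growth dg); apply: filterS H => h gh _; rewrite mul0r addr0.
have dN : derivable (fun h => g (- h)) 0 1 /\ 'D_1 (fun h => g (- h)) 0 = - 'D_1 g 0.
  have dopp : derivable (-%R : R -> R) 0 1 by exact: derivable_opp.
  have dg0 : differentiable g 0 := proj1 (derivable1_diffP g 0) dg.
  have dg' : differentiable g (- 0) by rewrite oppr0.
  have [d1 E] := derive_comp dopp dg'.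
  split=> //; rewrite -[LHS]/('D_1 (g \o -%R) 0) E oppr0.
  have -> : 'D_1 (-%R : R -> R) 0 = -1.
    by have [_ ->] := is_deriveNid (0 : R) 1.
  by rewrite !deriveE // linearN.
have [d1 E] := dN.
rewrite -oppr_ge0 -E; apply: (left_growth d1).
have HN : \forall h \near (0 : R), g (- h) <= g 0.
  have c : -%R h @[h --> (0 : R)] --> (0 : R).
    by rewrite -[X in _ --> X]oppr0; apply: cvgN; exact: cvg_id.
  exact: (c _ H).
by apply: filterS HN => h gh _; rewrite oppr0 mul0r addr0.
Qed.

(** The second derivative is taken of the first derivative g',
    which is how it presents itself for iterated directional derivatives.  If it
    were positive, g' would be positive just after 0 and g would exceed g 0. *)
Lemma second_derivative_local_max (g g' : R -> R) :
  (\forall h \near (0 : R), is_derive (h : R) (1 : R) g (g' h)) -> derivable g' 0 1 ->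
  (\forall h \near 0, g h <= g 0) -> 'D_1 g' 0 <= 0.
Proof.
move=> dg dg' H.
have [dg0 g'0] : derivable g 0 1 /\ 'D_1 g 0 = g' 0.
  by have := nbhs_singleton dg; case.
have g00 : g' 0 = 0 by rewrite -g'0; exact: critical_of_local_max.
rewrite leNgt; apply/negP => D0.
have cg : h^-1 *: ((g' \o shift 0) (h *: 1) - g' 0) @[h --> 0^'] --> 'D_1 g' 0.
  exact: dg'.
have n1 : \forall h \near (0 : R), h != 0 ->
    `|'D_1 g' 0 - h^-1 *: ((g' \o shift 0) (h *: 1) - g' 0)| < 'D_1 g' 0.
  exact: (proj1 (cvgrPdist_lt _ _) cg _ D0).
have /nbhs_ballP [r /= r0 rH] : nbhs (0 : R) (fun h : R => [/\ h != 0 ->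
   `|'D_1 g' 0 - h^-1 *: ((g' \o shift 0) (h *: 1) - g' 0)| < 'D_1 g' 0,
   g h <= g 0 & is_derive (h : R) (1 : R) g (g' h)]).
  by apply: filterS (filterI n1 (filterI H dg)) => h [? []].
have rb h : 0 <= h -> h < r -> ball (0 : R) r h.
  by move=> h0 hr; rewrite /ball /= sub0r normrN ger0_norm.
have pos h : 0 < h -> h < r -> 0 < g' h.
  move=> h0 hr; have [A _ _] := rH h (rb h (ltW h0) hr).
  have {A} := A (lt0r_neq0 h0); rewrite /= [h *: 1]mulr1 addr0 g00 subr0.
  rewrite [h^-1 *: g' h](_ : _ = h^-1 * g' h) //.
  rewrite ltr_norml => /andP[_]; rewrite gtrBl.
  by rewrite pmulr_rgt0 // invr_gt0.
pose b := r / 2; have b0 : 0 < b by rewrite divr_gt0.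
have br : b < r by rewrite ltr_pdivrMr // ltr_pMr // ltr1n.
have der (h : R) : h \in `]0, b[ -> is_derive (h : R) (1 : R) g (g' h).
  rewrite in_itv /= => /andP[h0 hb].
  by have [_ _] := rH h (rb h (ltW h0) (lt_trans hb br)).
have cont : {within `[0, b], continuous g}.
  apply: derivable_within_continuous => h; rewrite in_itv /= => /andP[h0 hb].
  by have [_ _ []] := rH h (rb h h0 (le_lt_trans hb br)).
have [c] := MVT b0 der cont; rewrite in_itv /= => /andP[c0 cb] E.
have [_ gb _] := rH b (rb b (ltW b0) br).
have := pos c c0 (lt_trans cb br).
have : 0 < b - 0 by rewrite subr0.
move=> B C; have := mulr_gt0 C B; rewrite -E subr_gt0 => /lt_le_trans /(_ gb).
by rewrite ltxx.
Qed.

(** Reduction to one variable along the line through z with direction v. *)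
Lemma local_max_along (V : normedModType R) (O : set V) (Z : V -> R) z v :
  open O -> O z -> smooth_on_open O Z ->
  (\forall h \near (0 : R), Z (h *: v + z) <= Z z) ->
  'D_v Z z = 0 /\ 'D_v ('D_v Z) z <= 0.
Proof.
move=> oO Oz sZ H.
have z0 : 0 *: v + z = z by rewrite scale0r add0r.
have line : \forall h \near (0 : R), O (h *: v + z).
  have c : h *: v + z @[h --> (0 : R)] --> z.
    have : h *: v + z @[h --> (0 : R)] --> 0 *: v + z.
      by apply: cvgD; [apply: cvgZr_tmp; exact: cvg_id|exact: cvg_cst].
    by rewrite z0.
  by apply: (c O); apply: open_nbhs_nbhs.
have der (h : R) : O (h *: v + z) ->
    is_derive (h : R) (1 : R) (fun s : R => Z (s *: v + z)) ('D_v Z (h *: v + z)).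
  by move=> Oh; apply: derivable_line; exact: smooth_derivable sZ Oh.
have d0 := der 0; rewrite z0 in d0; have {d0} [d0 D0] := d0 Oz.
have H' : \forall h \near (0 : R), Z (h *: v + z) <= Z (0 *: v + z) by rewrite z0.
split; first by rewrite -D0; apply: critical_of_local_max.
have line_der : \forall h \near (0 : R), is_derive (h : R) (1 : R)
    (fun s : R => Z (s *: v + z)) ('D_v Z (h *: v + z)).
  by apply: filterS line => h Oh; exact: (der h Oh).
have dD : derivable (fun s : R => 'D_v Z (s *: v + z)) 0 1.
  exact: (proj1 (derivable1P ('D_v Z) z v) (smooth_derivable (smooth_derive v sZ) Oz)).
rewrite (derive_line ('D_v Z)).
exact: (second_derivative_local_max line_der dD H').
Qed.

End Extrema.

(** * The polynomial inequality at a critical point *)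

Section PointwiseInequality.
Context {R : realFieldType}.
Implicit Types a b c x y s : R.

(** In terms of x = N^2, y = L D and D, the function Z reads
      (x - y) x (x - 4 y) - 2 c D^3 (x - 3 y) y.
    The functions [zx] to [zd] are its partial derivatives at D = 1, the
    subscripts naming the variables ([zd] is the one in D). *)
Definition zx x y c := 3 * x ^+ 2 - 10 * x * y + 4 * y ^+ 2 - 2 * c * y.
Definition zy x y c := - 5 * x ^+ 2 + 8 * x * y - 2 * c * (x - 6 * y).
Definition zxx x y : R := 6 * x - 10 * y.
Definition zxy x y c := - 10 * x + 8 * y - 2 * c.
Definition zyy x c : R := 8 * x + 12 * c.
Definition zd x y c := - 6 * c * (x - 3 * y) * y.

(** The part of Et Z - 3 H^2 (E0 E0 Z + E1 E1 Z) that involves the third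
    derivatives al = f000 and ga = f011; then n = E0 N and l = E0 L.  The
    derivatives de = f111 and be = f001 contribute the same expression with a and
    b exchanged, and no product of the two pairs occurs. *)
Definition gradient_term a b c (al ga : R) :=
  let s := a + b in let x := s ^+ 2 in let y := a * b in
  let n := al + ga in let l := b * al + a * ga in
  6 * s * n ^+ 2 * (2 * s * zx x y c + b * zy x y c)
  + 6 * x * zy x y c * ga * (ga - al)
  - 3 * x * (2 * zx x y c * n ^+ 2 + 4 * x * zxx x y * n ^+ 2
             + 4 * s * zxy x y c * n * l + zyy x c * l ^+ 2).

(** On the line of solutions of the critical point equation,
    Q * gradient_term is - 24 t^2 s^6 b^2 times this polynomial, where t
    parametrizes the line and s = a + b. *)
Definition gradient_poly a b : R :=
  2 * a ^+ 16 - 10 * a ^+ 15 * b + 10 * a ^+ 14 * b ^+ 2 + 42 * a ^+ 13 * b ^+ 3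
  - 135 * a ^+ 12 * b ^+ 4 + 274 * a ^+ 11 * b ^+ 5 - 272 * a ^+ 10 * b ^+ 6
  + 258 * a ^+ 9 * b ^+ 7 - 144 * a ^+ 8 * b ^+ 8 + 262 * a ^+ 7 * b ^+ 9
  - 166 * a ^+ 6 * b ^+ 10 + 98 * a ^+ 5 * b ^+ 11 + 6 * a ^+ 4 * b ^+ 12
  - 20 * a ^+ 3 * b ^+ 13 + 14 * a ^+ 2 * b ^+ 14 - 4 * a * b ^+ 15 + b ^+ 16.

Lemma quadratic_form_ge0 u v w a b : 0 < u -> v ^+ 2 <= 4 * u * w ->
  0 <= u * a ^+ 2 - v * a * b + w * b ^+ 2.
Proof.
move=> u0 disc; have u4 : 0 < 4 * u by rewrite mulr_gt0.
rewrite -(pmulr_rge0 _ u4).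
have -> : 4 * u * (u * a ^+ 2 - v * a * b + w * b ^+ 2) =
  (2 * u * a - v * b) ^+ 2 + (4 * u * w - v ^+ 2) * b ^+ 2 by ring.
by rewrite addr_ge0 ?sqr_ge0 // mulr_ge0 ?sqr_ge0 // subr_ge0.
Qed.

(** The polynomial is a combination with nonnegative monomial weights
    of nonnegative quadratic forms in (a, b), each verified by its discriminant. *)
Lemma gradient_poly_ge0 a b : 0 < a -> 0 < b -> 0 <= gradient_poly a b.
Proof.
move=> a0 b0; pose q (u v w : R) := u * a ^+ 2 - v * a * b + w * b ^+ 2.
have q0 (u v w : R) : 0 < u -> v ^+ 2 <= 4 * u * w -> 0 <= q u v w.
  exact: quadratic_form_ge0.
have -> : gradient_poly a b =
  b ^+ 14 * q 4 4 1
  + a ^+ 2 * b ^+ 11 * (a * q 20 10 5 + b * q 16 25 10)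
  + a ^+ 5 * b ^+ 9 * q 89 166 78 + a ^+ 7 * b ^+ 7 * q 30 144 173
  + a ^+ 9 * b ^+ 5 * q 82 272 228 + a ^+ 11 * b ^+ 3 * q 24 135 192
  + a ^+ 13 * (a * q 2 13 22 + b * q 3 12 18).
  by rewrite /gradient_poly /q; ring.
have [a1 b1] := (ltW a0, ltW b0).
clearbody q.
by rewrite !(addr_ge0, mulr_ge0, exprn_ge0) //; apply: q0; lra.
Qed.

Section CriticalValue.
Variables (a b c : R).
Let s := a + b.
Let x := s ^+ 2.
Let y := a * b.
Let P := (x - y) * x * (x - 4 * y).
Let Q := 2 * (x - 3 * y) * y.
Hypotheses (a0 : 0 < a) (b0 : 0 < b) (cQ : c * Q = P).

Lemma Q_gt0 : 0 < Q.
Proof.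
have -> : Q = 2 * ((a - b) ^+ 2 + a * b) * (a * b) by rewrite /Q /x /y /s; ring.
by rewrite !(mulr_gt0, ltr_wpDl) ?sqr_ge0.
Qed.

(** Multiplying by Q removes c, because c Q = P.  The same elimination in the
    lemmas that follow leaves polynomials in x and y only. *)
Lemma Q_zx : Q * zx x y c = 4 * y * (x ^+ 3 - 7 * x ^+ 2 * y + 15 * x * y ^+ 2 - 6 * y ^+ 3).
Proof.
have -> : Q * zx x y c = Q * (3 * x ^+ 2 - 10 * x * y + 4 * y ^+ 2) - 2 * y * (c * Q).
  by rewrite /zx; ring.
by rewrite cQ /P /Q; ring.
Qed.

Lemma Q_zy : Q * zy x y c = - 2 * x ^+ 2 * (x ^+ 2 - 6 * x * y + 11 * y ^+ 2).
Proof.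
have -> : Q * zy x y c = Q * (- 5 * x ^+ 2 + 8 * x * y) - 2 * (x - 6 * y) * (c * Q).
  by rewrite /zy; ring.
by rewrite cQ /P /Q; ring.
Qed.

Lemma Q_zxy : Q * zxy x y c = Q * (- 10 * x + 8 * y) - 2 * P.
Proof. by rewrite -cQ /zxy; ring. Qed.

Lemma Q_zyy : Q * zyy x c = 8 * x * Q + 12 * P.
Proof. by rewrite -cQ /zyy; ring. Qed.

(** After multiplication by Q and elimination of c the left-hand side
    collapses to - 24 x^2 y^4 (a - b)^2. *)
Lemma zero_order_le0 :
  - 8 * s ^+ 3 * (2 * s * zx x y c * (a ^+ 2 + b ^+ 2) + zy x y c * y * s)
  + 12 * x * zy x y c * y ^+ 2
  - 6 * x * (a ^+ 2 + b ^+ 2) * (y * zy x y c + zd x y c) <= 0.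
Proof.
rewrite -(pmulr_rle0 _ Q_gt0).
have -> : a ^+ 2 + b ^+ 2 = x - 2 * y by rewrite /x /y /s; ring.
have -> : Q * (- 8 * s ^+ 3 * (2 * s * zx x y c * (x - 2 * y) + zy x y c * y * s)
    + 12 * x * zy x y c * y ^+ 2 - 6 * x * (x - 2 * y) * (y * zy x y c + zd x y c)) =
  - 8 * s * s ^+ 2 * (2 * s * (Q * zx x y c) * (x - 2 * y) + (Q * zy x y c) * y * s)
    + 12 * x * (Q * zy x y c) * y ^+ 2
    - 6 * x * (x - 2 * y) * (y * (Q * zy x y c) - 3 * Q * (c * Q)).
  by rewrite /zd /Q; ring.
rewrite Q_zx Q_zy cQ.
have -> : - 8 * s * s ^+ 2 * (2 * s *
      (4 * y * (x ^+ 3 - 7 * x ^+ 2 * y + 15 * x * y ^+ 2 - 6 * y ^+ 3)) * (x - 2 * y)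
      + - 2 * x ^+ 2 * (x ^+ 2 - 6 * x * y + 11 * y ^+ 2) * y * s)
    + 12 * x * (- 2 * x ^+ 2 * (x ^+ 2 - 6 * x * y + 11 * y ^+ 2)) * y ^+ 2
    - 6 * x * (x - 2 * y) *
      (y * (- 2 * x ^+ 2 * (x ^+ 2 - 6 * x * y + 11 * y ^+ 2)) - 3 * Q * P) =
  - (24 * x ^+ 2 * y ^+ 4 * (a - b) ^+ 2).
  rewrite /P /Q (_ : (a - b) ^+ 2 = x - 4 * y); last by rewrite /x /y /s; ring.
  rewrite /x; ring.
have x0 : 0 <= x by rewrite /x sqr_ge0.
have y0 : 0 <= y by rewrite /y mulr_ge0 ?ltW.
rewrite oppr_le0; apply: mulr_ge0 (sqr_ge0 _).
by apply: mulr_ge0; [apply: mulr_ge0 => //|]; exact: exprn_ge0.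
Qed.

(** The hypothesis is E0 Z = 0.  By [Q_zx] and [Q_zy] it says that n and l are
    proportional to s^3 B and 4 y A; since a and b differ, al and ga are
    recovered from n and l, so the quadratic form is a multiple of t^2. *)
Lemma gradient_le0 al ga : a != b ->
  2 * s * zx x y c * (al + ga) + zy x y c * (b * al + a * ga) = 0 ->
  gradient_term a b c al ga <= 0.
Proof.
rewrite -subr_eq0 => ab crit.
(* Q zx = 4 y A and Q zy = - 2 x^2 B *)
pose A := x ^+ 3 - 7 * x ^+ 2 * y + 15 * x * y ^+ 2 - 6 * y ^+ 3.
pose B := x ^+ 2 - 6 * x * y + 11 * y ^+ 2.
have s0 : 0 < s by rewrite /s addr_gt0.
have B0 : 0 < B.
  have -> : B = (x - 3 * y) ^+ 2 + 2 * y ^+ 2 by rewrite /B; ring.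
  by rewrite ltr_wpDl ?sqr_ge0 // !mulr_gt0.
pose n := al + ga; pose l := b * al + a * ga; pose t := n / (s ^+ 3 * B).
have d0 : s ^+ 3 * B != 0 by rewrite mulf_neq0 ?expf_neq0 ?gt_eqF.
have nE : n = s ^+ 3 * B * t by rewrite /t mulrC divfK.
have lE : l = 4 * y * A * t.
  have : 2 * s * (Q * zx x y c) * n + (Q * zy x y c) * l = 0.
    by rewrite -[RHS](mulr0 Q) -crit /n /l; ring.
  rewrite Q_zx Q_zy -/A -/B => H.
  have x0 : 2 * s * (s ^+ 3 * B) != 0.
    by rewrite !mulf_neq0 ?expf_neq0 ?pnatr_eq0 ?gt_eqF.
  apply: (mulfI x0).
  have -> : 2 * s * (s ^+ 3 * B) * l = 2 * s * (4 * y * A) * n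
      - (2 * s * (4 * y * A) * n + - 2 * x ^+ 2 * B * l) by rewrite /x; ring.
  by rewrite H subr0 nE; ring.
have alE : (a - b) * al = a * n - l by rewrite /n /l; ring.
have gaE : (a - b) * ga = l - b * n by rewrite /n /l; ring.
have e0 : 0 < (a - b) ^+ 2 by rewrite lt_def sqr_ge0 andbT expf_neq0.
rewrite -(pmulr_rle0 _ Q_gt0) -(pmulr_rle0 _ e0).
have -> : (a - b) ^+ 2 * (Q * gradient_term a b c al ga) =
  (a - b) ^+ 2 * (6 * s * n ^+ 2 * (2 * s * (Q * zx x y c) + b * (Q * zy x y c))
    - 3 * x * (2 * (Q * zx x y c) * n ^+ 2 + 4 * x * Q * zxx x y * n ^+ 2
             + 4 * s * (Q * zxy x y c) * n * l + (Q * zyy x c) * l ^+ 2))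
  + 6 * x * (Q * zy x y c) * ((a - b) * ga) * ((a - b) * ga - (a - b) * al).
  by rewrite /gradient_term -/s -/x -/y -/n -/l; ring.
rewrite alE gaE Q_zx Q_zy Q_zxy Q_zyy -/A -/B nE lE.
have final : forall X : R,
  X = - (24 * (t ^+ 2 * (a - b) ^+ 2 * s ^+ 6 * b ^+ 2 * gradient_poly a b)) -> X <= 0.
  move=> X ->; rewrite oppr_le0 mulr_ge0 //; apply: mulr_ge0 (gradient_poly_ge0 a0 b0).
  exact: (mulr_ge0 (mulr_ge0 (mulr_ge0 (sqr_ge0 _) (sqr_ge0 _))
    (exprn_ge0 _ (ltW s0))) (sqr_ge0 _)).
apply: final; rewrite /A /B /P /Q /zxx /gradient_poly /x /y /s.
ring.
Qed.

End CriticalValue.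
End PointwiseInequality.

(** * Jets of a graph moving with speed H^3 *)

Section Derivations.
Context {R : realFieldType} {T : Type}.
Implicit Types (f g : T -> R) (O : set T) (S : set (T -> R)).

(** From here on the geometry only uses that smooth functions form an
    algebra acted upon by commuting derivations.  Keeping both abstract separates
    the polynomial identities from the analysis. *)
Record function_algebra S := FunctionAlgebra {
  alg_cst : forall k : R, S (fun=> k);
  alg_add : forall f g, S f -> S g -> S (fun z => f z + g z);
  alg_mul : forall f g, S f -> S g -> S (fun z => f z * g z) }.

(** The last field is locality: values outside of O do not matter, so
    identities known on O may be differentiated there. *)
Record derivation O S (E : (T -> R) -> T -> R) := Derivation {
  derivation_alg : forall f, S f -> S (E f);
  derivation_cst : forall (k : R) z, O z -> E (fun=> k) z = 0;
  derivation_add : forall f g z, S f -> S g -> O z ->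
    E (fun y => f y + g y) z = E f z + E g z;
  derivation_mul : forall f g z, S f -> S g -> O z ->
    E (fun y => f y * g y) z = E f z * g z + f z * E g z;
  derivation_congr : forall f g z, S f -> S g -> {in O, f =1 g} -> O z -> E f z = E g z }.

Definition jet1 S E f z (v0 v1 : R) := [/\ S f, f z = v0 & E f z = v1].
(** The order-two Taylor data of f along E.  Evaluating a polynomial expression
    on such data is mechanical, whereas expanding its second derivative by
    rewriting is not feasible. *)
Definition jet2 S (E : (T -> R) -> T -> R) f z (v0 v1 v2 : R) :=
  [/\ S f, f z = v0, E f z = v1 & E (E f) z = v2].

Lemma derivation_linear O S E (a b : R) f g z : function_algebra S ->
  derivation O S E -> S f -> S g -> O z ->
  E (fun y => a * f y + b * g y) z = a * E f z + b * E g z.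
Proof.
move=> aS dE Sf Sg Oz; have [Sa Sb] := (alg_cst aS a, alg_cst aS b).
have [Saf Sbg] := (alg_mul aS Sa Sf, alg_mul aS Sb Sg).
rewrite (derivation_add dE Saf Sbg Oz) (derivation_mul dE Sa Sf Oz).
by rewrite (derivation_mul dE Sb Sg Oz) !(derivation_cst dE) // !mul0r !add0r.
Qed.

Section Jets.
Variables (O : set T) (S : set (T -> R)) (E : (T -> R) -> T -> R) (z : T).
Hypotheses (Oz : O z) (aS : function_algebra S) (dE : derivation O S E).

Lemma jet1_cst k : jet1 S E (fun=> k) z k 0.
Proof. by split=> //; [exact: (alg_cst aS)|exact: (derivation_cst dE)]. Qed.

Lemma jet1_add f g v0 v1 w0 w1 :
  jet1 S E f z v0 v1 -> jet1 S E g z w0 w1 ->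
  jet1 S E (fun y => f y + g y) z (v0 + w0) (v1 + w1).
Proof.
move=> [Sf <- <-] [Sg <- <-]; split=> //; first exact: (alg_add aS).
exact: (derivation_add dE).
Qed.

Lemma jet1_mul f g v0 v1 w0 w1 :
  jet1 S E f z v0 v1 -> jet1 S E g z w0 w1 ->
  jet1 S E (fun y => f y * g y) z (v0 * w0) (v1 * w0 + v0 * w1).
Proof.
move=> [Sf <- <-] [Sg <- <-]; split=> //; first exact: (alg_mul aS).
exact: (derivation_mul dE).
Qed.

Lemma jet1_eq f v0 v1 w0 w1 : jet1 S E f z v0 v1 -> v0 = w0 -> v1 = w1 ->
  jet1 S E f z w0 w1.
Proof. by move=> + <- <-. Qed.

Lemma jet2_cst k : jet2 S E (fun=> k) z k 0 0.
Proof.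
split=> //; [exact: (alg_cst aS)|exact: (derivation_cst dE)|].
rewrite (@derivation_congr _ _ _ dE _ (fun=> 0)) //; first exact: (derivation_cst dE).
- by apply: (derivation_alg dE); exact: (alg_cst aS).
- exact: (alg_cst aS).
- by move=> y /set_mem Oy; rewrite (derivation_cst dE).
Qed.

Lemma jet2_add f g v0 v1 v2 w0 w1 w2 :
  jet2 S E f z v0 v1 v2 -> jet2 S E g z w0 w1 w2 ->
  jet2 S E (fun y => f y + g y) z (v0 + w0) (v1 + w1) (v2 + w2).
Proof.
move=> [Sf <- <- <-] [Sg <- <- <-].
have [SEf SEg] := (derivation_alg dE Sf, derivation_alg dE Sg).
have Sfg := alg_add aS Sf Sg.
split=> //; first exact: (derivation_add dE).
rewrite -(derivation_add dE) //; apply: (derivation_congr dE) => //.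
- exact: (derivation_alg dE).
- exact: (alg_add aS).
- by move=> y /set_mem Oy; rewrite (derivation_add dE).
Qed.

(** Truncated Taylor multiplication, with v2 and w2 the second derivatives
    themselves rather than halves of them. *)
Lemma jet2_mul f g v0 v1 v2 w0 w1 w2 :
  jet2 S E f z v0 v1 v2 -> jet2 S E g z w0 w1 w2 ->
  jet2 S E (fun y => f y * g y) z (v0 * w0) (v1 * w0 + v0 * w1)
    (v2 * w0 + 2 * v1 * w1 + v0 * w2).
Proof.
move=> [Sf <- <- <-] [Sg <- <- <-].
have [SEf SEg] := (derivation_alg dE Sf, derivation_alg dE Sg).
have Sfg := alg_mul aS Sf Sg.
have [S1 S2] := (alg_mul aS SEf Sg, alg_mul aS Sf SEg).
split=> //; first exact: (derivation_mul dE).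
have -> : E (E (fun y => f y * g y)) z =
    E (fun y => E f y * g y + f y * E g y) z.
  apply: (derivation_congr dE) => //; first exact: (derivation_alg dE).
  - exact: (alg_add aS).
  - by move=> y /set_mem Oy; rewrite (derivation_mul dE).
by rewrite (derivation_add dE) // !(derivation_mul dE) //; ring.
Qed.

Lemma jet2_eq f v0 v1 v2 w0 w1 w2 : jet2 S E f z v0 v1 v2 ->
  v0 = w0 -> v1 = w1 -> v2 = w2 -> jet2 S E f z w0 w1 w2.
Proof. by move=> + <- <- <-. Qed.

End Jets.
End Derivations.

Section GraphFlow.
Context {R : realFieldType} {T : Type}.

(** The products in [gradD] to [levelZ] are spelled out with the operations of
    [function_algebra], so that jets can be computed along their syntax. *)
Definition gradD (f0 f1 : T -> R) z : R := 1 + (f0 z * f0 z + f1 z * f1 z).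

(** The numerator of the mean curvature of the graph of f. *)
Definition traceN (f0 f1 f00 f01 f11 : T -> R) z : R :=
  (1 + f1 z * f1 z) * f00 z + (- 2) * (f0 z * f1 z * f01 z)
  + (1 + f0 z * f0 z) * f11 z.

(** The numerator of the Gauss curvature of the graph of f. *)
Definition detL (f00 f01 f11 : T -> R) z : R :=
  f00 z * f11 z + (- 1) * (f01 z * f01 z).

(** P - c Q for x = N^2 and y = L D, made homogeneous with powers of D. *)
Definition levelZ (c : R) (D N L : T -> R) z : R :=
  (N z * N z + (- 1) * (L z * D z)) * (N z * N z)
    * (N z * N z + (- 4) * (L z * D z))
  + (- 2 * c) * (D z * D z * D z) * (N z * N z + (- 3) * (L z * D z))
    * (L z * D z).

Variables (O : set T) (S : set (T -> R)) (E0 E1 Et : (T -> R) -> T -> R).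
Variables (z : T) (f : T -> R) (a b c : R).
Hypotheses (Oz : O z) (aS : function_algebra S).
Hypotheses (d0 : derivation O S E0) (d1 : derivation O S E1)
  (dt : derivation O S Et).
Hypothesis comm01 : forall g, S g -> {in O, E0 (E1 g) =1 E1 (E0 g)}.
Hypothesis comm0t : forall g, S g -> {in O, Et (E0 g) =1 E0 (Et g)}.
Hypothesis comm1t : forall g, S g -> {in O, Et (E1 g) =1 E1 (Et g)}.
Hypothesis Sf : S f.
Let f0 := E0 f.
Let f1 := E1 f.
Let f00 := E0 f0.
Let f01 := E0 f1.
Let f11 := E1 f1.
Let D := gradD f0 f1.
Let N := traceN f0 f1 f00 f01 f11.
Let L := detL f00 f01 f11.
Let Z := levelZ c D N L.
Hypothesis flow : {in O, forall y, Et f y * D y ^+ 4 = N y ^+ 3}.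
Hypotheses (f0z : f0 z = 0) (f1z : f1 z = 0) (f01z : f01 z = 0).
Hypotheses (f00z : f00 z = a) (f11z : f11 z = b).
Hypotheses (a0 : 0 < a) (b0 : 0 < b).

Let Sf0 : S f0 := derivation_alg d0 Sf.
Let Sf1 : S f1 := derivation_alg d1 Sf.
Let Sf00 : S f00 := derivation_alg d0 Sf0.
Let Sf01 : S f01 := derivation_alg d0 Sf1.
Let Sf11 : S f11 := derivation_alg d1 Sf1.

Let al := E0 f00 z.
Let be := E0 f01 z.
Let ga := E0 f11 z.
Let de := E1 f11 z.
Let p := E0 (E0 f00) z.
Let q := E0 (E0 f11) z.
Let r := E1 (E1 f11) z.

(** By commutation all third derivatives of f reduce to al, be, ga, de, and the
    fourth ones met along E0 and E1 to p, q, r.  The values of E E f01 are left as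
    they are, since f01 enters L quadratically and vanishes at z. *)
Lemma E1_f0 : {in O, E1 f0 =1 f01}.
Proof. by move=> y Oy; rewrite /f0 /f01 /f1 comm01. Qed.

Lemma E1_f01 : {in O, E1 f01 =1 E0 f11}.
Proof. by move=> y Oy; rewrite /f01 -comm01. Qed.

Lemma E1_f00 : {in O, E1 f00 =1 E0 f01}.
Proof.
move=> y Oy; rewrite /f00 -comm01 //.
apply: (derivation_congr d0) => //; [exact: (derivation_alg d1)|exact: E1_f0|exact: set_mem].
Qed.

Lemma E1E1_f00 : E1 (E1 f00) z = q.
Proof.
rewrite (@derivation_congr _ _ _ _ _ d1 _ (E0 f01)) //.
- rewrite -comm01 ?inE // /q.
  by apply: (derivation_congr d0) => //; [exact: (derivation_alg d1)|exact: (derivation_alg d0)|exact: E1_f01].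
- exact: (derivation_alg d1).
- exact: (derivation_alg d0).
- exact: E1_f00.
Qed.

Lemma jet_f0_0 : jet2 S E0 f0 z 0 a al. Proof. by []. Qed.
Lemma jet_f1_0 : jet2 S E0 f1 z 0 0 be. Proof. by []. Qed.
Lemma jet_f00_0 : jet2 S E0 f00 z a al p. Proof. by []. Qed.
Lemma jet_f01_0 : jet2 S E0 f01 z 0 be (E0 (E0 f01) z). Proof. by []. Qed.
Lemma jet_f11_0 : jet2 S E0 f11 z b ga q. Proof. by []. Qed.

Lemma jet_f0_1 : jet2 S E1 f0 z 0 0 ga.
Proof.
split=> //; first by rewrite E1_f0 ?inE.
rewrite (@derivation_congr _ _ _ _ _ d1 _ f01) //; [|exact: (derivation_alg d1)|exact: E1_f0].
by rewrite E1_f01 ?inE.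
Qed.
Lemma jet_f1_1 : jet2 S E1 f1 z 0 b de. Proof. by []. Qed.
Lemma jet_f00_1 : jet2 S E1 f00 z a be q.
Proof. by split=> //; [rewrite E1_f00 ?inE|exact: E1E1_f00]. Qed.
Lemma jet_f01_1 : jet2 S E1 f01 z 0 ga (E1 (E1 f01) z).
Proof. by split=> //; rewrite E1_f01 ?inE. Qed.
Lemma jet_f11_1 : jet2 S E1 f11 z b de r. Proof. by []. Qed.

Section Generic.
Variables (E : (T -> R) -> T -> R) (dE : derivation O S E).
Variables (u0 u1 v0 v1 w00 w01 w11 t00 t01 t11 : R).
Hypotheses (j0 : jet2 S E f0 z 0 u0 v0) (j1 : jet2 S E f1 z 0 u1 v1).
Hypotheses (j00 : jet2 S E f00 z a w00 t00) (j01 : jet2 S E f01 z 0 w01 t01)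
  (j11 : jet2 S E f11 z b w11 t11).

Let cst := jet2_cst Oz aS dE.
Let add := jet2_add Oz aS dE.
Let mul := jet2_mul Oz aS dE.

Lemma jet_D : jet2 S E D z 1 0 (2 * (u0 ^+ 2 + u1 ^+ 2)).
Proof.
by apply: (jet2_eq (add (cst 1) (add (mul j0 j0) (mul j1 j1)))); ring.
Qed.

Lemma jet_N : jet2 S E N z (a + b) (w00 + w11)
  (t00 + t11 + 2 * (u1 ^+ 2 * a + u0 ^+ 2 * b)).
Proof.
by apply: (jet2_eq (add (add (mul (add (cst 1) (mul j1 j1)) j00)
  (mul (cst (-2)) (mul (mul j0 j1) j01)))
  (mul (add (cst 1) (mul j0 j0)) j11))); ring.
Qed.

Lemma jet_L : jet2 S E L z (a * b) (w00 * b + a * w11)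
  (t00 * b + a * t11 + 2 * w00 * w11 - 2 * w01 ^+ 2).
Proof.
by apply: (jet2_eq (add (mul j00 j11) (mul (cst (-1)) (mul j01 j01)))); ring.
Qed.

(** One computation for both directions: u, v, w and t stand for the jets of
    the first and second derivatives of f along E.  The value of Z at z is kept
    as is because only its derivatives matter. *)
Lemma jet_Z :
  let s := a + b in let x := s ^+ 2 in let y := a * b in
  let n := w00 + w11 in let l := w00 * b + a * w11 in
  let m := t00 + t11 + 2 * (u1 ^+ 2 * a + u0 ^+ 2 * b) in
  let h := t00 * b + a * t11 + 2 * w00 * w11 - 2 * w01 ^+ 2 in
  let dd := 2 * (u0 ^+ 2 + u1 ^+ 2) in
  jet2 S E Z z (Z z) (2 * s * zx x y c * n + zy x y c * l)
    (zx x y c * (2 * n ^+ 2 + 2 * s * m) + zy x y c * (h + y * dd)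
     + 4 * x * zxx x y * n ^+ 2 + 4 * s * zxy x y c * n * l + zyy x c * l ^+ 2
     + zd x y c * dd).
Proof.
move=> s x y n l m h dd.
have jNN := mul jet_N jet_N; have jLD := mul jet_L jet_D.
have jD3 := mul (mul jet_D jet_D) jet_D.
have jZ := add (mul (mul (add jNN (mul (cst (-1)) jLD)) jNN)
      (add jNN (mul (cst (-4)) jLD)))
  (mul (mul (mul (cst (-2 * c)) jD3) (add jNN (mul (cst (-3)) jLD))) jLD).
have [_ ZE _ _] := jZ.
apply: (jet2_eq jZ); first by rewrite -ZE.
- by rewrite /zx /zy -/s -/y -/n -/l /x; ring.
- rewrite /zx /zy /zxx /zxy /zyy /zd -/s -/n -/l -/m -/h -/dd /x /y; ring.
Qed.

(** The speed is known only through Et f * D^4 = N^3; differentiating this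
    identity twice and solving gives its jet without dividing functions. *)
Lemma jet_speed : jet2 S E (Et f) z ((a + b) ^+ 3)
  (3 * (a + b) ^+ 2 * (w00 + w11))
  (3 * (a + b) ^+ 2 * (t00 + t11 + 2 * (u1 ^+ 2 * a + u0 ^+ 2 * b))
   + 6 * (a + b) * (w00 + w11) ^+ 2
   - 8 * (u0 ^+ 2 + u1 ^+ 2) * (a + b) ^+ 3).
Proof.
have SG : S (Et f) := derivation_alg dt Sf.
have jG : jet2 S E (Et f) z (Et f z) (E (Et f) z) (E (E (Et f)) z) by [].
have jGD := mul jG (mul (mul jet_D jet_D) (mul jet_D jet_D)).
have jN3 := mul (mul jet_N jet_N) jet_N.
have [S1 e0 e1 e2] := jGD; have [S2 e0' e1' e2'] := jN3.
have eqO : {in O, (fun y => Et f y * (D y * D y * (D y * D y))) =1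
    (fun y => N y * N y * N y)}.
  move=> y Oy; have := flow Oy.
  by rewrite (_ : D y ^+ 4 = D y * D y * (D y * D y)); [move=> ->; ring|ring].
have E1eq : {in O, E (fun y => Et f y * (D y * D y * (D y * D y))) =1
    E (fun y => N y * N y * N y)}.
  by move=> y /set_mem Oy; apply: (derivation_congr dE).
have h0 := eqO z (mem_set Oz).
have h1 := E1eq z (mem_set Oz).
have h2 : E (E (fun y => Et f y * (D y * D y * (D y * D y)))) z =
    E (E (fun y => N y * N y * N y)) z.
  by apply: (derivation_congr dE) => //; exact: (derivation_alg dE).
have G0 : Et f z = (a + b) ^+ 3.
  have := etrans (esym e0) (etrans h0 e0'); rewrite !mulr1 => ->; ring.
have G1 : E (Et f) z = 3 * (a + b) ^+ 2 * (w00 + w11).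
  have h := etrans (esym e1) (etrans h1 e1').
  rewrite [LHS](_ : _ = E (Et f) z * (1 * 1 * (1 * 1)) +
   Et f z * ((0 * 1 + 1 * 0) * (1 * 1) + 1 * 1 * (0 * 1 + 1 * 0))); last by ring.
  by rewrite h; ring.
split=> //; rewrite (_ : E (E (Et f)) z = E (E (Et f)) z
  + 8 * (u0 ^+ 2 + u1 ^+ 2) * (Et f z) - 8 * (u0 ^+ 2 + u1 ^+ 2) * (Et f z)); last by ring.
rewrite [in X in _ - X]G0; congr (_ - _).
have h := etrans (esym e2) (etrans h2 e2').
transitivity (E (E (Et f)) z * (1 * 1 * (1 * 1)) +
         2 * E (Et f) z * ((0 * 1 + 1 * 0) * (1 * 1) + 1 * 1 * (0 * 1 + 1 * 0)) +
         Et f z *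
         ((2 * (u0 ^+ 2 + u1 ^+ 2) * 1 + 2 * 0 * 0 + 1 * (2 * (u0 ^+ 2 + u1 ^+ 2))) *
          (1 * 1) + 2 * (0 * 1 + 1 * 0) * (0 * 1 + 1 * 0) +
          1 * 1 *
          (2 * (u0 ^+ 2 + u1 ^+ 2) * 1 + 2 * 0 * 0 + 1 * (2 * (u0 ^+ 2 + u1 ^+ 2))))).
  by ring.
by rewrite h; ring.
Qed.

End Generic.

(** At z the gradient of f and f01 vanish, so Et f0, Et f1 and Et f01 drop out
    and only the second derivatives of the speed remain. *)
Lemma jet_Z_t :
  let s := a + b in let x := s ^+ 2 in let y := a * b in
  let g0 := E0 (E0 (Et f)) z in let g1 := E1 (E1 (Et f)) z in
  Et Z z = 2 * s * zx x y c * (g0 + g1) + zy x y c * (b * g0 + a * g1).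
Proof.
move=> s x y g0 g1.
have Sft := derivation_alg dt Sf.
have j0 : jet1 S Et f0 z 0 (E0 (Et f) z).
  by split=> //; rewrite comm0t ?inE.
have j1 : jet1 S Et f1 z 0 (E1 (Et f) z).
  by split=> //; rewrite comm1t ?inE.
have j00 : jet1 S Et f00 z a g0.
  split=> //; rewrite comm0t ?inE //; apply: (derivation_congr d0) => //.
  - exact: (derivation_alg dt).
  - exact: (derivation_alg d0).
  - by move=> u Ou; rewrite comm0t.
have j11 : jet1 S Et f11 z b g1.
  split=> //; rewrite comm1t ?inE //; apply: (derivation_congr d1) => //.
  - exact: (derivation_alg dt).
  - exact: (derivation_alg d1).
  - by move=> u Ou; rewrite comm1t.
have j01 : jet1 S Et f01 z 0 (Et f01 z) by [].
have cst := jet1_cst Oz aS dt; have add := @jet1_add _ _ _ _ _ _ Oz aS dt.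
have mul := @jet1_mul _ _ _ _ _ _ Oz aS dt.
have jD : jet1 S Et D z 1 0.
  by apply: (jet1_eq (add _ _ _ _ _ _ (cst 1) (add _ _ _ _ _ _ (mul _ _ _ _ _ _ j0 j0) (mul _ _ _ _ _ _ j1 j1)))); ring.
have jN : jet1 S Et N z s (g0 + g1).
  apply: (jet1_eq (add _ _ _ _ _ _ (add _ _ _ _ _ _ (mul _ _ _ _ _ _ (add _ _ _ _ _ _ (cst 1) (mul _ _ _ _ _ _ j1 j1)) j00)
  (mul _ _ _ _ _ _ (cst (-2)) (mul _ _ _ _ _ _ (mul _ _ _ _ _ _ j0 j1) j01)))
  (mul _ _ _ _ _ _ (add _ _ _ _ _ _ (cst 1) (mul _ _ _ _ _ _ j0 j0)) j11))); rewrite /s; ring.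
have jL : jet1 S Et L z y (b * g0 + a * g1).
  by apply: (jet1_eq (add _ _ _ _ _ _ (mul _ _ _ _ _ _ j00 j11) (mul _ _ _ _ _ _ (cst (-1)) (mul _ _ _ _ _ _ j01 j01)))); rewrite /y; ring.
have jNN := mul _ _ _ _ _ _ jN jN; have jLD := mul _ _ _ _ _ _ jL jD.
have jD3 := mul _ _ _ _ _ _ (mul _ _ _ _ _ _ jD jD) jD.
have [_ _ ->] := add _ _ _ _ _ _ (mul _ _ _ _ _ _ (mul _ _ _ _ _ _ (add _ _ _ _ _ _ jNN (mul _ _ _ _ _ _ (cst (-1)) jLD)) jNN)
      (add _ _ _ _ _ _ jNN (mul _ _ _ _ _ _ (cst (-4)) jLD)))
  (mul _ _ _ _ _ _ (mul _ _ _ _ _ _ (mul _ _ _ _ _ _ (cst (-2 * c)) jD3) (add _ _ _ _ _ _ jNN (mul _ _ _ _ _ _ (cst (-3)) jLD))) jLD).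
rewrite /zx /zy /x; ring.
Qed.

(** The inequality of the maximum principle.  Substituting the
    jets, Et Z becomes 3 H^2 (E0 E0 Z + E1 E1 Z) plus the term of
    [zero_order_le0] plus two gradient terms. *)
Lemma level_nonincreasing :
  c * (2 * ((a + b) ^+ 2 - 3 * (a * b)) * (a * b)) =
    ((a + b) ^+ 2 - a * b) * (a + b) ^+ 2 * ((a + b) ^+ 2 - 4 * (a * b)) ->
  E0 Z z = 0 -> E1 Z z = 0 -> E0 (E0 Z) z <= 0 -> E1 (E1 Z) z <= 0 ->
  Et Z z <= 0.
Proof.
move=> cQ Z0 Z1 Z00 Z11; rewrite jet_Z_t /=.
have [_ _ _ ->] := jet_speed d0 jet_f0_0 jet_f1_0 jet_f00_0 jet_f01_0 jet_f11_0.
have [_ _ _ ->] := jet_speed d1 jet_f0_1 jet_f1_1 jet_f00_1 jet_f01_1 jet_f11_1.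
have [_ _ e0 e00] := jet_Z d0 jet_f0_0 jet_f1_0 jet_f00_0 jet_f01_0 jet_f11_0.
have [_ _ e1 e11] := jet_Z d1 jet_f0_1 jet_f1_1 jet_f00_1 jet_f01_1 jet_f11_1.
move: Z0 Z1 Z00 Z11; rewrite {}e0 {}e1 {}e00 {}e11 => Z0 Z1 Z00 Z11.
have [ab|ab] := eqVneq a b.
  (* x = 4 y here, so P = 0, and 2 s zx + a zy = 0 *)
  have c0 : c = 0.
    have Q0 := Q_gt0 a0 b0; apply: (mulIf (lt0r_neq0 Q0)).
    by rewrite cQ mul0r ab; ring.
  by rewrite le_eqVlt; apply/orP; left; apply/eqP; rewrite c0 ab /zx /zy; ring.
have C := zero_order_le0 a0 b0 cQ.
have G0 : gradient_term a b c al ga <= 0.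
  by apply: gradient_le0 => //; rewrite -[RHS]Z0; ring.
have G1 : gradient_term b a c de be <= 0.
  apply: gradient_le0 => //; rewrite 1?eq_sym //.
    by rewrite [b + a]addrC [b * a]mulrC.
  by rewrite -[RHS]Z1 [b + a]addrC [b * a]mulrC; ring.
have s2 : 0 <= 3 * (a + b) ^+ 2 by rewrite mulr_ge0 ?sqr_ge0.
have H0 := mulr_ge0_le0 s2 Z00.
have H1 := mulr_ge0_le0 s2 Z11.
have := ler_wnDr H0 (ler_wnDr H1 (ler_wnDr C (ler_wnDr G0 G1))).
congr (_ <= _); rewrite /gradient_term /zd /zxx [b + a]addrC [b * a]mulrC; ring.
Qed.

End GraphFlow.

(** * Commuting vector fields dual to two functions *)

Lemma nonsingular_2x2_kernel (R : comPzRingType) (k p q r s u v : R) : k * (p * s - r * q) = 1 ->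
  p * u + q * v = 0 -> r * u + s * v = 0 -> u = 0 /\ v = 0.
Proof.
move=> kJ e1 e2; split.
  have -> : u = k * ((p * u + q * v) * s - (r * u + s * v) * q).
    by rewrite -[LHS]mulr1 -kJ; ring.
  by rewrite e1 e2 !mul0r subrr mulr0.
have -> : v = k * ((r * u + s * v) * p - (p * u + q * v) * r).
  by rewrite -[LHS]mulr1 -kJ; ring.
by rewrite e1 e2 !mul0r subrr mulr0.
Qed.

Section FrameFields.
Context {R : realFieldType} {T : Type}.
Variables (O : set T) (S : set (T -> R)) (D1 D2 Dt : (T -> R) -> T -> R).
Hypotheses (aS : function_algebra S) (d1 : derivation O S D1)
  (d2 : derivation O S D2) (dt : derivation O S Dt).
Hypothesis comm12 : forall g, S g -> {in O, D1 (D2 g) =1 D2 (D1 g)}.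
Hypothesis comm1t : forall g, S g -> {in O, Dt (D1 g) =1 D1 (Dt g)}.
Hypothesis comm2t : forall g, S g -> {in O, Dt (D2 g) =1 D2 (Dt g)}.

(** The vector field with components A1, A2, At in a chart with space
    derivatives D1, D2 and time derivative Dt. *)
Definition field (A1 A2 At : T -> R) (g : T -> R) (z : T) : R :=
  A1 z * D1 g z + A2 z * D2 g z + At z * Dt g z.

Section Field.
Variables (A1 A2 At : T -> R).
Hypotheses (S1 : S A1) (S2 : S A2) (St : S At).

Lemma field_alg g : S g -> S (field A1 A2 At g).
Proof.
move=> Sg; apply: (alg_add aS); last first.
  by apply: (alg_mul aS) => //; exact: (derivation_alg dt).
by apply: (alg_add aS); apply: (alg_mul aS) => //;
  [exact: (derivation_alg d1)|exact: (derivation_alg d2)].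
Qed.

Lemma field_derivation : derivation O S (field A1 A2 At).
Proof.
split.
- exact: field_alg.
- by move=> k z Oz; rewrite /field (derivation_cst d1) // (derivation_cst d2) // (derivation_cst dt) // !mulr0 !addr0.
- move=> f g z Sf Sg Oz; rewrite /field (derivation_add d1) // (derivation_add d2) // (derivation_add dt) //.
  by ring.
- move=> f g z Sf Sg Oz; rewrite /field (derivation_mul d1) // (derivation_mul d2) // (derivation_mul dt) //.
  by ring.
- move=> f g z Sf Sg fg Oz.
  by rewrite /field (derivation_congr d1 Sf Sg fg) // (derivation_congr d2 Sf Sg fg) //
    (derivation_congr dt Sf Sg fg).
Qed.

Lemma der_field (D : (T -> R) -> T -> R) g z : derivation O S D -> S g -> O z ->
  D (field A1 A2 At g) z =
    D A1 z * D1 g z + D A2 z * D2 g z + D At z * Dt g z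
    + (A1 z * D (D1 g) z + A2 z * D (D2 g) z + At z * D (Dt g) z).
Proof.
move=> dD Sg Oz.
have [Sg1 Sg2 Sgt] : [/\ S (D1 g), S (D2 g) & S (Dt g)].
  by split; [exact: (derivation_alg d1)|exact: (derivation_alg d2)|exact: (derivation_alg dt)].
have [M1 M2 Mt] := And3 (alg_mul aS S1 Sg1) (alg_mul aS S2 Sg2) (alg_mul aS St Sgt).
rewrite /field (derivation_add dD) //; last exact: (alg_add aS).
by rewrite (derivation_add dD) // !(derivation_mul dD) //; ring.
Qed.
End Field.

(** As D1, D2 and Dt commute, the bracket of two fields is again a field;
    its components are the differences on the right. *)
Lemma field_commutator A1 A2 At B1 B2 Bt g z :
  S A1 -> S A2 -> S At -> S B1 -> S B2 -> S Bt -> S g -> O z ->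
  let X := field A1 A2 At in let Y := field B1 B2 Bt in
  X (Y g) z - Y (X g) z = (X B1 z - Y A1 z) * D1 g z + (X B2 z - Y A2 z) * D2 g z
     + (X Bt z - Y At z) * Dt g z.
Proof.
move=> SA1 SA2 SAt SB1 SB2 SBt Sg Oz X Y.
have dX := field_derivation SA1 SA2 SAt.
have dY := field_derivation SB1 SB2 SBt.
rewrite /X /Y (der_field _ _ _ dX) // (der_field _ _ _ dY) // -/X -/Y.
have [z1 z2 zt] := And3 (comm12 Sg (mem_set Oz)) (comm1t Sg (mem_set Oz)) (comm2t Sg (mem_set Oz)).
have -> : B1 z * X (D1 g) z + B2 z * X (D2 g) z + Bt z * X (Dt g) z =
    A1 z * Y (D1 g) z + A2 z * Y (D2 g) z + At z * Y (Dt g) z.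
  by rewrite /X /Y /field z1 z2 zt; ring.
ring.
Qed.

Variables (h0 h1 k : T -> R).
Hypotheses (Sh0 : S h0) (Sh1 : S h1) (Sk : S k).
Hypothesis kJ : {in O, forall z, k z * (D1 h0 z * D2 h1 z - D2 h0 z * D1 h1 z) = 1}.

Let zero : T -> R := fun=> 0.
Let one : T -> R := fun=> 1.
(** E0 and E1 are dual to the differentials of h0 and h1: the inverse of the
    Jacobian matrix of (h0, h1), k being the inverse of its determinant. *)
Definition E0_1 z : R := k z * D2 h1 z.
Definition E0_2 z : R := k z * ((-1) * D1 h1 z).
Definition E1_1 z : R := k z * ((-1) * D2 h0 z).
Definition E1_2 z : R := k z * D1 h0 z.
(** Et is the time derivative at fixed h0 and h1. *)
Definition Et_1 z : R := (-1) * (Dt h0 z * E0_1 z + Dt h1 z * E1_1 z).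
Definition Et_2 z : R := (-1) * (Dt h0 z * E0_2 z + Dt h1 z * E1_2 z).
Definition E0 := field E0_1 E0_2 zero.
Definition E1 := field E1_1 E1_2 zero.
Definition Et := field Et_1 Et_2 one.

Let Sz : S zero := alg_cst aS 0.
Let So : S one := alg_cst aS 1.
Let Sm : S (fun=> -1) := alg_cst aS (-1).
Let S01 : S E0_1. Proof. exact: (alg_mul aS Sk (derivation_alg d2 Sh1)). Qed.
Let S02 : S E0_2. Proof. exact: (alg_mul aS Sk (alg_mul aS Sm (derivation_alg d1 Sh1))). Qed.
Let S11 : S E1_1. Proof. exact: (alg_mul aS Sk (alg_mul aS Sm (derivation_alg d2 Sh0))). Qed.
Let S12 : S E1_2. Proof. exact: (alg_mul aS Sk (derivation_alg d1 Sh0)). Qed.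
Let St1 : S Et_1.
Proof.
apply: (alg_mul aS Sm); apply: (alg_add aS); apply: (alg_mul aS) => //; exact: (derivation_alg dt).
Qed.
Let St2 : S Et_2.
Proof.
apply: (alg_mul aS Sm); apply: (alg_add aS); apply: (alg_mul aS) => //; exact: (derivation_alg dt).
Qed.

Lemma E0_derivation : derivation O S E0. Proof. exact: field_derivation. Qed.
Lemma E1_derivation : derivation O S E1. Proof. exact: field_derivation. Qed.
Lemma Et_derivation : derivation O S Et. Proof. exact: field_derivation. Qed.

Lemma D1_frame g z : O z -> D1 g z = D1 h0 z * E0 g z + D1 h1 z * E1 g z.
Proof.
move=> Oz; have := kJ (mem_set Oz); set J := _ - _ => kJz.
rewrite -[LHS]mul1r -kJz /E0 /E1 /field /zero /E0_1 /E0_2 /E1_1 /E1_2 /J; ring.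
Qed.

Lemma D2_frame g z : O z -> D2 g z = D2 h0 z * E0 g z + D2 h1 z * E1 g z.
Proof.
move=> Oz; have := kJ (mem_set Oz); set J := _ - _ => kJz.
rewrite -[LHS]mul1r -kJz /E0 /E1 /field /zero /E0_1 /E0_2 /E1_1 /E1_2 /J; ring.
Qed.

Lemma Dt_frame g z : Et g z = Dt g z - Dt h0 z * E0 g z - Dt h1 z * E1 g z.
Proof. by rewrite /Et /E0 /E1 /field /one /zero /Et_1 /Et_2; ring. Qed.

Lemma E0_h0 : {in O, E0 h0 =1 one}.
Proof. by move=> z Oz; rewrite /one -(kJ Oz) /E0 /field /zero /E0_1 /E0_2; ring. Qed.
Lemma E0_h1 : {in O, E0 h1 =1 zero}.
Proof. by move=> z Oz; rewrite /E0 /field /zero /E0_1 /E0_2; ring. Qed.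
Lemma E1_h0 : {in O, E1 h0 =1 zero}.
Proof. by move=> z Oz; rewrite /E1 /field /zero /E1_1 /E1_2; ring. Qed.
Lemma E1_h1 : {in O, E1 h1 =1 one}.
Proof. by move=> z Oz; rewrite /one -(kJ Oz) /E1 /field /zero /E1_1 /E1_2; ring. Qed.
Lemma Et_h0 : {in O, Et h0 =1 zero}.
Proof. by move=> z Oz; rewrite Dt_frame E0_h0 // E1_h0 // /zero /one; ring. Qed.
Lemma Et_h1 : {in O, Et h1 =1 zero}.
Proof. by move=> z Oz; rewrite Dt_frame E0_h1 // E1_h1 // /zero /one; ring. Qed.

Lemma der_const_on (E : (T -> R) -> T -> R) g c z : derivation O S E -> S g -> O z ->
  {in O, g =1 fun=> c} -> E g z = 0.
Proof.
move=> dE Sg Oz gc; rewrite (derivation_congr dE Sg (alg_cst aS c) gc Oz).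
exact: (derivation_cst dE).
Qed.

(** The bracket of two fields along which h0, h1 and t have constant
    derivatives kills h0, h1 and t; as h0, h1 and t are coordinates, it is zero. *)
Lemma field_commute A1 A2 At B1 B2 Bt (cA cB a0 a1 b0 b1 : R) g :
  S A1 -> S A2 -> S At -> S B1 -> S B2 -> S Bt ->
  {in O, At =1 fun=> cA} -> {in O, Bt =1 fun=> cB} ->
  let X := field A1 A2 At in let Y := field B1 B2 Bt in
  {in O, X h0 =1 fun=> a0} -> {in O, X h1 =1 fun=> a1} ->
  {in O, Y h0 =1 fun=> b0} -> {in O, Y h1 =1 fun=> b1} ->
  S g -> {in O, X (Y g) =1 Y (X g)}.
Proof.
move=> SA1 SA2 SAt SB1 SB2 SBt cAt cBt X Y X0 X1 Y0 Y1 Sg z /set_mem Oz.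
have dX : derivation O S X by exact: field_derivation.
have dY : derivation O S Y by exact: field_derivation.
(* the bracket has no time component *)
have t0 : X Bt z - Y At z = 0.
  by rewrite (der_const_on dX SBt Oz cBt) (der_const_on dY SAt Oz cAt) subrr.
have C f : S f -> X (Y f) z - Y (X f) z =
    (X B1 z - Y A1 z) * D1 f z + (X B2 z - Y A2 z) * D2 f z.
  by move=> Sf; rewrite field_commutator // -/X -/Y t0 mul0r addr0.
have Ch0 : (X B1 z - Y A1 z) * D1 h0 z + (X B2 z - Y A2 z) * D2 h0 z = 0.
  rewrite -C // (der_const_on dX (derivation_alg dY Sh0) Oz Y0).
  by rewrite (der_const_on dY (derivation_alg dX Sh0) Oz X0) subrr.
have Ch1 : (X B1 z - Y A1 z) * D1 h1 z + (X B2 z - Y A2 z) * D2 h1 z = 0.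
  rewrite -C // (der_const_on dX (derivation_alg dY Sh1) Oz Y1).
  by rewrite (der_const_on dY (derivation_alg dX Sh1) Oz X1) subrr.
have kJz := kJ (mem_set Oz).
apply/eqP; rewrite -subr_eq0 C //.
have kJ' : k z * (D1 h0 z * D2 h1 z - D1 h1 z * D2 h0 z) = 1.
  by rewrite [D1 h1 z * _]mulrC.
have [-> ->] : X B1 z - Y A1 z = 0 /\ X B2 z - Y A2 z = 0.
  by apply: (nonsingular_2x2_kernel kJ'); rewrite [D1 _ z * _]mulrC [D2 _ z * _]mulrC.
by rewrite !mul0r addr0.
Qed.

Lemma E0_E1 g : S g -> {in O, E0 (E1 g) =1 E1 (E0 g)}.
Proof.
exact: (field_commute S01 S02 Sz S11 S12 Sz (fun _ _ => erefl) (fun _ _ => erefl)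
  E0_h0 E0_h1 E1_h0 E1_h1).
Qed.

Lemma Et_E0 g : S g -> {in O, Et (E0 g) =1 E0 (Et g)}.
Proof.
exact: (field_commute St1 St2 So S01 S02 Sz (fun _ _ => erefl) (fun _ _ => erefl)
  Et_h0 Et_h1 E0_h0 E0_h1).
Qed.

Lemma Et_E1 g : S g -> {in O, Et (E1 g) =1 E1 (Et g)}.
Proof.
exact: (field_commute St1 St2 So S11 S12 Sz (fun _ _ => erefl) (fun _ _ => erefl)
  Et_h0 Et_h1 E1_h0 E1_h1).
Qed.

(** Second derivatives of g in the chart in terms of those in the frame, the
    first derivatives of g entering through the second derivatives of h0, h1.
    Stated for two arbitrary derivations to cover all the pairs at once. *)
Lemma frame_second (D D' : (T -> R) -> T -> R) g z : derivation O S D -> S g -> O z ->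
  {in O, D' g =1 fun y => D' h0 y * E0 g y + D' h1 y * E1 g y} ->
  (forall f, S f -> S (D' f)) ->
  (forall f, S f -> D f z = D h0 z * E0 f z + D h1 z * E1 f z) ->
  D (D' g) z = D (D' h0) z * E0 g z + D (D' h1) z * E1 g z
    + D' h0 z * (D h0 z * E0 (E0 g) z + D h1 z * E0 (E1 g) z)
    + D' h1 z * (D h0 z * E0 (E1 g) z + D h1 z * E1 (E1 g) z).
Proof.
move=> dD Sg Oz E SD' F.
have [SE0 SE1] := (derivation_alg E0_derivation Sg, derivation_alg E1_derivation Sg).
have M0 := alg_mul aS (SD' _ Sh0) SE0; have M1 := alg_mul aS (SD' _ Sh1) SE1.
rewrite (derivation_congr dD _ _ E) //; [|exact: SD'|exact: (alg_add aS)].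
rewrite (derivation_add dD) // !(derivation_mul dD) //; try exact: SD'.
rewrite (F _ SE0) (F _ SE1) -(E0_E1 Sg (mem_set Oz)); ring.
Qed.

End FrameFields.

(** * A parametrized surface seen as a graph *)

Section MovingGraph.
Context {R : realFieldType} {T : Type}.
Variables (O : set T) (S : set (T -> R)) (D1 D2 Dt : (T -> R) -> T -> R).
Hypotheses (aS : function_algebra S) (d1 : derivation O S D1)
  (d2 : derivation O S D2) (dt : derivation O S Dt).
Hypothesis comm12 : forall g, S g -> {in O, D1 (D2 g) =1 D2 (D1 g)}.
Hypothesis comm1t : forall g, S g -> {in O, Dt (D1 g) =1 D1 (Dt g)}.
Hypothesis comm2t : forall g, S g -> {in O, Dt (D2 g) =1 D2 (Dt g)}.
Variables (h0 h1 h2 k : T -> R).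
Hypotheses (Sh0 : S h0) (Sh1 : S h1) (Sh2 : S h2) (Sk : S k).
Hypothesis kJ : {in O, forall z, k z * (D1 h0 z * D2 h1 z - D2 h0 z * D1 h1 z) = 1}.

(** The first fundamental form of the surface with orthonormal coordinates
    h0, h1, h2 of its position vector. *)
Definition metric (D D' : (T -> R) -> T -> R) z : R :=
  D h0 z * D' h0 z + D h1 z * D' h1 z + D h2 z * D' h2 z.

Definition second_form (D D' : (T -> R) -> T -> R) (n0 n1 n2 : R) z : R :=
  - (D (D' h0) z * n0 + D (D' h1) z * n1 + D (D' h2) z * n2).

(** The geometry of the moving surface at z in terms of the coordinates
    h0, h1, h2 of the position and n0, n1, n2 of the normal.  The curvatures enter
    through trace and determinant, multiplied by the metric determinant so that
    no inverse matrix remains. *)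
Record flow_point (H K n0 n1 n2 : R) (z : T) := FlowPoint {
  fp_unit : n0 ^+ 2 + n1 ^+ 2 + n2 ^+ 2 = 1;
  fp_orth1 : D1 h0 z * n0 + D1 h1 z * n1 + D1 h2 z * n2 = 0;
  fp_orth2 : D2 h0 z * n0 + D2 h1 z * n1 + D2 h2 z * n2 = 0;
  fp_trace : H * (metric D1 D1 z * metric D2 D2 z - metric D1 D2 z ^+ 2) =
    metric D2 D2 z * second_form D1 D1 n0 n1 n2 z
    - 2 * metric D1 D2 z * second_form D1 D2 n0 n1 n2 z
    + metric D1 D1 z * second_form D2 D2 n0 n1 n2 z;
  fp_det : K * (metric D1 D1 z * metric D2 D2 z - metric D1 D2 z ^+ 2) =
    second_form D1 D1 n0 n1 n2 z * second_form D2 D2 n0 n1 n2 z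
    - second_form D1 D2 n0 n1 n2 z ^+ 2;
  fp_flow0 : Dt h0 z = - H ^+ 3 * n0;
  fp_flow1 : Dt h1 z = - H ^+ 3 * n1;
  fp_flow2 : Dt h2 z = - H ^+ 3 * n2 }.

Let f z : R := (-1) * h2 z.
Let F0 := E0 D1 D2 Dt h1 k.
Let F1 := E1 D1 D2 Dt h0 k.
Let Ft := Et D1 D2 Dt h0 h1 k.
Let D := gradD (F0 f) (F1 f).
Let N := traceN (F0 f) (F1 f) (F0 (F0 f)) (F0 (F1 f)) (F1 (F1 f)).
Let L := detL (F0 (F0 f)) (F0 (F1 f)) (F1 (F1 f)).

Let Sf : S f := alg_mul aS (alg_cst aS (-1)) Sh2.

Let dF0 : derivation O S F0 := E0_derivation aS d1 d2 dt Sh1 Sk.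
Let dF1 : derivation O S F1 := E1_derivation aS d1 d2 dt Sh0 Sk.

Lemma derivation_height (E : (T -> R) -> T -> R) z : derivation O S E -> O z -> E f z = - E h2 z.
Proof.
move=> dE Oz; rewrite /f (derivation_mul dE) ?(derivation_cst dE) //; last exact: (alg_cst aS).
by rewrite mul0r add0r mulN1r.
Qed.

Lemma derivation_derivation_height (E E' : (T -> R) -> T -> R) z : derivation O S E -> derivation O S E' ->
  O z -> E (E' f) z = - E (E' h2) z.
Proof.
move=> dE dE' Oz; have SE := derivation_alg dE' Sh2.
rewrite (@derivation_congr _ _ _ _ _ dE _ (fun z => (-1) * E' h2 z)) //.
- rewrite (derivation_mul dE) ?(derivation_cst dE) //; last exact: (alg_cst aS).
  by rewrite mul0r add0r mulN1r.
- exact: (derivation_alg dE').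
- exact: (alg_mul aS (alg_cst aS (-1)) SE).
- by move=> y /set_mem Oy; rewrite derivation_height // mulN1r.
Qed.

Lemma D1_in_frame g z : O z -> D1 g z = D1 h0 z * F0 g z + D1 h1 z * F1 g z.
Proof. exact: D1_frame. Qed.

Lemma D2_in_frame g z : O z -> D2 g z = D2 h0 z * F0 g z + D2 h1 z * F1 g z.
Proof. exact: D2_frame. Qed.

Lemma level_alg c : S (levelZ c D N L).
Proof.
have [A C M] := And3 (alg_add aS) (alg_cst aS) (alg_mul aS).
have S0 := derivation_alg dF0 Sf; have S1 := derivation_alg dF1 Sf.
have S00 := derivation_alg dF0 S0; have S01 := derivation_alg dF0 S1; have S11 := derivation_alg dF1 S1.
have SD : S D by exact: (A _ _ (C 1) (A _ _ (M _ _ S0 S0) (M _ _ S1 S1))).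
have SN : S N.
  exact: (A _ _ (A _ _ (M _ _ (A _ _ (C 1) (M _ _ S1 S1)) S00)
    (M _ _ (C (-2)) (M _ _ (M _ _ S0 S1) S01))) (M _ _ (A _ _ (C 1) (M _ _ S0 S0)) S11)).
have SL : S L by exact: (A _ _ (M _ _ S00 S11) (M _ _ (C (-1)) (M _ _ S01 S01))).
have SNN := M _ _ SN SN; have SLD := M _ _ SL SD.
exact: (A _ _ (M _ _ (M _ _ (A _ _ SNN (M _ _ (C (-1)) SLD)) SNN)
      (A _ _ SNN (M _ _ (C (-4)) SLD)))
  (M _ _ (M _ _ (M _ _ (C (-2 * c)) (M _ _ (M _ _ SD SD) SD))
     (A _ _ SNN (M _ _ (C (-3)) SLD))) SLD)).
Qed.

Lemma gradD_gt0 y : 0 < D y.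
Proof. by rewrite /D /gradD ltr_pwDl // addr_ge0 // -expr2 sqr_ge0. Qed.

Section Point.
Variables (z : T) (H K n0 n1 n2 : R).
Hypotheses (Oz : O z) (fp : flow_point H K n0 n1 n2 z).

(** Tangent vectors of a graph of height - f span the plane orthogonal to
    (f0, f1, 1). *)
Lemma normal_slope : n0 = n2 * F0 f z /\ n1 = n2 * F1 f z.
Proof.
have kJz := kJ (mem_set Oz).
have o1 := fp_orth1 fp; have o2 := fp_orth2 fp.
have e1 : D1 h0 z * (n0 - n2 * F0 f z) + D1 h1 z * (n1 - n2 * F1 f z) = 0.
  rewrite -o1 -[D1 h2 z]opprK -(derivation_height d1 Oz) [D1 f z]D1_in_frame //; ring.
have e2 : D2 h0 z * (n0 - n2 * F0 f z) + D2 h1 z * (n1 - n2 * F1 f z) = 0.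
  rewrite -o2 -[D2 h2 z]opprK -(derivation_height d2 Oz) [D2 f z]D2_in_frame //; ring.
have [/eqP u0 /eqP v0] := nonsingular_2x2_kernel kJz e1 e2.
by split; apply/eqP; rewrite -subr_eq0.
Qed.

Lemma normal_unit : n2 ^+ 2 * D z = 1.
Proof.
have [e0 e1] := normal_slope.
by rewrite -(fp_unit fp) [in RHS]e0 [in RHS]e1 /D /gradD; ring.
Qed.

(** The first derivatives of f produced by [frame_second] cancel
    against the tangential components of the normal, leaving the Hessian of f
    times n2. *)
Lemma second_form_frame (X Y : (T -> R) -> T -> R) :
  derivation O S X -> derivation O S Y ->
  (forall g y, O y -> X g y = X h0 y * F0 g y + X h1 y * F1 g y) ->
  (forall g y, O y -> Y g y = Y h0 y * F0 g y + Y h1 y * F1 g y) ->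
  second_form X Y n0 n1 n2 z = n2 * (
    Y h0 z * (X h0 z * F0 (F0 f) z + X h1 z * F0 (F1 f) z)
    + Y h1 z * (X h0 z * F0 (F1 f) z + X h1 z * F1 (F1 f) z)).
Proof.
move=> dX dY FX FY; have [e0 e1] := normal_slope.
have E : X (Y f) z = X (Y h0) z * F0 f z + X (Y h1) z * F1 f z
    + Y h0 z * (X h0 z * F0 (F0 f) z + X h1 z * F0 (F1 f) z)
    + Y h1 z * (X h0 z * F0 (F1 f) z + X h1 z * F1 (F1 f) z).
  apply: (frame_second aS d1 d2 dt) => //.
  - by move=> y /set_mem Oy; exact: FY.
  - exact: (derivation_alg dY).
  - by move=> g _; exact: FX.
rewrite /second_form -[X (Y h2) z]opprK -(derivation_derivation_height dX dY Oz) E e0 e1; ring.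
Qed.

Lemma metric_frame :
  [/\ metric D1 D1 z = D1 h0 z ^+ 2 + D1 h1 z ^+ 2
        + (D1 h0 z * F0 f z + D1 h1 z * F1 f z) ^+ 2,
      metric D1 D2 z = D1 h0 z * D2 h0 z + D1 h1 z * D2 h1 z
        + (D1 h0 z * F0 f z + D1 h1 z * F1 f z) * (D2 h0 z * F0 f z + D2 h1 z * F1 f z) &
      metric D2 D2 z = D2 h0 z ^+ 2 + D2 h1 z ^+ 2
        + (D2 h0 z * F0 f z + D2 h1 z * F1 f z) ^+ 2].
Proof.
rewrite /metric -[D1 h2 z]opprK -[D2 h2 z]opprK -(derivation_height d1 Oz) -(derivation_height d2 Oz).
by rewrite [D1 f z]D1_in_frame // [D2 f z]D2_in_frame //; split; ring.
Qed.

(** The square of the Jacobian determinant of (h0, h1) is a factor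
    common to both sides of the trace equation in the chart; k cancels it. *)
Lemma mean_curvature_graph : H * D z = n2 * N z.
Proof.
have kJz := kJ (mem_set Oz).
have := fp_trace fp; have [-> -> ->] := metric_frame.
rewrite !second_form_frame //; try exact: D1_in_frame; try exact: D2_in_frame.
move=> E; rewrite -[LHS]mul1r -[RHS]mul1r.
have k2 : k z ^+ 2 * (D1 h0 z * D2 h1 z - D2 h0 z * D1 h1 z) ^+ 2 = 1.
  by rewrite -exprMn kJz expr1n.
rewrite -k2 -[LHS]mulrA -[RHS]mulrA; congr (_ * _).
transitivity (H * ((D1 h0 z ^+ 2 + D1 h1 z ^+ 2 + (D1 h0 z * F0 f z + D1 h1 z * F1 f z) ^+ 2) *
     (D2 h0 z ^+ 2 + D2 h1 z ^+ 2 + (D2 h0 z * F0 f z + D2 h1 z * F1 f z) ^+ 2) -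
     (D1 h0 z * D2 h0 z + D1 h1 z * D2 h1 z +
      (D1 h0 z * F0 f z + D1 h1 z * F1 f z) * (D2 h0 z * F0 f z + D2 h1 z * F1 f z)) ^+ 2)).
  by rewrite /D /gradD; ring.
by rewrite E /N /traceN; ring.
Qed.

Lemma gauss_curvature_graph : K * D z ^+ 2 = L z.
Proof.
have kJz := kJ (mem_set Oz).
have nu := normal_unit.
have := fp_det fp; have [-> -> ->] := metric_frame.
rewrite !second_form_frame //; try exact: D1_in_frame; try exact: D2_in_frame.
move=> E.
have k2 : k z ^+ 2 * (D1 h0 z * D2 h1 z - D2 h0 z * D1 h1 z) ^+ 2 = 1.
  by rewrite -exprMn kJz expr1n.
have E2 : K * D z = n2 ^+ 2 * L z.
  rewrite -[LHS]mul1r -[RHS]mul1r -k2 -[LHS]mulrA -[RHS]mulrA; congr (_ * _).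
  transitivity (K * ((D1 h0 z ^+ 2 + D1 h1 z ^+ 2 + (D1 h0 z * F0 f z + D1 h1 z * F1 f z) ^+ 2) *
     (D2 h0 z ^+ 2 + D2 h1 z ^+ 2 + (D2 h0 z * F0 f z + D2 h1 z * F1 f z) ^+ 2) -
     (D1 h0 z * D2 h0 z + D1 h1 z * D2 h1 z +
      (D1 h0 z * F0 f z + D1 h1 z * F1 f z) * (D2 h0 z * F0 f z + D2 h1 z * F1 f z)) ^+ 2)).
    by rewrite /D /gradD; ring.
  by rewrite E /L /detL; ring.
by rewrite expr2 mulrA E2 mulrAC nu mul1r.
Qed.

(** Et f is the normal speed divided by n2, and n2^2 = 1 / D; the odd powers of
    n2 coming from H^3 and from the slope combine to an even one. *)
Lemma speed_graph : Ft f z * D z ^+ 4 = N z ^+ 3.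
Proof.
have nu := normal_unit; have [e0 e1] := normal_slope.
rewrite /Ft Dt_frame -/F0 -/F1 (derivation_height dt Oz) (fp_flow0 fp) (fp_flow1 fp) (fp_flow2 fp).
rewrite e0 e1.
transitivity ((H * D z) ^+ 3 * n2 * D z ^+ 2).
  by rewrite /D /gradD; ring.
rewrite mean_curvature_graph.
transitivity ((n2 ^+ 2 * D z) ^+ 2 * N z ^+ 3); first by ring.
by rewrite nu expr1n mul1r.
Qed.

(** Since N^2 = H^2 D^3 and L D = K D^3, each term of Z is D^9 times the
    corresponding one of P - c Q. *)
Lemma level_graph c w :
  w * (2 * (H ^+ 2 - 3 * K) * K) = (H ^+ 2 - K) * H ^+ 2 * (H ^+ 2 - 4 * K) ->
  levelZ c D N L z = D z ^+ 9 * (2 * (H ^+ 2 - 3 * K) * K) * (w - c).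
Proof.
move=> wE; have nu := normal_unit.
have N2 : N z ^+ 2 = H ^+ 2 * D z ^+ 3.
  transitivity ((n2 * N z) ^+ 2 * D z).
    by rewrite -[LHS]mul1r -nu; ring.
  by rewrite -mean_curvature_graph; ring.
have LD : L z * D z = K * D z ^+ 3.
  by rewrite -gauss_curvature_graph; ring.
rewrite /levelZ LD -expr2 N2.
transitivity (D z ^+ 9 * (w * (2 * (H ^+ 2 - 3 * K) * K))
   - D z ^+ 9 * (2 * (H ^+ 2 - 3 * K) * K) * c); last by ring.
by rewrite wE; ring.
Qed.

End Point.

Variables (z : T) (H K n0 n1 n2 w : T -> R).
Hypothesis Oz : O z.
Hypothesis fp : {in O, forall y, flow_point (H y) (K y) (n0 y) (n1 y) (n2 y) y}.
Hypotheses (H0 : 0 < H z) (K0 : 0 < K z).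
Hypothesis wE : {in O, forall y, w y * (2 * (H y ^+ 2 - 3 * K y) * K y) =
  (H y ^+ 2 - K y) * H y ^+ 2 * (H y ^+ 2 - 4 * K y)}.
Hypotheses (n0z : n0 z = 0) (n1z : n1 z = 0) (n2z : n2 z = 1).
Variables (v01 v02 v11 v12 : R).
Hypotheses (e00 : v01 * D1 h0 z + v02 * D2 h0 z = 1)
  (e01 : v01 * D1 h1 z + v02 * D2 h1 z = 0)
  (e10 : v11 * D1 h0 z + v12 * D2 h0 z = 0)
  (e11 : v11 * D1 h1 z + v12 * D2 h1 z = 1).
Hypothesis diag : v01 * v11 * D1 (D1 h2) z + (v01 * v12 + v02 * v11) * D1 (D2 h2) z
  + v02 * v12 * D2 (D2 h2) z = 0.

Let Z := levelZ (w z) D N L.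

(** At z the frame coincides with the orthonormal principal directions
    given by v01, v02, v11, v12. *)
Lemma F0_at_point g : F0 g z = v01 * D1 g z + v02 * D2 g z.
Proof.
rewrite (D1_in_frame g Oz) (D2_in_frame g Oz).
transitivity ((v01 * D1 h0 z + v02 * D2 h0 z) * F0 g z
  + (v01 * D1 h1 z + v02 * D2 h1 z) * F1 g z); last by ring.
by rewrite e00 e01 mul1r mul0r addr0.
Qed.

Lemma F1_at_point g : F1 g z = v11 * D1 g z + v12 * D2 g z.
Proof.
rewrite (D1_in_frame g Oz) (D2_in_frame g Oz).
transitivity ((v11 * D1 h0 z + v12 * D2 h0 z) * F0 g z
  + (v11 * D1 h1 z + v12 * D2 h1 z) * F1 g z); last by ring.
by rewrite e10 e11 mul1r mul0r add0r.
Qed.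

(** The result of [level_nonincreasing] in terms of chart derivatives.  At a
    critical point second derivatives transform as a quadratic form, so the sign
    condition on the chart Hessian of Z passes to E0 E0 Z and E1 E1 Z, and the
    orthonormal principal directions make f00 and f11 the principal curvatures. *)
Lemma level_dt_le0 :
  D1 Z z = 0 -> D2 Z z = 0 ->
  (forall u v, u ^+ 2 * D1 (D1 Z) z + 2 * u * v * D1 (D2 Z) z
     + v ^+ 2 * D2 (D2 Z) z <= 0) -> Dt Z z <= 0.
Proof.
move=> Z1 Z2 Zconc.
have Fz g : D1 g z = 0 -> D2 g z = 0 -> F0 g z = 0 /\ F1 g z = 0.
  by move=> g1 g2; rewrite F0_at_point F1_at_point g1 g2 !mulr0 addr0.
have o1 : D1 h2 z = 0.
  by have := fp_orth1 (fp (mem_set Oz)); rewrite n0z n1z n2z !mulr0 !add0r mulr1.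
have o2 : D2 h2 z = 0.
  by have := fp_orth2 (fp (mem_set Oz)); rewrite n0z n1z n2z !mulr0 !add0r mulr1.
have [f0z f1z] : F0 f z = 0 /\ F1 f z = 0.
  by apply: Fz; rewrite derivation_height // ?o1 ?o2 oppr0.
have second g : S g -> F0 g z = 0 -> F1 g z = 0 ->
   [/\ D1 (D1 g) z = D1 h0 z ^+ 2 * F0 (F0 g) z + 2 * D1 h0 z * D1 h1 z * F0 (F1 g) z
         + D1 h1 z ^+ 2 * F1 (F1 g) z,
      D1 (D2 g) z = D1 h0 z * D2 h0 z * F0 (F0 g) z
         + (D1 h0 z * D2 h1 z + D1 h1 z * D2 h0 z) * F0 (F1 g) z
         + D1 h1 z * D2 h1 z * F1 (F1 g) z &
      D2 (D2 g) z = D2 h0 z ^+ 2 * F0 (F0 g) z + 2 * D2 h0 z * D2 h1 z * F0 (F1 g) z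
         + D2 h1 z ^+ 2 * F1 (F1 g) z].
  move=> Sg g0 g1.
  have FS := frame_second aS d1 d2 dt comm12 comm1t comm2t Sh0 Sh1 Sk kJ _ Sg Oz.
  have P1 : {in O, D1 g =1 fun y => D1 h0 y * F0 g y + D1 h1 y * F1 g y}.
    by move=> y /set_mem Oy; exact: D1_in_frame.
  have P2 : {in O, D2 g =1 fun y => D2 h0 y * F0 g y + D2 h1 y * F1 g y}.
    by move=> y /set_mem Oy; exact: D2_in_frame.
  split.
  - rewrite (FS D1 D1 d1 P1 (derivation_alg d1)); last by move=> *; exact: D1_in_frame.
    by rewrite -/F0 -/F1 g0 g1; ring.
  - rewrite (FS D1 D2 d1 P2 (derivation_alg d2)); last by move=> *; exact: D1_in_frame.
    by rewrite -/F0 -/F1 g0 g1; ring.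
  - rewrite (FS D2 D2 d2 P2 (derivation_alg d2)); last by move=> *; exact: D2_in_frame.
    by rewrite -/F0 -/F1 g0 g1; ring.
have second_at g : S g -> F0 g z = 0 -> F1 g z = 0 ->
  [/\ F0 (F0 g) z = v01 ^+ 2 * D1 (D1 g) z + 2 * v01 * v02 * D1 (D2 g) z
         + v02 ^+ 2 * D2 (D2 g) z,
      F0 (F1 g) z = v01 * v11 * D1 (D1 g) z + (v01 * v12 + v02 * v11) * D1 (D2 g) z
         + v02 * v12 * D2 (D2 g) z &
      F1 (F1 g) z = v11 ^+ 2 * D1 (D1 g) z + 2 * v11 * v12 * D1 (D2 g) z
         + v12 ^+ 2 * D2 (D2 g) z].
  move=> Sg g0 g1; have [-> -> ->] := second g Sg g0 g1.
  move: (F0 (F0 g) z) (F0 (F1 g) z) (F1 (F1 g) z) => A B C.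
  split.
  - transitivity ((v01 * D1 h0 z + v02 * D2 h0 z) ^+ 2 * A
      + 2 * (v01 * D1 h0 z + v02 * D2 h0 z) * (v01 * D1 h1 z + v02 * D2 h1 z) * B
      + (v01 * D1 h1 z + v02 * D2 h1 z) ^+ 2 * C); last by ring.
    by rewrite e00 e01; ring.
  - transitivity ((v01 * D1 h0 z + v02 * D2 h0 z) * (v11 * D1 h0 z + v12 * D2 h0 z) * A
      + ((v01 * D1 h0 z + v02 * D2 h0 z) * (v11 * D1 h1 z + v12 * D2 h1 z)
        + (v01 * D1 h1 z + v02 * D2 h1 z) * (v11 * D1 h0 z + v12 * D2 h0 z)) * B
      + (v01 * D1 h1 z + v02 * D2 h1 z) * (v11 * D1 h1 z + v12 * D2 h1 z) * C);
      last by ring.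
    by rewrite e00 e01 e10 e11; ring.
  - transitivity ((v11 * D1 h0 z + v12 * D2 h0 z) ^+ 2 * A
      + 2 * (v11 * D1 h0 z + v12 * D2 h0 z) * (v11 * D1 h1 z + v12 * D2 h1 z) * B
      + (v11 * D1 h1 z + v12 * D2 h1 z) ^+ 2 * C); last by ring.
    by rewrite e10 e11; ring.
have f01z : F0 (F1 f) z = 0.
  have [_ -> _] := second_at f Sf f0z f1z.
  rewrite (derivation_derivation_height d1 d1) // (derivation_derivation_height d1 d2) // (derivation_derivation_height d2 d2) //.
  transitivity (- (v01 * v11 * D1 (D1 h2) z + (v01 * v12 + v02 * v11) * D1 (D2 h2) z
    + v02 * v12 * D2 (D2 h2) z)); first by ring.
  by rewrite diag oppr0.
have Dz : D z = 1 by rewrite /D /gradD f0z f1z mul0r !addr0.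
have ab : F0 (F0 f) z + F1 (F1 f) z = H z.
  have := mean_curvature_graph Oz (fp (mem_set Oz)).
  by rewrite Dz n2z mul1r mulr1 /N /traceN f0z f1z f01z => ->; ring.
have abK : F0 (F0 f) z * F1 (F1 f) z = K z.
  have := gauss_curvature_graph Oz (fp (mem_set Oz)).
  by rewrite Dz expr1n mulr1 /L /detL f01z => ->; ring.
have [a0 b0] : 0 < F0 (F0 f) z /\ 0 < F1 (F1 f) z.
  move: H0 K0; rewrite -ab -abK; move: (F0 (F0 f) z) (F1 (F1 f) z) => A B AB0 ABK.
  have [A0|A0] := ltP 0 A; first by split=> //; rewrite -(pmulr_rgt0 _ A0).
  have B0 : 0 < B by lra.
  by move: ABK; rewrite pmulr_lgt0 // ltNge A0.
have [Z0 Z1'] := Fz Z Z1 Z2.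
have SZ : S Z := level_alg (w z).
have [Z00 _ Z11] := second_at Z SZ Z0 Z1'.
have -> : Dt Z z = Ft Z z.
  by rewrite /Ft Dt_frame -/F0 -/F1 Z0 Z1' !mulr0 !subr0.
apply: (level_nonincreasing Oz aS dF0 dF1 (Et_derivation aS d1 d2 dt Sh0 Sh1 Sk)
  _ _ _ Sf _ f0z f1z f01z erefl erefl a0 b0 _ Z0 Z1').
- by move=> g Sg; exact: (E0_E1 aS d1 d2 dt).
- by move=> g Sg; exact: (Et_E0 aS d1 d2 dt).
- by move=> g Sg; exact: (Et_E1 aS d1 d2 dt).
- by move=> y Oy; exact: (speed_graph (set_mem Oy) (fp Oy)).
- by rewrite ab abK wE ?inE.
- by rewrite -/Z Z00; exact: Zconc.
- by rewrite -/Z Z11; exact: Zconc.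
Qed.

End MovingGraph.

(** * Charts of a moving surface *)

Section SmoothDerivations.
Context {R : realType} {V : normedModType R}.
Variables (O : set V) (oO : open O).

Lemma smooth_function_algebra :
  function_algebra [set f : V -> R | smooth_on_open O f].
Proof.
split=> [k|f g|f g] /=.
- exact: smooth_cst.
- exact: smooth_add.
- exact: smooth_mul.
Qed.

Lemma smooth_derivation (v : V) :
  derivation O [set f : V -> R | smooth_on_open O f] (fun f => 'D_v f).
Proof.
split=> [f|k z _|f g z sf sg Oz|f g z sf sg Oz|f g z _ _ fg Oz] /=.
- exact: smooth_derive.
- exact: derive_cst.
- by apply: deriveD; [exact: smooth_derivable sf Oz|exact: smooth_derivable sg Oz].
- have := deriveM (smooth_derivable (v := v) sf Oz) (smooth_derivable (v := v) sg Oz).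
  move=> E; apply: (etrans E); rewrite addrC; congr (_ + _).
  exact: mulrC.
- exact: derive_congr fg Oz.
Qed.

Lemma smooth_derivations_commute (v w : V) (f : V -> R) : smooth_on_open O f ->
  {in O, 'D_v ('D_w f) =1 'D_w ('D_v f)}.
Proof. by move=> sf z /set_mem Oz; apply: (derive_comm _ _ oO Oz sf). Qed.

End SmoothDerivations.

Section Charts.
Context {R : realType}.

(** Relative openness of the image comes from continuity of the inverse
    diffeomorphism, which extends continuously near each point. *)
Lemma local_param_comp (N M : set 'rV[R]_3) U phi F :
  local_param N U phi -> diffeo_onto N M F -> local_param M U (F \o phi).
Proof.
move=> [ oU [sphi [psi [spsi _ phiK psiK]]] [ O2 oO2 phiU]] [sF [G [sG FN FK GK]]].
have UN u : U u -> N (phi u).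
  move=> Uu; have : (phi @` U) (phi u) by exists u.
  by rewrite phiU => -[].
split=> //.
  split.
    apply: (smooth_on_comp (rV_coordinates _) (rV_coordinates _) _ sphi sF).
    exact: UN.
  exists (psi \o G); split=> //.
  - apply: (@smooth_on_comp _ _ _ _ (rV_coordinates _) (rV_coordinates _) _ (phi @` U)).
    + by move=> _ [u Uu <-] /=; exists u; rewrite // FK // inE; apply: UN.
    + apply: smooth_on_subset sG => _ [u Uu <-] /=; rewrite -FN.
      by exists (phi u) => //; apply: UN.
    + exact: spsi.
  - move=> u /set_mem Uu /=; rewrite FK ?phiK ?inE //; exact: UN.
  - move=> _ /set_mem [u Uu <-] /=; rewrite FK ?phiK ?inE //; exact: UN.
exists ([set p | M p -> O2 (G p)]^°); first exact: open_interior.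
apply/seteqP; split=> [_ [u Uu <-] /=|p [Mp /interior_subset /(_ Mp) O2p]].
  have Nu := UN _ Uu; have Mu : M (F (phi u)) by rewrite -FN; exists (phi u).
  split=> //.
  have [P [g [ oP Pu cg Gg]]] := smooth_on_continuous sG Mu.
  have gu : g (F (phi u)) = phi u by rewrite -Gg ?inE // FK ?inE.
  have O2u : O2 (phi u).
    have : (phi @` U) (phi u) by exists u.
    by rewrite phiU => -[].
  have n1 : \forall q \near F (phi u), O2 (g q).
    by apply: cg; rewrite /= gu; apply: open_nbhs_nbhs.
  have n2 : \forall q \near F (phi u), P q by apply: open_nbhs_nbhs.
  apply: filterS (filterI n1 n2) => q [ O2q Pq] Mq.
  by rewrite Gg // inE.
have : (N `&` O2) (G p).
  split=> //; move: Mp; rewrite -FN => -[x Nx <-].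
  by rewrite FK ?inE.
rewrite -phiU => -[u Uu uE]; exists u => //=.
by rewrite uE GK ?inE.
Qed.

Lemma smooth_fst : smooth_on_open setT (@fst 'rV[R]_2 R).
Proof.
apply/(smooth_coordP (rV_coordinates 2) _ openT) => i.
exact: (smooth_lin openT (@cfun_continuous _ _
  (pair_coordinates (rV_coordinates 2)) (inl i))).
Qed.

(** The family is smooth on N x [0, T) in the sense of local extensions, so a
    chart is obtained on a full neighbourhood in space and time even when t0 = 0.
    The last clause turns a neighbourhood of parameters into one of points of N. *)
Lemma moving_chart (J : set R) (N : set 'rV[R]_3) X M t0 x0 :
  smooth_family J N X M -> J t0 -> N x0 ->
  exists (U : set 'rV[R]_2) (phi : 'rV[R]_2 -> 'rV[R]_3) (psi : 'rV[R]_3 -> 'rV[R]_2)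
    (O : set ('rV[R]_2 * R)%type) (Y : 'rV[R]_2 * R -> 'rV[R]_3),
  [/\ open O /\ O (psi x0, t0), smooth_on_open O Y,
      forall u t, O (u, t) -> U u /\ (J t -> Y (u, t) = X t (phi u)),
      (forall t, J t -> local_param (M t) U (X t \o phi)) /\
      (forall u, U u -> N (phi u)) &
      phi (psi x0) = x0 /\ forall A, nbhs (psi x0) A ->
        \forall x \near x0, N x -> A (psi x) /\ phi (psi x) = x].
Proof.
move=> [[_ _ _ charts] sX dX] It0 Nx0.
have [U [phi [lp phix0]]] := charts x0 Nx0.
have [ oU [sphi [psi [spsi _ phiK psiK]]] [ O2 oO2 phiU]] := lp.
have UN u : U u -> N (phi u).
  move=> Uu; have : (phi @` U) (phi u) by exists u.
  by rewrite phiU => -[].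
have [P [g [ oP Px0 sg Xg]]] := sX (x0, t0) (conj Nx0 It0).
have phi0 : phi (psi x0) = x0 by rewrite psiK ?inE.
have U0 : U (psi x0) by case: phix0 => u Uu <-; rewrite phiK ?inE.
have sphiU := smooth_on_openP oU sphi.
pose O1 : set ('rV[R]_2 * R)%type := fst @^-1` U.
have oO1 : open O1.
  by apply: open_comp => // z _; exact: (smooth_continuous smooth_fst I).
pose Phi (z : 'rV[R]_2 * R) := (phi z.1, z.2).
have sPhi : smooth_on_open O1 Phi.
  apply/(smooth_coordP (pair_coordinates (rV_coordinates 3)) Phi oO1) => -[i|[]] /=.
    have sp : smooth_on_open O1 (phi \o fst).
      apply: (smooth_comp (rV_coordinates 2) (rV_coordinates 3) oO1 oU) => //.
      by apply: smooth_subset smooth_fst.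
    exact: (smooth_lin_comp oO1 (@cfun_continuous _ _ (rV_coordinates 3) i) sp).
  exact: (smooth_lin oO1 (@cfun_continuous _ _
    (pair_coordinates (rV_coordinates 2)) (inr tt))).
pose O : set ('rV[R]_2 * R)%type := O1 `&` (Phi @^-1` P)^°.
have OP : O `<=` O1 `&` (Phi @^-1` P).
  by move=> y [Oy]; move/interior_subset.
have oO : open O by apply: openI => //; exact: open_interior.
exists U, phi, psi, O, (g \o Phi); split=> //.
- split=> //; split=> //.
  have cPhi := smooth_continuous sPhi (U0 : O1 (psi x0, t0)).
  by apply: cPhi; rewrite /Phi /= phi0; apply: open_nbhs_nbhs.
- apply: (smooth_comp (pair_coordinates (rV_coordinates 3)) (rV_coordinates 3) oO oP).
  + by move=> z /OP[].
  + by apply: smooth_subset sPhi => z /OP[].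
  + exact: sg.
- move=> u t /OP[Uu Pz]; split=> // It /=.
  by rewrite -Xg // inE; split=> //; split=> //=; apply: UN.
- by split=> // t It; apply: local_param_comp lp (dX t It).
split=> // A A0.
have [Q [h [ oQ Qx ch psih]]] := smooth_on_continuous spsi phix0.
have h0 : h x0 = psi x0 by rewrite psih // inE.
have n1 : \forall x \near x0, A (h x) by apply: ch; rewrite /= h0.
have n2 : \forall x \near x0, Q x by apply: open_nbhs_nbhs.
have n3 : \forall x \near x0, O2 x.
  by apply: open_nbhs_nbhs; split=> //; move: phix0; rewrite phiU => -[].
apply: filterS (filterI n1 (filterI n2 n3)) => x [Ax [Qx' O2x]] Nx.
have ix : (phi @` U) x by rewrite phiU.
by rewrite psih ?inE //; split=> //; rewrite -psih ?inE // psiK ?inE.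
Qed.

End Charts.

(** * Time derivatives and curvatures in a chart *)

Section Slices.
Context {R : realType}.

Lemma derive_slice (W : normedModType R) (O : set ('rV[R]_2 * R)%type)
    (Y : 'rV[R]_2 * R -> W) (F : 'rV[R]_2 -> W) u t w :
  open O -> O (u, t) -> (forall v, O (v, t) -> Y (v, t) = F v) ->
  'D_w F u = 'D_(w, 0) Y (u, t).
Proof.
move=> oO Out YF.
have slice : \forall v \near u, O (v, t).
  have c : (v, t) @[v --> u] --> (u, t) by exact: (cvg_pair (@cvg_id _ (nbhs u)) (cvg_cst t)).
  exact: (c O (open_nbhs_nbhs (conj oO Out))).
rewrite (@near_eq_derive _ _ _ F (fun v => Y (v, t))); last first.
  by apply: filterS slice => v Ov; rewrite YF.
rewrite /derive.
set g1 := fun h => h^-1 *: _; set g2 := fun h => h^-1 *: _.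
suff -> : g1 = g2 by [].
apply/funext => h; rewrite /g1 /g2 /=; congr (_ *: (Y _ - _)).
by congr (_, _); rewrite /= scaler0 add0r.
Qed.

(** The limit within [0, T) restricts to right-hand increments, which are
    available at every t in [0, T); the two-sided derivative of Y is determined
    by them. *)
Lemma derive_within_time (T t : R) (Y : 'rV[R]_2 * R -> 'rV[R]_3)
    (O : set ('rV[R]_2 * R)%type) (F : R -> 'rV[R]_3) u v :
  0 <= t < T -> open O -> O (u, t) -> derivable Y (u, t) (0, 1) ->
  (forall s, O (u, s) -> 0 <= s < T -> Y (u, s) = F s) ->
  is_derive_within `[0, T[ F t v -> 'D_(0, 1) Y (u, t) = v.
Proof.
move=> /andP[t0 tT] oO Out dY YF dF.
have right0 : \forall h \near 0^'+, (0 : R) < h by exact: nbhs_right_gt.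
have tto : h + t @[h --> (0 : R)^'+] --> t.
  have h0 : h + t @[h --> (0 : R)] --> 0 + t by apply: cvgD; [exact: cvg_id|exact: cvg_cst].
  rewrite add0r in h0; apply: cvg_trans h0; apply: cvg_app; exact: cvg_within.
have inT : \forall h \near (0 : R)^'+, h + t < T.
  exact: (tto _ (open_nbhs_nbhs (conj (@open_lt _ T) tT))).
have inO : \forall h \near (0 : R)^'+, O (u, h + t).
  have c : (u, s) @[s --> t] --> (u, t) by exact: (cvg_pair (cvg_cst u) (@cvg_id _ (nbhs t))).
  exact: (tto _ (c O (open_nbhs_nbhs (conj oO Out)))).
have cF : h^-1 *: (F (h + t) - F t) @[h --> (0 : R)^'+] --> v.
  have shift_within : h + t @[h --> (0 : R)^'+] --> within [set` `[0, T[] t^'.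
    move=> A; rewrite /within /= => nA.
    have {}nA : \forall s \near t, s != t -> [set` `[0, T[] s -> A s by exact: nA.
    have {}nA : \forall h \near (0 : R)^'+,
        h + t != t -> [set` `[0, T[] (h + t) -> A (h + t) by exact: tto _ nA.
    apply: filterS (filterI nA (filterI right0 inT)) => h [hA [hp hT]].
    apply: hA; first by rewrite gt_eqF // ltrDr.
    by rewrite /= in_itv /= hT andbT addr_ge0 // ltW.
  have cs := cvg_comp _ _ shift_within dF.
  apply: cvg_trans cs; apply: near_eq_cvg; near=> h.
  by rewrite /= addrK.
have cY : h^-1 *: (F (h + t) - F t) @[h --> (0 : R)^'+] --> 'D_(0, 1) Y (u, t).
  have cs : h^-1 *: ((Y \o shift (u, t)) (h *: (0, 1)) - Y (u, t)) @[h --> (0 : R)^'+]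
     --> 'D_(0, 1) Y (u, t).
    apply: cvg_trans dY; apply: cvg_app => A A0.
    have {}A0 : \forall h \near (0 : R), h != 0 -> A h by exact: A0.
    apply: (@filterS _ (nbhs (0 : R)) _ _ _ _ A0) => h hA hp.
    by apply: hA; rewrite gt_eqF.
  apply: cvg_trans cs; apply: near_eq_cvg; near=> h.
  have hp : 0 < h by near: h.
  have hT : h + t < T by near: h.
  have hO : O (u, h + t) by near: h.
  have -> : (Y \o shift (u, t)) (h *: (0, 1)) = Y (u, h + t).
    rewrite /= /shift; congr (Y _); apply: injective_projections => /=.
      by rewrite scaler0 add0r.
    by rewrite [h *: 1]mulr1.
  by rewrite !YF // ?t0 ?tT // hT andbT addr_ge0 // ltW.
exact: cvg_unique cY cF.
Unshelve. all: by end_near. Qed.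

End Slices.

Section Curvatures.
Context {R : realType}.

Lemma det_2x2 (A : 'M[R]_2) : \det A = A 0 0 * A 1 1 - A 0 1 * A 1 0.
Proof.
rewrite (expand_det_row _ 0) !big_ord_recl big_ord0 /cofactor !det_mx11 !mxE /=.
have -> : lift 0 0 = 1 :> 'I_2 by apply: val_inj.
have -> : lift 1 0 = 0 :> 'I_2 by apply: val_inj.
by rewrite expr0 expr1; ring.
Qed.

(** Cleared of denominators, so that the curvature equations do not mention
    the inverse of the metric. *)
Lemma trace_det_2x2 (g h B : 'M[R]_2) : g *m B = h ->
  \tr B * \det g = g 1 1 * h 0 0 - g 0 1 * h 1 0 + g 0 0 * h 1 1 - g 1 0 * h 0 1.
Proof.
have sum2 (F : 'I_2 -> R) : \sum_i F i = F 0 + F 1.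
  by rewrite big_ord_recl big_ord1; congr (_ + F _); apply: val_inj.
move=> <-; rewrite /mxtrace !mxE !sum2 det_2x2; ring.
Qed.

(** Nondegeneracy of the metric is a consequence: the
    determinant of the shape operator is l1 l2 > 0, but it contains the
    factor (det G)^-1, which is 0 when det G = 0. *)
Lemma principal_curvature_equations (M : set 'rV[R]_3) nu l1 l2 U F u
    (d : 'I_2 -> 'rV[R]_3) (dd : 'I_2 -> 'I_2 -> 'rV[R]_3) :
  principal_curvatures M nu l1 l2 -> local_param M U F -> U u ->
  0 < l1 (F u) -> 0 < l2 (F u) ->
  (forall i, partial F i u = d i) ->
  (forall i j, partial (partial F i) j u = dd i j) ->
  let g i j := dot (d i) (d j) in
  let h i j := - dot (dd i j) (nu (F u)) in
  [/\ g 0 0 * g 1 1 - g 0 1 * g 1 0 != 0,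
    (l1 (F u) + l2 (F u)) * (g 0 0 * g 1 1 - g 0 1 * g 1 0) =
      g 1 1 * h 0 0 - g 0 1 * h 1 0 + g 0 0 * h 1 1 - g 1 0 * h 0 1 &
    l1 (F u) * l2 (F u) * (g 0 0 * g 1 1 - g 0 1 * g 1 0) =
      h 0 0 * h 1 1 - h 0 1 * h 1 0].
Proof.
move=> pc lp Uu l1p l2p dE ddE g h; have := pc U F u lp Uu.
set G := first_fundamental_form F u; set Hm := second_fundamental_form F (nu (F u)) u.
set B := invmx G *m Hm => E.
pose a := l1 (F u); pose b := l2 (F u).
have polyE : ('X - a%:P) * ('X - b%:P) = 'X * ('X - (a + b)%:P) + (a * b)%:P.
  by rewrite polyCD polyCM; ring.
have trB : \tr B = a + b.
  have := char_poly_trace B isT; rewrite E polyE coefD coefC coefXM coefB coefX coefC /=.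
  by rewrite sub0r addr0 => /oppr_inj.
have detB : \det B = a * b.
  have := char_poly_det B; rewrite E polyE coefD coefC coefXM /= add0r sqrrN expr1n mul1r.
  by [].
have GE i j : G i j = g i j by rewrite mxE !dE.
have HE i j : Hm i j = h i j by rewrite mxE ddE.
have detG : \det G = g 0 0 * g 1 1 - g 0 1 * g 1 0.
  by rewrite det_2x2 !GE.
have G0 : \det G != 0.
  apply/eqP => G0; have : \det B = 0.
    by rewrite /B det_mulmx det_inv G0 invr0 mul0r.
  by move/eqP; rewrite detB mulf_eq0 !gt_eqF.
have GB : G *m B = Hm by rewrite /B mulKVmx // unitmxE unitfE.
split; first by rewrite -detG.
  by rewrite -detG -trB (trace_det_2x2 GB) !GE !HE.
by rewrite -detG -detB mulrC -det_mulmx GB det_2x2 !HE.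
Qed.

(** (B, d + r) is an eigenvector of the traceless part of the symmetric
    matrix with rows (A, B) and (B, C); it vanishes only if B = 0. *)
Lemma diagonalizing_rotation (A B C : R) : exists c s : R,
  c ^+ 2 + s ^+ 2 = 1 /\ c * s * (C - A) + (c ^+ 2 - s ^+ 2) * B = 0.
Proof.
have [->|B0] := eqVneq B 0.
  by exists 1, 0; split; ring.
pose d := (C - A) / 2; pose r := Num.sqrt (d ^+ 2 + B ^+ 2).
have r2 : r ^+ 2 = d ^+ 2 + B ^+ 2 by rewrite sqr_sqrtr // addr_ge0 ?sqr_ge0.
pose q := Num.sqrt (B ^+ 2 + (d + r) ^+ 2).
have q2p : 0 < B ^+ 2 + (d + r) ^+ 2 by rewrite ltr_pwDl ?sqr_ge0 // exprn_even_gt0.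
have q2 : q ^+ 2 = B ^+ 2 + (d + r) ^+ 2 by rewrite sqr_sqrtr // ltW.
have q0 : q != 0 by rewrite gt_eqF // sqrtr_gt0.
exists (B / q), ((d + r) / q); split.
  by rewrite !exprMn -mulrDl -q2 -exprMn divff // expr1n.
have -> : C - A = 2 * d by rewrite /d; field.
transitivity (B * (d ^+ 2 + B ^+ 2 - r ^+ 2) / q ^+ 2); first by field.
by rewrite r2 subrr mulr0 mul0r.
Qed.

(** Gram-Schmidt for the metric g, then a rotation that
    diagonalizes h in the resulting orthonormal basis. *)
Lemma simultaneous_diagonalization (g11 g12 g22 h11 h12 h22 : R) :
  0 < g11 -> 0 < g11 * g22 - g12 ^+ 2 -> exists v01 v02 v11 v12 : R,
  [/\ v01 ^+ 2 * g11 + 2 * v01 * v02 * g12 + v02 ^+ 2 * g22 = 1,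
      v01 * v11 * g11 + (v01 * v12 + v02 * v11) * g12 + v02 * v12 * g22 = 0,
      v11 ^+ 2 * g11 + 2 * v11 * v12 * g12 + v12 ^+ 2 * g22 = 1 &
      v01 * v11 * h11 + (v01 * v12 + v02 * v11) * h12 + v02 * v12 * h22 = 0].
Proof.
move=> g0 det0.
pose p := (Num.sqrt g11)^-1; have p2 : p ^+ 2 * g11 = 1.
  by rewrite exprVn sqr_sqrtr ?ltW // mulVf // gt_eqF.
pose e := g11 * g22 - g12 ^+ 2.
pose q := (Num.sqrt (g11 * e))^-1; have q2 : q ^+ 2 * (g11 * e) = 1.
  by rewrite exprVn sqr_sqrtr ?mulVf ?ltW ?gt_eqF // mulr_gt0.
(* (p, 0) and (y1, y2) are orthonormal for g *)
pose y1 := - g12 * q; pose y2 := g11 * q.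
pose A := p ^+ 2 * h11; pose B := p * y1 * h11 + p * y2 * h12.
pose C := y1 ^+ 2 * h11 + 2 * y1 * y2 * h12 + y2 ^+ 2 * h22.
have [c [s [cs1 rot]]] := diagonalizing_rotation A B C.
have yy : y1 ^+ 2 * g11 + 2 * y1 * y2 * g12 + y2 ^+ 2 * g22 = 1.
  by rewrite -[RHS]q2 /y1 /y2 /e; ring.
have py : p * (y1 * g11 + y2 * g12) = 0 by rewrite /y1 /y2; ring.
exists (c * p + s * y1), (s * y2), (c * y1 - s * p), (c * y2); split.
- transitivity (c ^+ 2 * (p ^+ 2 * g11)
    + s ^+ 2 * (y1 ^+ 2 * g11 + 2 * y1 * y2 * g12 + y2 ^+ 2 * g22)
    + 2 * c * s * (p * (y1 * g11 + y2 * g12))); first by ring.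
  by rewrite yy p2 py mulr0 addr0 !mulr1.
- transitivity (c * s * (y1 ^+ 2 * g11 + 2 * y1 * y2 * g12 + y2 ^+ 2 * g22 - p ^+ 2 * g11)
    + (c ^+ 2 - s ^+ 2) * (p * (y1 * g11 + y2 * g12))); first by ring.
  by rewrite yy p2 py subrr !mulr0 addr0.
- transitivity (c ^+ 2 * (y1 ^+ 2 * g11 + 2 * y1 * y2 * g12 + y2 ^+ 2 * g22)
    + s ^+ 2 * (p ^+ 2 * g11)
    - 2 * c * s * (p * (y1 * g11 + y2 * g12))); first by ring.
  by rewrite yy p2 py mulr0 subr0 !mulr1.
- by rewrite -[RHS]rot /A /B /C; ring.
Qed.

End Curvatures.

(** * Orthonormal coordinates of space *)

Section Dot.
Context {R : realType}.

Lemma dotE n (u v : 'rV[R]_n) : dot u v = \sum_i u 0 i * v 0 i.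
Proof. by rewrite /dot mxE; apply: eq_bigr => i _; rewrite !mxE. Qed.

Lemma dotC n (u v : 'rV[R]_n) : dot u v = dot v u.
Proof. by rewrite !dotE; apply: eq_bigr => i _; rewrite mulrC. Qed.

Definition dotr n (e u : 'rV[R]_n) : R := dot u e.

Lemma dotr_linear n (e : 'rV[R]_n) : linear (dotr e).
Proof.
by move=> a u v; rewrite /dotr /dot mulmxDl -scalemxAl !mxE.
Qed.

HB.instance Definition _ n (e : 'rV[R]_n) :=
  GRing.isLinear.Build R 'rV[R]_n R _ _ (dotr_linear e).

Lemma dotr_continuous n (e : 'rV[R]_n) : continuous (dotr e).
Proof.
have : smooth_on_open setT (dotr e).
  have sc i : smooth_on_open setT (fun u : 'rV[R]_n => rV_coord i u * e 0 i).
    apply: (smooth_mul openT); last exact: smooth_cst.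
    exact: (smooth_lin openT (@cfun_continuous _ _ (rV_coordinates n) i)).
  apply: (smooth_congr openT _ (smooth_sum (index_enum 'I_n) openT sc)) => u _.
  by rewrite /dotr dotE.
by move=> s u; exact: (smooth_continuous s).
Qed.

Lemma dotZl n (a : R) (u v : 'rV[R]_n) : dot (a *: u) v = a * dot u v.
Proof. exact: (linearZ_LR (dotr v)). Qed.

Lemma dot_comb n (a b : R) (u v w : 'rV[R]_n) :
  dot (a *: u + b *: v) w = a * dot u w + b * dot v w.
Proof. by rewrite -![dot _ w]/(dotr w _) linearD !linearZ. Qed.

Lemma dot_gt0 (u : 'rV[R]_3) : dot u u != 0 -> 0 < dot u u.
Proof.
move=> u0; rewrite lt_def u0 dotE sumr_ge0 // => i _.
by rewrite -expr2 sqr_ge0.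
Qed.

(** Lagrange's identity: the Gram determinant is the squared length of the
    cross product. *)
Lemma gram_det_ge0 (u v : 'rV[R]_3) : 0 <= dot u u * dot v v - dot u v ^+ 2.
Proof.
rewrite !dotE !big_ord_recl !big_ord0 /=.
set i := lift ord0 ord0; set j := lift ord0 (lift ord0 ord0).
have -> : forall a b c d e f : R,
  (a * a + (b * b + (c * c + 0))) * (d * d + (e * e + (f * f + 0)))
  - (a * d + (b * e + (c * f + 0))) ^+ 2 =
  (a * e - b * d) ^+ 2 + (a * f - c * d) ^+ 2 + (b * f - c * e) ^+ 2.
  by move=> *; ring.
by rewrite !addr_ge0 ?sqr_ge0.
Qed.

(** The matrix Q with rows e0, e1, e2 satisfies Q Q^T = 1, hence
    Q^T Q = 1. *)
Lemma orthonormal_expansion (e0 e1 e2 u v : 'rV[R]_3) :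
  dot e0 e0 = 1 -> dot e1 e1 = 1 -> dot e2 e2 = 1 ->
  dot e0 e1 = 0 -> dot e0 e2 = 0 -> dot e1 e2 = 0 ->
  dot u v = dot u e0 * dot v e0 + dot u e1 * dot v e1 + dot u e2 * dot v e2.
Proof.
move=> e00 e11 e22 e01 e02 e12.
pose Q : 'M[R]_3 := \matrix_(i, j) (if i == 0 then e0 0 j else if i == 1 then e1 0 j else e2 0 j).
have QE i : row i Q = if i == 0 then e0 else if i == 1 then e1 else e2.
  by apply/rowP => j; rewrite !mxE; case: ifP => // _; case: ifP.
have QQ : Q *m Q^T = 1%:M.
  apply/matrixP => i j.
  have -> : (Q *m Q^T) i j = dot (row i Q) (row j Q).
    by rewrite dotE mxE; apply: eq_bigr => l _; rewrite !mxE.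
  rewrite !QE mxE.
  case: i => [[|[|[|//]]] ?]; case: j => [[|[|[|//]]] ?] //=; rewrite -?val_eqE /=;
    by rewrite ?e00 ?e11 ?e22 ?e01 ?e02 ?e12 // dotC ?e01 ?e02 ?e12.
have QQ' := mulmx1C QQ.
have dotQ (w : 'rV[R]_3) i : (w *m Q^T) 0 i = dot w (row i Q).
  by rewrite dotE mxE; apply: eq_bigr => l _; rewrite !mxE.
have -> : dot u v = dot (u *m Q^T) (v *m Q^T).
  by rewrite /dot trmx_mul trmxK mulmxA -[u *m _ *m _]mulmxA QQ' mulmx1.
rewrite dotE !big_ord_recl big_ord0 !dotQ !QE /= addr0 addrA.
by congr (_ + _ + _); rewrite -?val_eqE /=.
Qed.

Lemma smooth_dotr (V : normedModType R) (O : set V) n (Y : V -> 'rV[R]_n) e :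
  open O -> smooth_on_open O Y -> smooth_on_open O (fun z => dotr e (Y z)).
Proof. by move=> oO sY; exact: (smooth_lin_comp oO (@dotr_continuous n e) sY). Qed.

Lemma derive_dotr (V : normedModType R) n (Y : V -> 'rV[R]_n) e z v :
  derivable Y z v -> 'D_v (fun y => dotr e (Y y)) z = dot ('D_v Y z) e.
Proof. by move=> dY; have [_] := derive_lin_comp (@dotr_continuous n e) dY. Qed.

Lemma derive_derive_dotr (V : normedModType R) (O : set V) n (Y : V -> 'rV[R]_n) e z v w :
  open O -> O z -> smooth_on_open O Y ->
  'D_w ('D_v (fun y => dotr e (Y y))) z = dot ('D_w ('D_v Y) z) e.
Proof.
move=> oO Oz sY.
rewrite -(derive_dotr e (smooth_derivable (smooth_derive v sY) Oz)).
apply: (derive_congr _ oO _ Oz) => y /set_mem Oy.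
exact: (derive_dotr e (smooth_derivable sY Oy)).
Qed.

End Dot.

(** * Charts adapted to a point of the flow *)

(** The curvature equations carry both off-diagonal entries; these two
    lemmas merge them using symmetry of the metric and of the second form. *)
Lemma symmetric_trace (R : comPzRingType)
    (H G00 G01 G11 K00 K01 K11 g00 g01 g10 g11 k00 k01 k10 k11 : R) :
  G00 = g00 -> G01 = g01 -> G11 = g11 -> K00 = k00 -> K01 = k10 -> K11 = k11 ->
  g10 = g01 -> k10 = k01 ->
  H * (g00 * g11 - g01 * g10) = g11 * k00 - g01 * k10 + g00 * k11 - g10 * k01 ->
  H * (G00 * G11 - G01 ^+ 2) = G11 * K00 - 2 * G01 * K01 + G00 * K11.
Proof. by move=> -> -> -> -> -> -> -> <-; rewrite -expr2 => ->; ring. Qed.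

Lemma symmetric_det (R : comPzRingType)
    (K G00 G01 G11 K00 K01 K11 g00 g01 g10 g11 k00 k01 k10 k11 : R) :
  G00 = g00 -> G01 = g01 -> G11 = g11 -> K00 = k00 -> K01 = k10 -> K11 = k11 ->
  g10 = g01 -> k10 = k01 ->
  K * (g00 * g11 - g01 * g10) = k00 * k11 - k01 * k10 ->
  K * (G00 * G11 - G01 ^+ 2) = K00 * K11 - K01 ^+ 2.
Proof. by move=> -> -> -> -> -> -> -> <-; rewrite -!expr2. Qed.

(** An orthonormal basis of the tangent plane made of principal directions,
    with its components in the chart; k00, k01, k11 is the second form. *)
Lemma adapted_basis (R : realType) (Y0 Y1 n : 'rV[R]_3) (k00 k01 k11 : R) :
  dot Y0 Y0 * dot Y1 Y1 - dot Y0 Y1 * dot Y1 Y0 != 0 ->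
  dot Y0 n = 0 -> dot Y1 n = 0 ->
  exists v01 v02 v11 v12 : R,
    let e0 := v01 *: Y0 + v02 *: Y1 in let e1 := v11 *: Y0 + v12 *: Y1 in
    [/\ dot e0 e0 = 1, dot e1 e1 = 1, dot e0 e1 = 0, dot e0 n = 0 & dot e1 n = 0] /\
    v01 * v11 * k00 + (v01 * v12 + v02 * v11) * k01 + v02 * v12 * k11 = 0.
Proof.
rewrite [dot Y1 Y0]dotC -expr2 => g0 orth0 orth1.
have det0 : 0 < dot Y0 Y0 * dot Y1 Y1 - dot Y0 Y1 ^+ 2.
  by rewrite lt_def g0 gram_det_ge0.
have Y00 : 0 < dot Y0 Y0.
  apply: dot_gt0; apply/eqP => Y00; move: det0; rewrite Y00 mul0r sub0r.
  by rewrite oppr_gt0 ltNge sqr_ge0.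
have [v01 [v02 [v11 [v12 [V0 V01 V1 diag]]]]] :=
  simultaneous_diagonalization k00 k01 k11 Y00 det0.
have expand (a b c d : R) : dot (a *: Y0 + b *: Y1) (c *: Y0 + d *: Y1) =
    a * c * dot Y0 Y0 + (a * d + b * c) * dot Y0 Y1 + b * d * dot Y1 Y1.
  rewrite dot_comb [dot Y0 _]dotC [dot Y1 _]dotC !dot_comb [dot Y1 Y0]dotC; ring.
exists v01, v02, v11, v12; split=> //; split.
- by rewrite expand -[RHS]V0; ring.
- by rewrite expand -[RHS]V1; ring.
- by rewrite expand.
- by rewrite dot_comb orth0 orth1 !mulr0 addr0.
- by rewrite dot_comb orth0 orth1 !mulr0 addr0.
Qed.

Lemma dual_frame_det (R : comPzRingType) (v01 v02 v11 v12 p q r s : R) :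
  v01 * p + v02 * r = 1 -> v01 * q + v02 * s = 0 ->
  v11 * p + v12 * r = 0 -> v11 * q + v12 * s = 1 ->
  (v01 * v12 - v02 * v11) * (p * s - r * q) = 1.
Proof.
move=> F00 F01 F10 F11.
transitivity ((v01 * p + v02 * r) * (v11 * q + v12 * s)
  - (v01 * q + v02 * s) * (v11 * p + v12 * r)); first by ring.
by rewrite F00 F01 F10 F11 mul0r subr0 mulr1.
Qed.

(** The quantity in terms of H and K, with the positivity of its
    denominator that makes it smooth. *)
Lemma curvature_quantity_eq (R : realType) (a b : R) : 0 < a -> 0 < b ->
  let H := a + b in let K := a * b in
  0 < 2 * (H ^+ 2 - 3 * K) * K /\
  curvature_quantity a b * (2 * (H ^+ 2 - 3 * K) * K) =
    (H ^+ 2 - K) * H ^+ 2 * (H ^+ 2 - 4 * K).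
Proof.
move=> a0 b0 H K.
have K0 : 0 < K by rewrite mulr_gt0.
have E1 : H ^+ 2 - 3 * K = a ^+ 2 - a * b + b ^+ 2 by rewrite /H /K; ring.
have q0 : 0 < a ^+ 2 - a * b + b ^+ 2.
  have -> : a ^+ 2 - a * b + b ^+ 2 = (a - b) ^+ 2 + a * b by ring.
  by rewrite ltr_wpDl ?sqr_ge0.
have d0 : 0 < 2 * (a ^+ 2 - a * b + b ^+ 2) * (a * b) by rewrite !mulr_gt0.
split; first by rewrite E1.
rewrite E1 /curvature_quantity divfK ?gt_eqF //.
by rewrite /H /K; ring.
Qed.

Lemma quadratic_expansion (R : comPzRingType) (a b A B C G1 G2 : R) :
  G1 = a * A + b * B -> G2 = a * B + b * C ->
  a * G1 + b * G2 = a ^+ 2 * A + 2 * a * b * B + b ^+ 2 * C.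
Proof. by move=> -> ->; ring. Qed.

Section MovingSurface.
Context {R : realType}.
Let V : normedModType R := ('rV[R]_2 * R)%type.

Definition space_dir (i : 'I_2) : V := (delta_mx 0 i, 0).
Definition time_dir : V := (0, 1).
Definition Du (f : V -> R) : V -> R := 'D_(space_dir 0) f.
Definition Dv (f : V -> R) : V -> R := 'D_(space_dir 1) f.
Definition Dtime (f : V -> R) : V -> R := 'D_time_dir f.

(** At z the coordinates h0, h1, h2 are those of an orthonormal basis made of
    two tangent vectors and the normal; (v01, v02) and (v11, v12) are the chart
    components of the tangent vectors, and the last equation says that these are
    principal directions. *)
Definition frame_data (z : V) (h0 h1 h2 n0 n1 n2 : V -> R) :=
  [/\ n0 z = 0, n1 z = 0, n2 z = 1 &
    exists v01 v02 v11 v12 : R,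
    [/\ v01 * Du h0 z + v02 * Dv h0 z = 1,
        v01 * Du h1 z + v02 * Dv h1 z = 0,
        v11 * Du h0 z + v12 * Dv h0 z = 0,
        v11 * Du h1 z + v12 * Dv h1 z = 1 &
        v01 * v11 * Du (Du h2) z + (v01 * v12 + v02 * v11) * Du (Dv h2) z
          + v02 * v12 * Dv (Dv h2) z = 0]].

Variables (T : R) (M : R -> set 'rV[R]_3) (N : set 'rV[R]_3)
  (X : R -> 'rV[R]_3 -> 'rV[R]_3) (nu : R -> 'rV[R]_3 -> 'rV[R]_3)
  (l1 l2 : R -> 'rV[R]_3 -> R).
Hypotheses (X_embed : smooth_family `[0, T[ N X M)
    (nu_outer : forall t, 0 <= t < T -> outer_unit_normal (M t) (nu t))
    (l_curv : forall t, 0 <= t < T ->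
      principal_curvatures (M t) (nu t) (l1 t) (l2 t))
    (M_convex : forall t, 0 <= t < T -> strictly_convex (M t) (l1 t) (l2 t))
    (flow : forall t x, 0 <= t < T -> N x ->
      let p := X t x in
      let H := l1 t p + l2 t p in
      is_derive_within `[0, T[ (fun s => X s x) t (- (H ^+ 3) *: nu t p)).

Lemma family_point t x : 0 <= t < T -> N x -> M t (X t x).
Proof.
move=> tT Nx; case: X_embed => _ _ dX.
have [_ [G [_ <- _ _]]] : diffeo_onto N (M t) (X t) by apply: dX; rewrite /= in_itv.
by exists x.
Qed.

Section Local.
Variables (U : set 'rV[R]_2) (phi : 'rV[R]_2 -> 'rV[R]_3) (O : set V)
  (Y : V -> 'rV[R]_3) (e0 e1 e2 : 'rV[R]_3).
Hypotheses (oO : open O) (sY : smooth_on_open O Y).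
Hypothesis YX : forall u t, O (u, t) -> U u /\ (0 <= t < T -> Y (u, t) = X t (phi u)).
Hypothesis lp : forall t, 0 <= t < T -> local_param (M t) U (X t \o phi).
Hypothesis UN : forall u, U u -> N (phi u).
Hypotheses (e00 : dot e0 e0 = 1) (e11 : dot e1 e1 = 1) (e22 : dot e2 e2 = 1)
  (e01 : dot e0 e1 = 0) (e02 : dot e0 e2 = 0) (e12 : dot e1 e2 = 0).

Let h (e : 'rV[R]_3) : V -> R := fun z => dotr e (Y z).

Lemma partial_chart t u i : 0 <= t < T -> O (u, t) ->
  partial (X t \o phi) i u = 'D_(space_dir i) Y (u, t).
Proof.
by move=> tT Out; apply: (derive_slice _ oO Out) => v Ov; have [_ ->] := YX Ov.
Qed.

Lemma partial_partial_chart t u i j : 0 <= t < T -> O (u, t) ->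
  partial (partial (X t \o phi) i) j u =
  'D_(space_dir j) ('D_(space_dir i) Y) (u, t).
Proof.
by move=> tT Out; apply: (derive_slice _ oO Out) => v Ov; rewrite partial_chart.
Qed.

Lemma chart_equations t u : 0 <= t < T -> O (u, t) ->
  let p := X t (phi u) in
  let g i j := dot ('D_(space_dir i) Y (u, t)) ('D_(space_dir j) Y (u, t)) in
  let k i j := - dot ('D_(space_dir j) ('D_(space_dir i) Y) (u, t)) (nu t p) in
  [/\ g 0 0 * g 1 1 - g 0 1 * g 1 0 != 0,
    (l1 t p + l2 t p) * (g 0 0 * g 1 1 - g 0 1 * g 1 0) =
      g 1 1 * k 0 0 - g 0 1 * k 1 0 + g 0 0 * k 1 1 - g 1 0 * k 0 1,
    l1 t p * l2 t p * (g 0 0 * g 1 1 - g 0 1 * g 1 0) =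
      k 0 0 * k 1 1 - k 0 1 * k 1 0,
    dot (nu t p) (nu t p) = 1 &
    forall i, dot ('D_(space_dir i) Y (u, t)) (nu t p) = 0].
Proof.
move=> tT Out p g k.
have [Uu _] := YX Out.
have Mp : M t p by apply: family_point => //; apply: UN.
have [c1 c2] := M_convex tT Mp.
have [E1 E2 E3] := principal_curvature_equations (l_curv tT) (lp tT) Uu c1 c2
  (fun i => partial_chart i tT Out) (fun i j => partial_partial_chart i j tT Out).
have [nu1 nu2 _] := nu_outer tT Mp.
split; [exact: E1|exact: E2|exact: E3|exact: nu1|move=> i].
by rewrite -partial_chart //; exact: (nu2 _ _ u (lp tT) Uu).
Qed.

Lemma chart_flow t u : 0 <= t < T -> O (u, t) ->
  let p := X t (phi u) in
  'D_time_dir Y (u, t) = - ((l1 t p + l2 t p) ^+ 3) *: nu t p.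
Proof.
move=> tT Out p; have [Uu _] := YX Out.
have dY : derivable Y (u, t) (0, 1) by exact: smooth_derivable sY Out.
have YF s : O (u, s) -> 0 <= s < T -> Y (u, s) = X s (phi u).
  by move=> Ous sT; have [_ ->] := YX Ous.
exact: (derive_within_time tT oO Out dY YF (flow tT (UN Uu))).
Qed.

(** The equations of [chart_equations] and [chart_flow], expanded in the
    orthonormal basis e0, e1, e2. *)
Lemma chart_flow_point t u : 0 <= t < T -> O (u, t) ->
  let p := X t (phi u) in
  flow_point Du Dv Dtime (h e0) (h e1) (h e2) (l1 t p + l2 t p) (l1 t p * l2 t p)
    (dot (nu t p) e0) (dot (nu t p) e1) (dot (nu t p) e2) (u, t).
Proof.
move=> tT Out p; have [_ tr dt unit orth] := chart_equations tT Out.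
have expand a b : dot a b = dot a e0 * dot b e0 + dot a e1 * dot b e1 + dot a e2 * dot b e2.
  exact: orthonormal_expansion.
have D1 e v : 'D_v (h e) (u, t) = dot ('D_v Y (u, t)) e.
  exact: (derive_dotr e (smooth_derivable sY Out)).
have D2 e v w : 'D_w ('D_v (h e)) (u, t) = dot ('D_w ('D_v Y) (u, t)) e.
  exact: (derive_derive_dotr e v w oO Out sY).
have sh e : smooth_on_open O (h e) by exact: smooth_dotr.
have met i j : metric (h e0) (h e1) (h e2) (fun f => 'D_(space_dir i) f)
     (fun f => 'D_(space_dir j) f) (u, t)
   = dot ('D_(space_dir i) Y (u, t)) ('D_(space_dir j) Y (u, t)).
  by rewrite expand /metric !D1.
have sec i j : second_form (h e0) (h e1) (h e2) (fun f => 'D_(space_dir i) f)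
     (fun f => 'D_(space_dir j) f) (dot (nu t p) e0) (dot (nu t p) e1) (dot (nu t p) e2) (u, t)
   = - dot ('D_(space_dir i) ('D_(space_dir j) Y) (u, t)) (nu t p).
  by rewrite [in RHS]expand /second_form !D2.
have comm : dot ('D_(space_dir 0) ('D_(space_dir 1) Y) (u, t)) (nu t p) =
            dot ('D_(space_dir 1) ('D_(space_dir 0) Y) (u, t)) (nu t p).
  have C := smooth_derivations_commute oO (space_dir 0) (space_dir 1)
    (sh (nu t p)) (mem_set Out).
  have L1 := derive_derive_dotr (nu t p) (space_dir 1) (space_dir 0) oO Out sY.
  have L2 := derive_derive_dotr (nu t p) (space_dir 0) (space_dir 1) oO Out sY.
  exact: etrans (esym L1) (etrans C L2).
set n0 := dot (nu t p) e0; set n1 := dot (nu t p) e1; set n2 := dot (nu t p) e2.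
have m00 : metric (h e0) (h e1) (h e2) Du Du (u, t) =
    dot ('D_(space_dir 0) Y (u, t)) ('D_(space_dir 0) Y (u, t)) := met 0 0.
have m01 : metric (h e0) (h e1) (h e2) Du Dv (u, t) =
    dot ('D_(space_dir 0) Y (u, t)) ('D_(space_dir 1) Y (u, t)) := met 0 1.
have m11 : metric (h e0) (h e1) (h e2) Dv Dv (u, t) =
    dot ('D_(space_dir 1) Y (u, t)) ('D_(space_dir 1) Y (u, t)) := met 1 1.
have s00 : second_form (h e0) (h e1) (h e2) Du Du n0 n1 n2 (u, t) =
    - dot ('D_(space_dir 0) ('D_(space_dir 0) Y) (u, t)) (nu t p) := sec 0 0.
have s01 : second_form (h e0) (h e1) (h e2) Du Dv n0 n1 n2 (u, t) =
    - dot ('D_(space_dir 0) ('D_(space_dir 1) Y) (u, t)) (nu t p) := sec 0 1.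
have s11 : second_form (h e0) (h e1) (h e2) Dv Dv n0 n1 n2 (u, t) =
    - dot ('D_(space_dir 1) ('D_(space_dir 1) Y) (u, t)) (nu t p) := sec 1 1.
have gC := dotC ('D_(space_dir 1) Y (u, t)) ('D_(space_dir 0) Y (u, t)).
have kC := congr1 -%R comm.
have Dt e : dot ('D_time_dir Y (u, t)) e = - (l1 t p + l2 t p) ^+ 3 * dot (nu t p) e.
  by rewrite (chart_flow tT Out) dotZl.
split.
- by rewrite -[RHS]unit [in RHS]expand /n0 /n1 /n2; ring.
- by rewrite -[RHS](orth 0) [RHS]expand; congr (_ * _ + _ * _ + _ * _); exact: D1.
- by rewrite -[RHS](orth 1) [RHS]expand; congr (_ * _ + _ * _ + _ * _); exact: D1.
- exact: (symmetric_trace m00 m01 m11 s00 s01 s11 gC kC tr).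
- exact: (symmetric_det m00 m01 m11 s00 s01 s11 gC kC dt).
- exact: etrans (D1 e0 time_dir) (Dt e0).
- exact: etrans (D1 e1 time_dir) (Dt e1).
- exact: etrans (D1 e2 time_dir) (Dt e2).
Qed.

End Local.

Definition mean_at (phi : 'rV[R]_2 -> 'rV[R]_3) (z : V) : R :=
  l1 z.2 (X z.2 (phi z.1)) + l2 z.2 (X z.2 (phi z.1)).

Definition gauss_at (phi : 'rV[R]_2 -> 'rV[R]_3) (z : V) : R :=
  l1 z.2 (X z.2 (phi z.1)) * l2 z.2 (X z.2 (phi z.1)).

(** A chart of the moving surface near (x0, t0) on which the coordinates
    h0, h1 of the position along the tangent plane at (x0, t0) have nonzero
    Jacobian, k being its inverse, together with what the maximum principle uses
    of the geometry. *)
Record adapted_chart (t0 : R) (x0 : 'rV[R]_3) (phi : 'rV[R]_2 -> 'rV[R]_3)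
    (psi : 'rV[R]_3 -> 'rV[R]_2) (O : set V) (h0 h1 h2 k n0 n1 n2 : V -> R) := {
  ac_open : open O;
  ac_mem : O (psi x0, t0);
  ac_psi : phi (psi x0) = x0;
  ac_near : forall A, nbhs (psi x0) A ->
    \forall x \near x0, N x -> A (psi x) /\ phi (psi x) = x;
  ac_N : forall u t, O (u, t) -> N (phi u);
  ac_h0 : smooth_on_open O h0;
  ac_h1 : smooth_on_open O h1;
  ac_h2 : smooth_on_open O h2;
  ac_k : smooth_on_open O k;
  ac_kJ : {in O, forall z, k z * (Du h0 z * Dv h1 z - Dv h0 z * Du h1 z) = 1};
  ac_flow : forall u t, O (u, t) -> 0 <= t < T ->
    flow_point Du Dv Dtime h0 h1 h2 (mean_at phi (u, t)) (gauss_at phi (u, t))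
      (n0 (u, t)) (n1 (u, t)) (n2 (u, t)) (u, t);
  ac_frame : frame_data (psi x0, t0) h0 h1 h2 n0 n1 n2 }.

(** The orthonormal basis is built once from the tangent plane and the
    normal at (x0, t0) and then kept fixed; the Jacobian of (h0, h1) is nonzero
    at (x0, t0) by [dual_frame_det], hence on a smaller open set. *)
Lemma adapted_chart_exists t0 x0 : 0 <= t0 < T -> N x0 ->
  exists phi psi O h0 h1 h2 k n0 n1 n2,
    adapted_chart t0 x0 phi psi O h0 h1 h2 k n0 n1 n2.
Proof.
move=> tT Nx0.
have It0 : [set` `[0, T[] t0 by rewrite /= in_itv.
have [U [phi [psi [ O [Y [ [ oO O0] sY YX' [lp' UN] [psi0 psinear] ] ] ] ] ] ] :=
  moving_chart X_embed It0 Nx0.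
have YX u t : O (u, t) -> U u /\ (0 <= t < T -> Y (u, t) = X t (phi u)).
  move=> /YX'[Uu Yut]; split=> // tT'; apply: Yut; by rewrite /= in_itv.
have lp t : 0 <= t < T -> local_param (M t) U (X t \o phi).
  by move=> tT'; apply: lp'; rewrite /= in_itv.
pose z0 : V := (psi x0, t0).
have [g0 _ _ unit orth] := chart_equations oO YX lp UN tT O0.
set n := nu t0 _ in unit orth.
have [v01 [v02 [v11 [v12 [[E00 E11 E01 E02 E12] diag]]]]] := adapted_basis
  (dot ('D_(space_dir 0) ('D_(space_dir 0) Y) z0) n)
  (dot ('D_(space_dir 0) ('D_(space_dir 1) Y) z0) n)
  (dot ('D_(space_dir 1) ('D_(space_dir 1) Y) z0) n) g0 (orth 0) (orth 1).
set e0 := (X in dot X n = 0) in E02; set e1 := (X in dot X n = 0) in E12.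
pose h (e : 'rV[R]_3) (z : V) : R := dotr e (Y z).
have D1 e v : 'D_v (h e) z0 = dot ('D_v Y z0) e.
  exact: (derive_dotr e (smooth_derivable sY O0)).
have D2 e v w : 'D_w ('D_v (h e)) z0 = dot ('D_w ('D_v Y) z0) e.
  exact: (derive_derive_dotr e v w oO O0 sY).
have sh e : smooth_on_open O (h e) by exact: smooth_dotr.
pose J z : R := Du (h e0) z * Dv (h e1) z - Dv (h e0) z * Du (h e1) z.
have sJ : smooth_on_open O J.
  apply: (smooth_add oO); first by apply: (smooth_mul oO); exact: smooth_derive.
  by apply: (smooth_opp oO); apply: (smooth_mul oO); exact: smooth_derive.
have frame a b e : a * Du (h e) z0 + b * Dv (h e) z0 =
    dot (a *: 'D_(space_dir 0) Y z0 + b *: 'D_(space_dir 1) Y z0) e.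
  exact: etrans (f_equal2 (fun x y => a * x + b * y) (D1 e (space_dir 0))
    (D1 e (space_dir 1))) (esym (dot_comb a b _ _ e)).
have F00 : v01 * Du (h e0) z0 + v02 * Dv (h e0) z0 = 1 := etrans (frame v01 v02 e0) E00.
have F01 : v01 * Du (h e1) z0 + v02 * Dv (h e1) z0 = 0 := etrans (frame v01 v02 e1) E01.
have F10 : v11 * Du (h e0) z0 + v12 * Dv (h e0) z0 = 0.
  exact: etrans (frame v11 v12 e0) (etrans (dotC e1 e0) E01).
have F11 : v11 * Du (h e1) z0 + v12 * Dv (h e1) z0 = 1 := etrans (frame v11 v12 e1) E11.
have J0 : J z0 != 0.
  have := dual_frame_det F00 F01 F10 F11; rewrite -/(J z0).
  apply: contra_eqN => /eqP ->.
  by rewrite mulr0 eq_sym oner_eq0.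
pose O' := O `&` (J @^-1` [set x | x != 0])^°.
have OO' : O' `<=` O `&` [set z | J z != 0].
  by move=> z [Oz]; move/interior_subset.
have oO' : open O' by apply: openI => //; exact: open_interior.
have O0' : O' z0.
  split=> //; have cJ := smooth_continuous sJ O0.
  by apply: cJ; apply: open_nbhs_nbhs; split => //; exact: open_neq.
exists phi, psi, O', (h e0), (h e1), (h n), (fun z => (J z)^-1),
  (fun z => dot (nu z.2 (X z.2 (phi z.1))) e0),
  (fun z => dot (nu z.2 (X z.2 (phi z.1))) e1),
  (fun z => dot (nu z.2 (X z.2 (phi z.1))) n).
split=> //.
- by move=> u t /OO'[/YX[Uu _] _]; apply: UN.
- by apply: smooth_subset (sh _) => z /OO'[].
- by apply: smooth_subset (sh _) => z /OO'[].
- by apply: smooth_subset (sh _) => z /OO'[].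
- apply: (smooth_inv oO'); first by move=> z /OO'[].
  by apply: smooth_subset sJ => z /OO'[].
- by move=> z /set_mem /OO'[_ Jz]; rewrite mulVf.
- move=> u t /OO'[Out _] tT'.
  exact: (chart_flow_point oO sY YX lp UN E00 E11 unit E01 E02 E12 tT' Out).
- split=> /=; rewrite ?[dot (nu _ _) _]dotC //.
  exists v01, v02, v11, v12; split; [exact: F00|exact: F01|exact: F10|exact: F11|].
  have dd00 : Du (Du (h n)) z0 = _ := D2 n (space_dir 0) (space_dir 0).
  have dd01 : Du (Dv (h n)) z0 = _ := D2 n (space_dir 1) (space_dir 0).
  have dd11 : Dv (Dv (h n)) z0 = _ := D2 n (space_dir 1) (space_dir 1).
  apply: etrans diag; exact: (f_equal2 +%R (f_equal2 +%R (congr1 _ dd00) (congr1 _ dd01)) (congr1 _ dd11)).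
Qed.

(** * The maximum principle *)

Let w (t : R) (x : 'rV[R]_3) : R :=
  curvature_quantity (l1 t (X t x)) (l2 t (X t x)).

Lemma curvatures_gt0 t x : 0 <= t < T -> N x ->
  0 < l1 t (X t x) /\ 0 < l2 t (X t x).
Proof. by move=> tT Nx; apply: M_convex tT _ (family_point tT Nx). Qed.

Section Chart.
Variables (t0 : R) (x0 : 'rV[R]_3) (phi : 'rV[R]_2 -> 'rV[R]_3)
  (psi : 'rV[R]_3 -> 'rV[R]_2) (O : set V) (h0 h1 h2 k n0 n1 n2 : V -> R).
Hypothesis ac : adapted_chart t0 x0 phi psi O h0 h1 h2 k n0 n1 n2.

Let f z : R := (-1) * h2 z.
Let F0 := E0 Du Dv Dtime h1 k.
Let F1 := E1 Du Dv Dtime h0 k.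
Let D := gradD (F0 f) (F1 f).
Let Nn := traceN (F0 f) (F1 f) (F0 (F0 f)) (F0 (F1 f)) (F1 (F1 f)).
Let L := detL (F0 (F0 f)) (F0 (F1 f)) (F1 (F1 f)).

Definition chart_level (c : R) : V -> R := levelZ c D Nn L.

Let S : set (V -> R) := [set g | smooth_on_open O g].
Let oO : open O := ac_open ac.
Let aS : function_algebra S := smooth_function_algebra oO.
Let d1 : derivation O S Du := smooth_derivation oO (space_dir 0).
Let d2 : derivation O S Dv := smooth_derivation oO (space_dir 1).
Let dt : derivation O S Dtime := smooth_derivation oO time_dir.
Let comm12 g : S g -> {in O, Du (Dv g) =1 Dv (Du g)}.
Proof. exact: (smooth_derivations_commute oO (space_dir 0) (space_dir 1)). Qed.
Let comm1t g : S g -> {in O, Dtime (Du g) =1 Du (Dtime g)}.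
Proof. exact: (smooth_derivations_commute oO time_dir (space_dir 0)). Qed.
Let comm2t g : S g -> {in O, Dtime (Dv g) =1 Dv (Dtime g)}.
Proof. exact: (smooth_derivations_commute oO time_dir (space_dir 1)). Qed.
Let Sh0 : S h0 := ac_h0 ac.
Let Sh1 : S h1 := ac_h1 ac.
Let Sh2 : S h2 := ac_h2 ac.
Let Sk : S k := ac_k ac.

Lemma chart_level_smooth c : smooth_on_open O (chart_level c).
Proof.
exact: (level_alg aS d1 d2 dt Sh0 Sh1 Sh2 Sk c).
Qed.

(** The positive factor q is the difference of the levels 0 and 1 of the
    family Z, which is affine in c; this shows that q is smooth, and so is the
    quotient expressing w. *)
Lemma chart_level_eq c u t : O (u, t) -> 0 <= t < T ->
  exists2 q, 0 < q & chart_level c (u, t) = q * (w t (phi u) - c) /\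
    q = chart_level 0 (u, t) - chart_level 1 (u, t).
Proof.
move=> Out tT; have Nx := ac_N ac Out.
have [a0 b0] := curvatures_gt0 tT Nx.
have [den0 wE] := curvature_quantity_eq a0 b0.
have LG := level_graph aS d1 d2 dt comm12 comm1t comm2t Sh0 Sh1 Sh2 Sk
  (ac_kJ ac) Out (ac_flow ac Out tT) _ wE.
exists (D (u, t) ^+ 9 * (2 * (mean_at phi (u, t) ^+ 2
   - 3 * gauss_at phi (u, t)) * gauss_at phi (u, t))).
  apply: mulr_gt0 den0; apply: exprn_gt0.
  exact: (gradD_gt0 Du Dv Dtime h0 h1 h2 k).
have E e : chart_level e (u, t) = D (u, t) ^+ 9 * (2 * (mean_at phi (u, t) ^+ 2
   - 3 * gauss_at phi (u, t)) * gauss_at phi (u, t)) * (w t (phi u) - e).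
  exact: LG.
split; first exact: E.
by rewrite (E 0) (E 1); move: (_ * (_ * _)) (w t _) => *; ring.
Qed.

Lemma derive_combination (a b : R) (g : V -> R) y : O y -> S g ->
  'D_(a *: space_dir 0 + b *: space_dir 1) g y = a * Du g y + b * Dv g y.
Proof.
move=> Oy sg.
have dg := smooth_differentiable (pair_coordinates (rV_coordinates 2)) oO Oy sg.
by rewrite /Du /Dv !deriveE // linearD !linearZ.
Qed.

Lemma second_derive_combination (a b : R) (g : V -> R) y : O y -> S g ->
  'D_(a *: space_dir 0 + b *: space_dir 1)
    ('D_(a *: space_dir 0 + b *: space_dir 1) g) y =
  a ^+ 2 * Du (Du g) y + 2 * a * b * Du (Dv g) y + b ^+ 2 * Dv (Dv g) y.
Proof.
move=> Oy sg.
pose G z : R := a * Du g z + b * Dv g z.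
have [S1 S2] : S (Du g) /\ S (Dv g).
  by split; [exact: (derivation_alg d1)|exact: (derivation_alg d2)].
have SG : S G.
  exact: (alg_add aS (alg_mul aS (alg_cst aS a) S1) (alg_mul aS (alg_cst aS b) S2)).
pose v : V := a *: space_dir 0 + b *: space_dir 1.
have first_der : {in O, 'D_v g =1 G}.
  by move=> z /set_mem Oz; exact: derive_combination.
have DG : 'D_v ('D_v g) y = 'D_v G y := derive_congr v oO first_der Oy.
have GE : 'D_v G y = a * Du G y + b * Dv G y := derive_combination a b Oy SG.
have G1 : Du G y = a * Du (Du g) y + b * Du (Dv g) y.
  exact: (derivation_linear a b aS d1 S1 S2 Oy).
have G2 : Dv G y = a * Du (Dv g) y + b * Dv (Dv g) y.
  rewrite (comm12 sg (mem_set Oy)).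
  exact: (derivation_linear a b aS d2 S1 S2 Oy).
exact: (etrans DG (etrans GE (quadratic_expansion G1 G2))).
Qed.

(** In the chart, Z is q (w - c) with q > 0.  Maximality of w in space makes
    Z maximal along lines in space, so [level_dt_le0] gives Dt Z <= 0.  If w were
    to grow at rate e up to t0, then Z <= (q0 / 2) e h for times t0 + h, h <= 0,
    where q0 is the value of q at the point, and Dt Z would be positive. *)
Lemma no_growth_in_chart (e : R) :
  (forall u t, O (u, t) -> 0 <= t < T) -> 0 < e -> N x0 ->
  (forall x, N x -> w t0 x <= w t0 x0) ->
  (\forall s \near t0, s <= t0 -> w s x0 <= w t0 x0 - e * (t0 - s)) -> False.
Proof.
move=> Opos e0 Nx0 space time.
pose z0 : V := (psi x0, t0); have O0 : O z0 := ac_mem ac.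
have phi0 := ac_psi ac.
pose c := w t0 (phi (psi x0)).
pose Z := chart_level c; have sZ : S Z := chart_level_smooth c.
have level u t : O (u, t) -> exists2 q, 0 < q & Z (u, t) = q * (w t (phi u) - c) /\
    q = chart_level 0 (u, t) - chart_level 1 (u, t).
  by move=> Out; apply: chart_level_eq => //; exact: Opos Out.
have Zz0 : Z z0 = 0.
  by have [q _ [-> _]] := level _ _ O0; rewrite subrr mulr0.
have Zmax a b : \forall h \near (0 : R),
    Z (h *: (a *: space_dir 0 + b *: space_dir 1) + z0) <= Z z0.
  set v := _ + b *: _.
  have line : \forall h \near (0 : R), O (h *: v + z0).
    have cv : h *: v + z0 @[h --> (0 : R)] --> z0.
      have : h *: v + z0 @[h --> (0 : R)] --> 0 *: v + z0.
        by apply: cvgD; [apply: cvgZr_tmp; exact: cvg_id|exact: cvg_cst].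
      by rewrite scale0r add0r.
    by apply: (cv O); apply: open_nbhs_nbhs.
  apply: filterS line => h Oh; rewrite Zz0.
  have E : h *: v + z0 = ((h *: v + z0).1, t0).
    apply: injective_projections => //=.
    by rewrite !scaler0 addr0 scaler0 add0r.
  rewrite E in Oh *; have [q q0 [-> _]] := level _ _ Oh.
  rewrite pmulr_rle0 // subr_le0 /c phi0; apply: space.
  exact: ac_N ac _ _ Oh.
have max v : (exists a b, v = a *: space_dir 0 + b *: space_dir 1) ->
    'D_v Z z0 = 0 /\ 'D_v ('D_v Z) z0 <= 0.
  by move=> [a [b ->]]; apply: (local_max_along oO O0 sZ); exact: Zmax.
have Z1 : Du Z z0 = 0.
  by have [] := max (space_dir 0) _; first by exists 1, 0; rewrite scale1r scale0r addr0.
have Z2 : Dv Z z0 = 0.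
  by have [] := max (space_dir 1) _; first by exists 0, 1; rewrite scale1r scale0r add0r.
have Zconc a b : a ^+ 2 * Du (Du Z) z0 + 2 * a * b * Du (Dv Z) z0
    + b ^+ 2 * Dv (Dv Z) z0 <= 0.
  rewrite -second_derive_combination //.
  by have [_] := max (a *: space_dir 0 + b *: space_dir 1) (ex_intro _ a (ex_intro _ b erefl)).
have [n0z n1z n2z [v01 [v02 [v11 [v12 [e00 e01 e10 e11 diag]]]]]] := ac_frame ac.
have tT0 := Opos _ _ O0.
have [a0 b0] := curvatures_gt0 tT0 (ac_N ac O0).
have H0 : 0 < mean_at phi z0 by exact: addr_gt0 a0 b0.
have K0 : 0 < gauss_at phi z0 by exact: mulr_gt0 a0 b0.
have fp : {in O, forall y, flow_point Du Dv Dtime h0 h1 h2 (mean_at phi y)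
    (gauss_at phi y) (n0 y) (n1 y) (n2 y) y}.
  by move=> [u t] /set_mem Out; exact: (ac_flow ac Out (Opos _ _ Out)).
pose W (y : V) := w y.2 (phi y.1).
have wE : {in O, forall y, W y * (2 * (mean_at phi y ^+ 2
     - 3 * gauss_at phi y) * gauss_at phi y) =
    (mean_at phi y ^+ 2 - gauss_at phi y) * mean_at phi y ^+ 2
     * (mean_at phi y ^+ 2 - 4 * gauss_at phi y)}.
  move=> [u t] /set_mem Out.
  have [a1 b1] := curvatures_gt0 (Opos _ _ Out) (ac_N ac Out).
  by have [_] := curvature_quantity_eq a1 b1.
have dtZ : Dtime Z z0 <= 0.
  exact: (level_dt_le0 aS d1 d2 dt comm12 comm1t comm2t Sh0 Sh1 Sh2 Sk (ac_kJ ac)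
    O0 fp H0 K0 wE n0z n1z n2z e00 e01 e10 e11 diag Z1 Z2 Zconc).
pose Q y := chart_level 0 y - chart_level 1 y.
have [q0 q0p [_ q0E]] := level _ _ O0.
have cQ : {for z0, continuous Q}.
  by apply: continuousB; apply: smooth_continuous O0; exact: chart_level_smooth.
have line : h *: time_dir + z0 @[h --> (0 : R)] --> z0.
  have : h *: time_dir + z0 @[h --> (0 : R)] --> 0 *: time_dir + z0.
    by apply: cvgD; [apply: cvgZr_tmp; exact: cvg_id|exact: cvg_cst].
  by rewrite scale0r add0r.
have nQ : \forall h \near (0 : R), q0 / 2 < Q (h *: time_dir + z0).
  have q0Q : q0 / 2 < Q z0.
    by rewrite (_ : Q z0 = q0) // ltr_pdivrMr // ltr_pMr // ltr1n.
  have nQ0 : nbhs (Q z0) [set x | q0 / 2 < x].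
    exact: (open_nbhs_nbhs (conj (@open_gt _ _) q0Q)).
  exact: (line _ (cQ _ nQ0)).
have nO : \forall h \near (0 : R), O (h *: time_dir + z0).
  by apply: (line O); apply: open_nbhs_nbhs.
have nt : \forall h \near (0 : R), h + t0 <= t0 ->
    w (h + t0) x0 <= w t0 x0 - e * (t0 - (h + t0)).
  have ct : h + t0 @[h --> (0 : R)] --> t0.
    have : h + t0 @[h --> (0 : R)] --> 0 + t0.
      by apply: cvgD; [exact: cvg_id|exact: cvg_cst].
    by rewrite add0r.
  exact: (ct _ time).
have E h : h *: time_dir + z0 = (psi x0, h + t0).
  apply: injective_projections => /=; first by rewrite scaler0 add0r.
  by rewrite [h *: 1]mulr1.
have growth : \forall h \near (0 : R), h <= 0 ->
    Z (h *: time_dir + z0) <= Z (0 *: time_dir + z0) + (q0 / 2 * e) * h.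
  apply: filterS (filterI nQ (filterI nO nt)) => h [hQ [hO ht]] h0'.
  rewrite scale0r add0r Zz0 add0r.
  move: hQ hO; rewrite !E => hQ hO; have [q qp [-> qE]] := level _ _ hO.
  rewrite /Q -qE in hQ.
  have ht0 : h + t0 <= t0 by rewrite gerDr.
  have := ht ht0; rewrite phi0 /c phi0 => ht'.
  apply: (@le_trans _ _ (q * (e * h))).
    rewrite ler_wpM2l ?(ltW qp) // lerBlDl; apply: le_trans ht' _.
    by rewrite le_eqVlt; apply/orP; left; apply/eqP; ring.
  rewrite -mulrA; apply: ler_wnM2r; last exact: ltW.
  by rewrite mulr_ge0_le0 // ltW.
have dline : derivable (fun h : R => Z (h *: time_dir + z0)) 0 1.
  exact: (proj1 (derivable1P Z z0 time_dir) (smooth_derivable sZ O0)).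
have := left_growth dline growth; rewrite -derive_line.
move=> /le_trans /(_ dtZ); apply/negP; rewrite -ltNge.
by rewrite mulr_gt0 // divr_gt0.
Qed.

End Chart.

Lemma adapted_chart_subset t0 x0 phi psi (O O' : set V)
    (h0 h1 h2 k n0 n1 n2 : V -> R) :
  adapted_chart t0 x0 phi psi O h0 h1 h2 k n0 n1 n2 ->
  open O' -> O' `<=` O -> O' (psi x0, t0) ->
  adapted_chart t0 x0 phi psi O' h0 h1 h2 k n0 n1 n2.
Proof.
move=> ac oO' OO' O0; split=> //.
- exact: ac_psi ac.
- exact: ac_near ac.
- by move=> u t /OO'; exact: (ac_N ac).
- exact: smooth_subset OO' (ac_h0 ac).
- exact: smooth_subset OO' (ac_h1 ac).
- exact: smooth_subset OO' (ac_h2 ac).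
- exact: smooth_subset OO' (ac_k ac).
- by move=> z /set_mem /OO' Oz; apply: (ac_kJ ac); rewrite inE.
- by move=> u t /OO' Out; exact: (ac_flow ac Out).
- exact: ac_frame ac.
Qed.

(** In an adapted chart w is a quotient of smooth functions, namely the
    level 0 divided by the difference of the levels 0 and 1. *)
Lemma quantity_continuous t0 x0 (e : R) : 0 <= t0 < T -> N x0 -> 0 < e ->
  \forall z \near ((x0, t0) : 'rV[R]_3 * R),
    N z.1 -> 0 <= z.2 < T -> `|w t0 x0 - w z.2 z.1| < e.
Proof.
move=> tT Nx0 e0.
have [phi [psi [ O [h0 [h1 [h2 [k [n0 [n1 [n2 ac]]]]]]]]]] :=
  adapted_chart_exists tT Nx0.
pose A := chart_level h0 h1 h2 k 0; pose B := chart_level h0 h1 h2 k 1.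
have level u t : O (u, t) -> 0 <= t < T ->
    A (u, t) - B (u, t) != 0 /\ A (u, t) / (A (u, t) - B (u, t)) = w t (phi u).
  move=> Out tT'.
  have [q q0 [AE qE]] := chart_level_eq ac 0 Out tT'.
  have AB : A (u, t) - B (u, t) = q := esym qE.
  rewrite AB gt_eqF //; split=> //.
  by rewrite [A (u, t)]AE subr0 mulrC mulKf // gt_eqF.
have O0 := ac_mem ac; have phi0 := ac_psi ac.
have [AB0 W0] := level _ _ O0 tT; rewrite phi0 in W0.
pose G y := A y / (A y - B y).
have cA := smooth_continuous (chart_level_smooth ac 0) O0.
have cB := smooth_continuous (chart_level_smooth ac 1) O0.
have cG : {for (psi x0, t0), continuous G}.
  apply: continuousM => //; apply: continuousV => //.
  exact: continuousB.
have n1' : \forall y \near (psi x0, t0), `|G (psi x0, t0) - G y| < e.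
  by move/cvgrPdist_lt : cG; apply.
have n2' : \forall y \near (psi x0, t0), O y.
  by apply: open_nbhs_nbhs; split => //; exact: ac_open ac.
have [[A1 A2] /= [nA1 nA2] A12] := filterI n1' n2'.
have near1 := ac_near ac nA1.
exists ([set x | N x -> A1 (psi x) /\ phi (psi x) = x], A2) => //=.
move=> [x t] /= [xA tA2] Nx tT'.
have [A1x phix] := xA Nx.
have [close Oxt] := A12 (psi x, t) (conj A1x tA2).
have [_ Wx] := level _ _ Oxt tT'.
by move: close; rewrite /G W0 Wx phix.
Qed.

(** As t0 > 0, the chart can be cut down to times in (0, T), where the flow
    equations hold throughout. *)
Lemma no_growth t0 x0 (e : R) : 0 < t0 < T -> N x0 -> 0 < e ->
  (forall x, N x -> w t0 x <= w t0 x0) ->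
  (\forall s \near t0, s <= t0 -> w s x0 <= w t0 x0 - e * (t0 - s)) -> False.
Proof.
move=> /andP[t00 t0T] Nx0 e0 space time.
have tT : 0 <= t0 < T by rewrite (ltW t00).
have [phi [psi [ O [h0 [h1 [h2 [k [n0 [n1 [n2 ac]]]]]]]]]] :=
  adapted_chart_exists tT Nx0.
pose O' := O `&` (@snd _ R @^-1` [set t | 0 < t < T]).
have osnd : open (@snd 'rV[R]_2 R @^-1` [set t | 0 < t < T]).
  apply: open_comp; first by move=> z _; exact: cvg_snd.
  rewrite (_ : [set t | 0 < t < T] = [set t | 0 < t] `&` [set t | t < T]).
    by apply: openI; [exact: open_gt|exact: open_lt].
  by apply/seteqP; split=> t /= => [/andP[]|[-> ->]].
have ac' : adapted_chart t0 x0 phi psi O' h0 h1 h2 k n0 n1 n2.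
  apply: (adapted_chart_subset ac).
  - exact: openI (ac_open ac) osnd.
  - by move=> z [].
  - by split; [exact: ac_mem ac|rewrite /= t00].
apply: (no_growth_in_chart ac' _ e0 Nx0 space time).
by move=> u t [_ /= /andP[/ltW -> ->]].
Qed.

(** For e = 0 and s = t this is the existence of the maximum at a fixed time. *)
Lemma quantity_max s t : 0 <= s -> s <= t -> t < T -> forall e : R,
  exists x0 t0, [/\ N x0, s <= t0 <= t &
    forall x r, N x -> s <= r <= t -> w r x - e * r <= w t0 x0 - e * t0].
Proof.
move=> s0 st tT e.
have cN : compact N by case: X_embed => -[].
have [x1 Nx1] : N !=set0 by case: X_embed => -[].
pose K : set ('rV[R]_3 * R) := N `*` [set` `[s, t]].
have cK : compact K by apply: compact_setX => //; exact: segment_compact.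
have K0 : K !=set0 by exists (x1, s); split=> //=; rewrite in_itv /= lexx.
pose F (z : 'rV[R]_3 * R) := w z.2 z.1 - e * z.2.
have cF : {within K, continuous F}.
  apply/subspace_continuousP => -[x0 t0] [/= Nx0]; rewrite in_itv /= => /andP[st0 t0t].
  have t0T : 0 <= t0 < T by rewrite (le_trans s0 st0) (le_lt_trans t0t tT).
  apply: cvgB; last first.
    apply: cvg_within_filter; apply: cvgM; [exact: cvg_cst|exact: cvg_snd].
  apply/cvgrPdist_lt => d d0.
  apply: filterS (quantity_continuous t0T Nx0 d0) => -[x r] /= close [/= Nx].
  rewrite in_itv /= => /andP[sr rt]; apply: close => //.
  by rewrite (le_trans s0 sr) (le_lt_trans rt tT).
have [[x0 t0] /set_mem [/= Nx0 t0I] Fmax] := compact_EVT_max K0 cK cF.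
exists x0, t0; split=> //.
move=> x r Nx rI; apply: (Fmax (x, r)).
by rewrite inE; split=> //=; rewrite in_itv.
Qed.

(** The rate e is half the average growth rate, so that w - e t
    is still larger at time t than at time s; its maximum over the whole slab
    is then not attained at time s. *)
Lemma quantity_nonincreasing s t x y : 0 <= s -> s <= t -> t < T -> N y ->
  (forall z, N z -> w s z <= w s x) -> w t y <= w s x.
Proof.
move=> s0 st tT Ny xmax; rewrite leNgt; apply/negP => gap.
have slt : s < t.
  by rewrite lt_def st andbT; apply: contraTneq gap => ->; rewrite -leNgt xmax.
pose e := (w t y - w s x) / (2 * (t - s)).
have e0 : 0 < e by rewrite divr_gt0 ?mulr_gt0 ?subr_gt0.
have [x0 [t0 [Nx0 /andP[st0 t0t] max]]] := quantity_max s0 st tT e.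
have t0s : s < t0.
  rewrite lt_def st0 andbT; apply/negP => /eqP t0s.
  have := max y t Ny; rewrite st lexx => /(_ isT); rewrite t0s.
  have := xmax x0 Nx0.
  have : e * (t - s) = (w t y - w s x) / 2.
    rewrite /e; move: (w t y - w s x) => g; field.
    by rewrite subr_eq0 gt_eqF.
  by move: gap; lra.
apply: (@no_growth t0 x0 e _ Nx0 e0).
- by rewrite (le_lt_trans s0 t0s) (le_lt_trans t0t tT).
- move=> z Nz; have := max z t0 Nz; rewrite st0 t0t => /(_ isT).
  by rewrite lerD2r.
- have ns : \forall r \near t0, s < r by apply: open_nbhs_nbhs; split => //; exact: open_gt.
  apply: filterS ns => r sr rt0.
  have := max x0 r Nx0; rewrite (ltW sr) (le_trans rt0 t0t) => /(_ isT); lra.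
Qed.

End MovingSurface.

Theorem theorem5p2 (R : realType) (T : R)
    (M : R -> set 'rV[R]_3)
    (N : set 'rV[R]_3) (X : R -> 'rV[R]_3 -> 'rV[R]_3)
    (nu : R -> 'rV[R]_3 -> 'rV[R]_3)
    (l1 l2 : R -> 'rV[R]_3 -> R)
    (M_closed : forall t, 0 <= t < T -> closed_surface (M t))
    (X_embed : smooth_family `[0, T[ N X M)
    (nu_outer : forall t, 0 <= t < T -> outer_unit_normal (M t) (nu t))
    (l_curv : forall t, 0 <= t < T ->
      principal_curvatures (M t) (nu t) (l1 t) (l2 t))
    (M_convex : forall t, 0 <= t < T -> strictly_convex (M t) (l1 t) (l2 t))
    (flow : forall t x, 0 <= t < T -> N x ->
      let p := X t x in
      let H := l1 t p + l2 t p in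
      is_derive_within `[0, T[ (fun s => X s x) t (- (H ^+ 3) *: nu t p)) :
  exists m : R -> R,
    (forall t, 0 <= t < T ->
      is_max [set curvature_quantity (l1 t p) (l2 t p) | p in M t] (m t)) /\
    (forall s t, 0 <= s -> s <= t -> t < T -> m t <= m s).
Proof.
pose w (t : R) (x : 'rV[R]_3) : R :=
  curvature_quantity (l1 t (X t x)) (l2 t (X t x)).
have argmax t : exists x, 0 <= t < T -> N x /\ forall z, N z -> w t z <= w t x.
  have [tT|tT] := boolP (0 <= t < T); last by exists 0.
  have /andP[t0 t1] := tT.
  have [x [r [Nx /andP[tr rt] max]]] :=
    quantity_max X_embed nu_outer l_curv M_convex flow t0 (lexx t) t1 0.
  have rE : r = t by apply/eqP; rewrite eq_le rt tr.
  exists x => _; split=> // z Nz.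
  by have := max z t Nz; rewrite lexx rE !mul0r !subr0 => /(_ isT).
have [x xmax] := choice argmax.
exists (fun t => w t (x t)); split=> [t tT|s t s0 st tT].
  have [Nx max] := xmax t tT.
  split; first by exists (X t (x t)); first exact: (family_point X_embed tT Nx).
  move=> _ [p Mp <-].
  have [_ _ dX] := X_embed.
  have [_ [_ [_ XN _ _]]] : diffeo_onto N (M t) (X t) by apply: dX; rewrite /= in_itv.
  by move: Mp; rewrite -XN => -[z Nz <-]; exact: max.
have sT : 0 <= s < T by rewrite s0 (le_lt_trans st tT).
have tT' : 0 <= t < T by rewrite (le_trans s0 st).
apply: (quantity_nonincreasing X_embed nu_outer l_curv M_convex flow s0 st tT).
  by have [] := xmax t tT'.
by have [] := xmax s sT.
Qed.
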